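(* For every $n\ge2$, $\widehat\Delta_n\subseteq[\mathrm{UVAL}_n]$, i.e. every promise problem in $\widehat{\mathrm{P}}^{\mathrm{SAT}_{n-1}}$ strongly reduces to $\mathrm{UVAL}_n$.
   Context: $\Sigma=\{0,1\}$, $\Sigma^*$ the finite nonempty binary strings; for $x\in\Sigma^m$, $\pi_1(x)=x_1$. $\mathbb{P}_+\Sigma=\{\{0\},\{1\},\Sigma\}$. A promise problem is $\phi:\Sigma^*\to\mathbb{P}_+\Sigma$; a problem $\psi:\Sigma^*\to\Sigma$ is identified with $x\mapsto\{\psi(x)\}$. $\phi_1\propto\phi_2$ means there is a polynomial-time computable $\mu$ with $\phi_1(x)\supseteq\phi_2(\mu(x))$ for all $x$; $[\phi]=\{\phi_1:\phi_1\propto\phi\}$. A $\phi$-oracle Turing machine may, given $x$, obtain in unit time some $y\in\phi(x)$; when $\phi(x)=\Sigma$ the returned value is nondeterministic (adversarial), independently on each call. $\phi_1\propto_T\phi_2$ means there is a $\phi_2$-oracle Turing machine $M$ and a polynomial $p$ such that on every input $x$ every possible computation path halts within $p(|x|)$ steps and outputs an element of $\phi_1(x)$. $\widehat{\mathrm{P}}^{\phi}=\{\phi_1:\phi_1\propto_T\phi\}$; $\widehat\Delta_n=\widehat{\mathrm{P}}^{\mathrm{SAT}_{n-1}}$. Level-$n$ problems: the input encodes (e.g. as a Boolean formula) $f:\Sigma^{m_1}\times\dots\times\Sigma^{m_n}\to\Sigma$, written $f(x,y^{(1)},\dots,y^{(n-1)})$ with $x\in\Sigma^{m_1}$; $f_x$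 is $f$ with $x$ fixed. For a constant $c$ (zero arguments), $\mathrm{SAT}_0(c)=\overline{\mathrm{SAT}}_0(c)=c$; for $n\ge1$, $\mathrm{SAT}_n(f)=1\iff\exists x:\overline{\mathrm{SAT}}_{n-1}(f_x)=1$ and $\overline{\mathrm{SAT}}_n(f)=1\iff\forall x,\ \mathrm{SAT}_{n-1}(f_x)=1$. $\mathrm{UVAL}_n(f)=\{\pi_1x:\overline{\mathrm{SAT}}_{n-1}(f_x)=1\}$ if there is exactly one $x$ with $\overline{\mathrm{SAT}}_{n-1}(f_x)=1$, and $\Sigma$ otherwise. *)

(* Defs.v *)
From mathcomp Require Import all_boot.
Set Implicit Arguments. Unset Strict Implicit. Unset Printing Implicit Defensive.

Definition word := seq bool.

(* P_+ Sigma = {{0},{1},Sigma}:  Some b = {b},  None = Sigma *)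
Definition pprob := word -> option bool.
Definition amem (A : option bool) (b : bool) : Prop :=
  match A with None => True | Some c => b = c end.
Definition of_problem (psi : word -> bool) : pprob := fun x => Some (psi x).

Inductive form :=
| FConst of bool
| FVar of nat
| FNot of form
| FAnd of form & form
| FOr of form & form.

Fixpoint eval (a : seq bool) (f : form) : bool :=
  match f with
  | FConst b => b
  | FVar v => nth false a v
  | FNot g => ~~ eval a g
  | FAnd g h => eval a g && eval a h
  | FOr g h => eval a g || eval a h
  end.

Fixpoint maxvar1 (f : form) : nat :=
  match f with
  | FConst _ => 0
  | FVar v => v.+1
  | FNot g => maxvar1 g
  | FAnd g h | FOr g h => maxn (maxvar1 g) (maxvar1 h)
  end.

Fixpoint dec_unary (s : word) : option (nat * word) :=
  match s with
  | [::] => None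
  | false :: r => Some (0, r)
  | true :: r => if dec_unary r is Some (k, r') then Some (k.+1, r') else None
  end.

Fixpoint dec_sizes (fuel : nat) (s : word) : option (seq nat * word) :=
  match fuel with
  | 0 => None
  | fuel'.+1 =>
    match s with
    | false :: r => Some ([::], r)
    | true :: r =>
      if dec_unary r is Some (m, r1) then
        if dec_sizes fuel' r1 is Some (ms, r2) then Some (m :: ms, r2) else None
      else None
    | [::] => None
    end
  end.

Fixpoint dec_form (fuel : nat) (s : word) : option (form * word) :=
  match fuel with
  | 0 => None
  | fuel'.+1 =>
    match s with
    | false :: false :: b :: r => Some (FConst b, r)
    | false :: true :: r =>
      if dec_unary r is Some (v, r') then Some (FVar v, r') else None
    | true :: false :: r =>
      if dec_form fuel' r is Some (g, r') then Some (FNot g, r') else None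
    | true :: true :: c :: r =>
      if dec_form fuel' r is Some (g, r1) then
        if dec_form fuel' r1 is Some (h, r2) then
          Some ((if c then FOr g h else FAnd g h), r2)
        else None
      else None
    | _ => None
    end
  end.

(* An instance: block sizes m_1..m_k (all >= 1) and a formula whose variables
   are among the sum m_1+..+m_k variables; block i uses the global indices
   m_1+..+m_{i-1}, ..., m_1+..+m_i - 1. *)
Definition decode (s : word) : option (seq nat * form) :=
  if dec_sizes (size s) s is Some (ms, r) then
    if dec_form (size s) r is Some (f, r') then
      if [&& r' == [::], all (fun m => 0 < m) ms & maxvar1 f <= sumn ms]
      then Some (ms, f) else None
    else None
  else None.

Fixpoint words (m : nat) : seq word :=
  match m with
  | 0 => [:: [::]]
  | m'.+1 => [seq b :: w | b <- [:: false; true], w <- words m']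
  end.

Fixpoint qval (q : bool) (ms : seq nat) (pre : seq bool) (f : form) : bool :=
  match ms with
  | [::] => eval pre f
  | m :: ms' =>
    if q then has (fun x => qval (~~ q) ms' (pre ++ x) f) (words m)
    else all (fun x => qval (~~ q) ms' (pre ++ x) f) (words m)
  end.

(* SAT_k: inputs not encoding a k-block function are answered 0 *)
Definition SAT (k : nat) (s : word) : bool :=
  if decode s is Some (ms, f) then (size ms == k) && qval true ms [::] f
  else false.

Definition coSAT (k : nat) (s : word) : bool :=
  if decode s is Some (ms, f) then (size ms == k) && qval false ms [::] f
  else false.

(* UVAL_k; inputs not encoding a k-block function are answered Sigma *)
Definition UVAL (k : nat) (s : word) : option bool :=
  match decode s with
  | Some (m1 :: ms', f) =>
    if size ms' == k.-1 then
      if [seq x <- words m1 | qval false ms' x f] is [:: x] then Some (head false x)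
      else None
    else None
  | _ => None
  end.

Definition sym := option bool.             (* None = blank *)
Inductive dir := DL | DR | DN.

Record tape := Tape { tleft : seq sym; tcur : sym; tright : seq sym }.
Definition blank_tape := Tape [::] None [::].

Definition move (d : dir) (t : tape) : tape :=
  match d with
  | DN => t
  | DL => match tleft t with
          | [::] => Tape [::] None (tcur t :: tright t)
          | a :: l => Tape l a (tcur t :: tright t)
          end
  | DR => match tright t with
          | [::] => Tape (tcur t :: tleft t) None [::]
          | a :: r => Tape (tcur t :: tleft t) a r
          end
  end.

Definition write (a : sym) (t : tape) := Tape (tleft t) a (tright t).

Fixpoint takeSome (s : seq sym) : word :=
  match s with Some b :: s' => b :: takeSome s' | _ => [::] end.

Definition tape_out (t : tape) : word := takeSome (tcur t :: tright t).

Definition input_tape (x : word) : tape :=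
  match x with [::] => blank_tape | a :: r => Tape [::] (Some a) (map Some r) end.

Inductive action (Q : Type) :=
| Act of Q & sym & sym & dir & dir   (* new state, write work/query, moves *)
| Ask of Q & Q                       (* query oracle: yes-state, no-state *)
| Halt of bool.

(* two tapes: work tape (holds the input initially) and oracle query tape *)
Record OTM := { state : finType; q0 : state;
                delta : state -> sym -> sym -> action state }.

Record cfg (M : OTM) := Cfg { cst : state M; cwork : tape; cquery : tape }.

Definition init (M : OTM) (x : word) : cfg M := Cfg (q0 M) (input_tape x) blank_tape.

(* O w y : y is an admissible oracle answer to query w *)
Definition step (O : word -> bool -> Prop) (M : OTM) (c c' : cfg M) : Prop :=
  match delta (cst c) (tcur (cwork c)) (tcur (cquery c)) with
  | Act q w1 w2 d1 d2 =>
      c' = Cfg q (move d1 (write w1 (cwork c))) (move d2 (write w2 (cquery c)))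
  | Ask qy qn =>
      exists y, O (tape_out (cquery c)) y /\
                c' = Cfg (if y then qy else qn) (cwork c) blank_tape
  | Halt _ => False
  end.

Definition halted (M : OTM) (c : cfg M) : option bool :=
  if delta (cst c) (tcur (cwork c)) (tcur (cquery c)) is Halt b then Some b else None.

(* every computation path from c halts within t steps, in a configuration
   satisfying P (stuck non-halting configurations count as failure) *)
Fixpoint all_halt (O : word -> bool -> Prop) (M : OTM) (P : cfg M -> bool -> Prop)
         (t : nat) (c : cfg M) : Prop :=
  match halted c with
  | Some b => P c b
  | None =>
    match t with
    | 0 => False
    | t'.+1 => (exists c', step O c c') /\
               forall c', step O c c' -> all_halt O P t' c'
    end
  end.

Definition poly_bound (k n : nat) : nat := k * n ^ k + k.

Definition no_oracle : word -> bool -> Prop := fun _ _ => False.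
Definition oracle_of (phi : pprob) : word -> bool -> Prop := fun w y => amem (phi w) y.

Definition poly_computable (mu : word -> word) : Prop :=
  exists (M : OTM) (k : nat), forall x,
    all_halt no_oracle (fun c _ => tape_out (cwork c) = mu x)
             (poly_bound k (size x)) (init M x).

Definition reduces (phi1 phi2 : pprob) : Prop :=
  exists mu, poly_computable mu /\
    forall x b, amem (phi2 (mu x)) b -> amem (phi1 x) b.

Definition red_class (phi : pprob) (phi1 : pprob) : Prop := reduces phi1 phi.

Definition Treduces (phi1 phi2 : pprob) : Prop :=
  exists (M : OTM) (k : nat), forall x,
    all_halt (oracle_of phi2) (fun _ b => amem (phi1 x) b)
             (poly_bound k (size x)) (init M x).

Definition Phat (phi : pprob) (phi1 : pprob) : Prop := Treduces phi1 phi.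
Definition Deltahat (n : nat) : pprob -> Prop := Phat (of_problem (SAT n.-1)).

(* Main.v *)
(* The machine M deciding phi1 with oracle SAT_(n-1) runs for T steps.  The outer
   word y1 contains the output bit first, then the oracle answers, for every
   positive answer the lexicographically first witness (zero otherwise), and the
   whole tableau of the run, so that exactly one y1 is correct.  Correctness is a
   statement with n-1 further quantifiers starting with a universal one: the
   universal word y2 picks a query and asks either that its witness w be good,
   i.e. forall y2 exists y3 ... q(w, y2, y3, ...), or that no candidate w' = y2
   which is smaller than w (or arbitrary, if the answer is no) be good, i.e.
   exists y3 forall y4 ... not q(w', y3, y4, ...).  Decoding and evaluating q is
   done by a circuit, whose gates are quantified together with y_n: their values
   are unique, so the kind of the last quantifier does not matter.

   All this is expressed by one first-order sentence over a padded input word,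
   where y1, ..., yn are binary relations on positions.  The propositional
   expansion of a fixed sentence is printed by nested loops over the positions,
   and such loop programs are compiled to two-tape machines. *)
Require Import Defs.
From mathcomp Require Import all_boot.
From mathcomp Require Import zify.
From Stdlib Require Import FunctionalExtensionality ClassicalEpsilon Setoid Morphisms.
Set Implicit Arguments. Unset Strict Implicit. Unset Printing Implicit Defensive.

(** * Structured programs for two-tape machines *)

(** Uniqueness has to reach bits that carry no information: answers at times without a query,
    witness bits beyond the first block of a query, entries off the diagonal of a relation that
    codes a set, and relations that only other blocks use. All of these are forced to be zero, and a
    halting configuration is repeated, so that the number of rows depends on the length alone. The
    padding makes this length exceed the running time and the extent of the tapes; then times,
    cells, places in a query and variable numbers of a query are all positions of one word. Both
    checks of a query fit under one prefix: a witness already fills the first block of q, which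
    leaves one block fewer to quantify, while the refutation of a candidate spends the first
    universal block on the candidate itself. For n = 2 the selecting block is also the last one, so
    selection and gates use different relations of a block. The sentence depends on M and n only,
    hence the correctness of the printed instance is a structural induction over formulas. *)

Definition effect := (sym * sym * dir * dir)%type.

Inductive prog :=
| Prim of (sym -> sym -> effect)
| PSeq of prog & prog
| PIf of (sym -> sym -> bool) & prog & prog
| PWhile of (sym -> sym -> bool) & prog.

Fixpoint St (p : prog) : finType :=
  match p with
  | Prim _ => unit
  | PSeq p q => (St p + St q)%type
  | PIf _ p q => option (St p + St q)
  | PWhile _ p => option (St p)
  end.

Fixpoint start (p : prog) : St p :=
  match p with
  | Prim _ => tt
  | PSeq p q => inl (start p)
  | PIf _ p q => None
  | PWhile _ p => None
  end.

(* [None] as next state means that the program exits. *)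
Fixpoint next (p : prog) : St p -> sym -> sym -> option (St p) * effect :=
  match p with
  | Prim f => fun _ a b => (None, f a b)
  | PSeq p q => fun s a b =>
      match s with
      | inl s => let: (o, x) := next s a b in
                 (Some (if o is Some s' then inl s' else inr (start q)), x)
      | inr s => let: (o, x) := next s a b in (omap inr o, x)
      end
  | PIf c p q => fun s a b =>
      match s with
      | None => (Some (Some (if c a b then inl (start p) else inr (start q))),
                 (a, b, DN, DN))
      | Some (inl s) => let: (o, x) := next s a b in (omap (Some \o inl) o, x)
      | Some (inr s) => let: (o, x) := next s a b in (omap (Some \o inr) o, x)
      end
  | PWhile c p => fun s a b =>
      match s with
      | None => (if c a b then Some (Some (start p)) else None, (a, b, DN, DN))
      | Some s => let: (o, x) := next s a b in (Some o, x)
      end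
  end.

Definition zap (x : effect) (z : tape * tape) : tape * tape :=
  let: (a, b, d1, d2) := x in (move d1 (write a z.1), move d2 (write b z.2)).

Arguments zap : simpl never.

Fixpoint zrun p (k : nat) (s : St p) (z : tape * tape) : option (tape * tape) :=
  if k is k'.+1 then
    let: (o, x) := next s (tcur z.1) (tcur z.2) in
    if o is Some s' then zrun k' s' (zap x z) else Some (zap x z)
  else None.

Lemma zrunW p k k' (s : St p) z z' :
  k <= k' -> zrun k s z = Some z' -> zrun k' s z = Some z'.
Proof.
elim: k k' s z => [//|k IH] [//|k'] s z /= lek.
by case: next => [[s'|] x] //; apply: IH.
Qed.

Lemma zrun_seqr p q k (s : St q) z z' :
  zrun k s z = Some z' -> @zrun (PSeq p q) k (inr s) z = Some z'.
Proof.
elim: k s z => [//|k IH] s z /=.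
by case: next => [[s'|] x] //=; apply: IH.
Qed.

Lemma zrun_seql p q k k' (s : St p) z z1 z' :
  zrun k s z = Some z1 -> zrun k' (start q) z1 = Some z' ->
  @zrun (PSeq p q) (k + k') (inl s) z = Some z'.
Proof.
move=> + H2; elim: k s z => [//|k IH] s z /=.
case: next => [[s'|] x] //=; first exact: IH.
case=> ->; apply: (@zrunW _ k'); first exact: leq_addl.
exact: zrun_seqr.
Qed.

Lemma zrun_ifl c p q k (s : St p) z z' :
  zrun k s z = Some z' -> @zrun (PIf c p q) k (Some (inl s)) z = Some z'.
Proof.
elim: k s z => [//|k IH] s z /=.
by case: next => [[s'|] x] //=; apply: IH.
Qed.

Lemma zrun_ifr c p q k (s : St q) z z' :
  zrun k s z = Some z' -> @zrun (PIf c p q) k (Some (inr s)) z = Some z'.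
Proof.
elim: k s z => [//|k IH] s z /=.
by case: next => [[s'|] x] //=; apply: IH.
Qed.

Lemma zrun_while c p k k' (s : St p) z z1 z' :
  zrun k s z = Some z1 -> @zrun (PWhile c p) k' None z1 = Some z' ->
  @zrun (PWhile c p) (k + k') (Some s) z = Some z'.
Proof.
move=> + H2; elim: k s z => [//|k IH] s z /=.
case: next => [[s'|] x] //=; first exact: IH.
case=> ->; apply: (@zrunW (PWhile c p) k'); first exact: leq_addl.
exact: H2.
Qed.

Lemma zap_id z : zap (tcur z.1, tcur z.2, DN, DN) z = z.
Proof. by case: z => [[l a r] [l' a' r']]. Qed.

Definition otm (p : prog) : OTM :=
  {| state := option (St p) : finType; q0 := Some (start p);
     delta := fun s a b =>
       if s is Some s then
         let: (o, (a', b', d1, d2)) := next s a b in Act o a' b' d1 d2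
       else Halt _ true |}.

(** Entering the state [None] is already halting, so the number of calls of [next] bounds the steps
    of the machine. No action is an oracle call, hence [no_oracle]. *)
Lemma zrun_all_halt p k (s : St p) z z' (P : word -> Prop) :
  zrun k s z = Some z' -> P (tape_out z'.1) ->
  @all_halt no_oracle (otm p) (fun c _ => P (tape_out (cwork c))) k
    (@Cfg (otm p) (Some s) z.1 z.2).
Proof.
move=> + HP; elim: k s z => [//|k IH] s z /=.
rewrite /halted /step /=.
case: next => [o [[[a b] d1] d2]] /= H.
split; first by eexists.
move=> c' ->; case: o H => [s'|] H.
  by move/IH: H.
by case: H HP => <-; case: k {IH} => [|k].
Qed.

(* Tapes with absolute positions: a content function and a head position; the
   cells to the left of position 0 are left unspecified. *)
Record conf := Conf { cw : nat -> sym; hw : nat; cq : nat -> sym; hq : nat }.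

Definition trep (t : tape) (c : nat -> sym) (h : nat) :=
  [/\ tcur t = c h, forall i, nth None (tright t) i = c (h + i).+1 &
      forall i, i < h -> nth None (tleft t) i = c (h - i.+1)].

Definition rep (z : tape * tape) (s : conf) :=
  trep z.1 (cw s) (hw s) /\ trep z.2 (cq s) (hq s).

Definition fupd (T : Type) (c : nat -> T) h a := fun p => if p == h then a else c p.

Lemma fupd_id T (c : nat -> T) h : fupd c h (c h) = c.
Proof. by apply: functional_extensionality => p; rewrite /fupd; case: eqP => [->|]. Qed.

Definition mvh (d : dir) (h : nat) := match d with DL => h.-1 | DR => h.+1 | DN => h end.
(** A left move from position 0 would reach the unspecified cells. *)
Definition okmv (d : dir) (h : nat) := if d is DL then 0 < h else true.

Lemma trep_step t c h a d : trep t c h -> okmv d h ->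
  trep (move d (write a t)) (fupd c h a) (mvh d h).
Proof.
case: t => l x r [/= -> Hr Hl]; case: d => /= Hd.
- case: h Hd Hr Hl => // h _ Hr Hl.
  have Hcur : nth None l 0 = c h by rewrite Hl // subn1.
  case: l Hl Hcur => [|y l] Hl /= Hcur; split => /=.
  + by rewrite /fupd ltn_eqF //.
  + case=> [|i] /=; first by rewrite addn0 /fupd eqxx.
    rewrite Hr /fupd addnS addSn gtn_eqF //; lia.
  + move=> i lti; rewrite nth_nil /fupd ifF; last by apply/eqP; lia.
    by have := Hl i.+1; rewrite nth_nil => ->; [congr c; lia|lia].
  + by rewrite /fupd ltn_eqF //.
  + case=> [|i] /=; first by rewrite addn0 /fupd eqxx.
    rewrite Hr /fupd addnS addSn gtn_eqF //; lia.
  + move=> i lti; rewrite /fupd ifF; last by apply/eqP; lia.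
    by have /= -> := Hl i.+1; [congr c; lia|lia].
- case: r Hr => [|y r] Hr; split => /=.
  + by have := Hr 0; rewrite nth_nil addn0 /fupd gtn_eqF.
  + move=> i; rewrite nth_nil /fupd gtn_eqF; last by lia.
    by have := Hr i.+1; rewrite nth_nil addnS addSn.
  + case=> [|i] lti /=; first by rewrite subn1 /= /fupd eqxx.
    rewrite /fupd ifF; last by apply/eqP; lia.
    by rewrite Hl; [congr c; lia|lia].
  + by have := Hr 0; rewrite addn0 /fupd gtn_eqF.
  + move=> i; rewrite /fupd gtn_eqF; last by lia.
    by have /= := Hr i.+1; rewrite addnS addSn.
  + case=> [|i] lti /=; first by rewrite subn1 /= /fupd eqxx.
    rewrite /fupd ifF; last by apply/eqP; lia.
    by rewrite Hl; [congr c; lia|lia].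
- split => /=; first by rewrite /fupd eqxx.
  + by move=> i; rewrite /fupd gtn_eqF //; lia.
  + by move=> i lti; rewrite /fupd ifF ?Hl //; apply/eqP; lia.
Qed.

Definition cstep (x : effect) (s : conf) : conf :=
  let: (a, b, d1, d2) := x in
  Conf (fupd (cw s) (hw s) a) (mvh d1 (hw s)) (fupd (cq s) (hq s) b) (mvh d2 (hq s)).

Definition okstep (x : effect) (s : conf) : bool :=
  let: (a, b, d1, d2) := x in okmv d1 (hw s) && okmv d2 (hq s).

Definition csym (s : conf) := (cw s (hw s), cq s (hq s)).

(* The time argument is an upper bound. *)
Inductive exec : prog -> conf -> nat -> conf -> Prop :=
| EPrim f s t s' : 0 < t -> okstep (f (csym s).1 (csym s).2) s ->
    s' = cstep (f (csym s).1 (csym s).2) s -> exec (Prim f) s t s'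
| ESeq p q s s1 s' t1 t2 t : exec p s t1 s1 -> exec q s1 t2 s' -> t1 + t2 <= t ->
    exec (PSeq p q) s t s'
| EIf (c : sym -> sym -> bool) p q s s' t1 t : exec (if c (csym s).1 (csym s).2 then p else q) s t1 s' ->
    t1 < t -> exec (PIf c p q) s t s'
| EWhileF (c : sym -> sym -> bool) p s t : 0 < t -> c (csym s).1 (csym s).2 = false -> exec (PWhile c p) s t s
| EWhileT (c : sym -> sym -> bool) p s s1 s' t1 t2 t : c (csym s).1 (csym s).2 -> exec p s t1 s1 ->
    exec (PWhile c p) s1 t2 s' -> t1 + t2 < t -> exec (PWhile c p) s t s'.

Lemma exec_zrun p s t s' z : exec p s t s' -> rep z s ->
  exists z', zrun t (start p) z = Some z' /\ rep z' s'.
Proof.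
move=> H; elim: H z => {p s t s'}.
- move=> f s [//|t] s' _ ok -> z [r1 r2]; case: (r1) => [e1 _ _]; case: (r2) => [e2 _ _].
  exists (zap (f (csym s).1 (csym s).2) z).
  rewrite /= e1 e2 /=; split=> //; move: ok; rewrite /rep.
  case: (f _ _) => [[[a b] d1] d2] /= /andP[o1 o2]; split; exact: trep_step.
- move=> p q s s1 s' t1 t2 t _ IH1 _ IH2 le z /IH1[z1 [H1 /IH2[z2 [H2 r2]]]].
  exists z2; split=> //; apply: zrunW le _; exact: zrun_seql H1 H2.
- move=> c p q s s' t1 [//|t] _ IH le z rz; case: (rz) => [[e1 _ _] [e2 _ _]].
  have [z' [H r']] := IH _ rz; exists z'; split=> //=.
  rewrite zap_id e1 e2; move: H; rewrite [(csym s).1]/= [(csym s).2]/=.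
  case: (c _ _) => H; apply: (@zrunW (PIf c p q) t1 t); try exact: le.
    exact: zrun_ifl.
  exact: zrun_ifr.
- move=> c p s [//|t] _ H z rz; case: (rz) => [[e1 _ _] [e2 _ _]].
  by exists z; rewrite /= zap_id e1 e2 [c _ _]H.
- move=> c p s s1 s' t1 t2 [//|t] H _ IH1 _ IH2 le z rz; case: (rz) => [[e1 _ _] [e2 _ _]].
  have [z1 [H1 /IH2[z2 [H2 r2]]]] := IH1 _ rz.
  exists z2; split=> //=; rewrite zap_id e1 e2 [c _ _]H.
  apply: (@zrunW (PWhile c p) (t1 + t2)); [exact: le|exact: zrun_while H1 H2].
Qed.

(** * Loop programs over the positions of a word *)

(** With base [n.+1] powers grow with the exponent even at length 0, so a single constant can be
    both coefficient and exponent. *)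
Definition pbounded (f : nat -> nat) := exists c, forall n, f n <= c * n.+1 ^ c.

Lemma pbounded_const a : pbounded (fun=> a).
Proof. by exists a => n; rewrite leq_pmulr // expn_gt0. Qed.

Lemma pbounded_id : pbounded id.
Proof. by exists 1 => n; rewrite mul1n expn1. Qed.

Lemma pbounded_le f g : (forall n, f n <= g n) -> pbounded g -> pbounded f.
Proof. by move=> le [c H]; exists c => n; apply: leq_trans (le n) (H n). Qed.

Lemma pbounded_add f g : pbounded f -> pbounded g -> pbounded (fun n => f n + g n).
Proof.
case=> c Hc [d Hd]; exists (c + d) => n; rewrite mulnDl.
by apply: leq_add; [apply: leq_trans (Hc n) _|apply: leq_trans (Hd n) _];
  rewrite leq_mul2l leq_pexp2l ?orbT // ?leq_addr ?leq_addl.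
Qed.

Lemma pbounded_mul f g : pbounded f -> pbounded g -> pbounded (fun n => f n * g n).
Proof.
case=> c Hc [d Hd]; exists (c * d + c + d) => n.
apply: leq_trans (leq_mul (Hc n) (Hd n)) _.
rewrite mulnACA -expnD; apply: leq_mul; first by rewrite -addnA leq_addr.
by apply: leq_pexp2l => //; rewrite -addnA leq_addl.
Qed.

Lemma pbounded_comp f g : pbounded f -> pbounded g -> pbounded (f \o g).
Proof.
case=> c Hc [d Hd]; exists (c * d.+1 ^ c + d * c) => n /=.
apply: leq_trans (Hc _) _.
have le1 : (g n).+1 <= d.+1 * n.+1 ^ d.
  rewrite mulSn addnC -addn1 leq_add ?Hd // expn_gt0 //.
apply: (@leq_trans (c * (d.+1 * n.+1 ^ d) ^ c)).
  by rewrite leq_mul2l; case: (c) => [//|c']; rewrite leq_exp2r // le1.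
rewrite expnMn -expnM mulnA; apply: leq_mul; first exact: leq_addr.
by apply: leq_pexp2l => //; exact: leq_addl.
Qed.

(** At length 0 the additive constant suffices; at a positive length n, the inequality n + 1 <= 2 n
    turns the shifted base into a factor [2 ^ c]. *)
Lemma pbounded_poly f : pbounded f -> exists k, forall n, f n <= poly_bound k n.
Proof.
case=> c Hc; exists (c * 2 ^ c + c) => n; rewrite /poly_bound.
apply: leq_trans (Hc n) _; case: n => [|n].
  by rewrite exp1n muln1; apply: leq_trans (leq_addl _ _); exact: leq_addl.
apply: leq_trans (leq_addr _ _).
have le2 : n.+2 ^ c <= 2 ^ c * n.+1 ^ c.
  by rewrite -expnMn; case: (c) => [//|c']; rewrite leq_exp2r // mul2n -addnn addSn addnS !ltnS leq_addl.
apply: (@leq_trans (c * (2 ^ c * n.+1 ^ c))); first by rewrite leq_mul2l le2 orbT.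
rewrite mulnA; apply: leq_mul; first exact: leq_addr.
by apply: leq_pexp2l => //; exact: leq_addl.
Qed.

Lemma execW p s t t' s' : t <= t' -> exec p s t s' -> exec p s t' s'.
Proof.
move=> le H; case: H le => {p s t s'}.
- by move=> f s t s' t0 ok e le; apply: EPrim => //; exact: leq_trans le.
- by move=> p q s s1 s' t1 t2 t H1 H2 l le; apply: ESeq H1 H2 (leq_trans l le).
- by move=> c p q s s' t1 t H l le; apply: EIf H (leq_trans l le).
- by move=> c p s t t0 e le; apply: EWhileF e; exact: leq_trans le.
- by move=> c p s s1 s' t1 t2 t e H1 H2 l le; apply: EWhileT e H1 H2 (leq_trans l le).
Qed.

Lemma execS p q s s1 s' t1 t : exec p s t1 s1 -> t1 <= t -> exec q s1 (t - t1) s' ->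
  exec (PSeq p q) s t s'.
Proof. by move=> H1 le H2; apply: ESeq H1 H2 _; rewrite subnKC. Qed.

Definition qmv d := Prim (fun a b => (a, b, DN, d)).
Definition wmv d := Prim (fun a b => (a, b, d, DN)).
Definition skip := qmv DN.
Fixpoint rpt n p := if n is n'.+1 then PSeq p (rpt n' p) else skip.

Lemma exec_qmv d w h c k : okmv d k -> exec (qmv d) (Conf w h c k) 1 (Conf w h c (mvh d k)).
Proof. by move=> ok; apply: EPrim; rewrite //= ?fupd_id. Qed.

Lemma exec_wmv d w h c k : okmv d h -> exec (wmv d) (Conf w h c k) 1 (Conf w (mvh d h) c k).
Proof. by move=> ok; apply: EPrim; rewrite //= ?fupd_id ?andbT. Qed.

Lemma exec_skip s : exec skip s 1 s.
Proof. by case: s => w h c k; apply: exec_qmv. Qed.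

Lemma exec_qwrite v w h c k :
  exec (Prim (fun a _ => (a, v, DN, DN))) (Conf w h c k) 1 (Conf w h (fupd c k v) k).
Proof. by apply: EPrim => //=; rewrite fupd_id. Qed.

Lemma exec_rptR n w h c k :
  exec (rpt n (qmv DR)) (Conf w h c k) n.+1 (Conf w h c (k + n)).
Proof.
elim: n k => [|n IH] k /=; first by rewrite addn0; exact: exec_skip.
rewrite -addSnnS; apply: ESeq (IH _) _; first exact: exec_qmv.
by rewrite add1n.
Qed.

Lemma exec_rptL n w h c k : n <= k ->
  exec (rpt n (qmv DL)) (Conf w h c k) n.+1 (Conf w h c (k - n)).
Proof.
elim: n k => [|n IH] [|k] //= le; rewrite ?subn0; try exact: exec_skip.
rewrite subSS; apply: ESeq (IH _ le) _; first exact: exec_qmv.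
by rewrite add1n.
Qed.

Lemma exec_goL (cnd : sym -> sym -> bool) w h c k m : m <= k ->
  (forall p, k - m < p <= k -> cnd (w h) (c p)) -> cnd (w h) (c (k - m)) = false ->
  exec (PWhile cnd (qmv DL)) (Conf w h c k) (m.*2.+1) (Conf w h c (k - m)).
Proof.
elim: m k => [|m IH] k le H1 H0.
  by rewrite subn0 in H0 *; apply: EWhileF.
case: k le H1 H0 => // k le H1 H0; rewrite subSS in H1 H0 *.
apply: (@EWhileT _ _ _ (Conf w h c k) _ 1 m.*2.+1).
- by apply: (H1 k.+1); lia.
- exact: exec_qmv.
- by apply: IH => // p lp; apply: H1; lia.
- by rewrite doubleS; lia.
Qed.

Lemma exec_goR (cnd : sym -> sym -> bool) w h c k D m :
  (forall a, a < m -> cnd (w h) (c (k + a * D))) -> cnd (w h) (c (k + m * D)) = false ->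
  exec (PWhile cnd (rpt D (qmv DR))) (Conf w h c k) (m * D.+2).+1 (Conf w h c (k + m * D)).
Proof.
elim: m k => [|m IH] k H1 H0.
  by rewrite mul0n addn0 in H0 *; apply: EWhileF.
rewrite mulSn addnA in H0 *.
apply: (@EWhileT _ _ _ (Conf w h c (k + D)) _ D.+1 (m * D.+2).+1).
- by have := H1 0 isT; rewrite mul0n addn0.
- exact: exec_rptR.
- by apply: IH => // a la; have := H1 a.+1; rewrite mulSn addnA; apply; lia.
- lia.
Qed.

Section ForPrograms.

Variable d : nat.
Let D := d.+1.

(* Programs over the positions of an input word: [d] variables range over
   positions; the value [size X] means that a variable is not in use, and
   [FFor i j p] runs [p] for all values of [i] below the one of [j]. *)
Inductive fp :=
| FSkip
| FEmit of bool
| FSeq of fp & fp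
| FFor (i j : nat) of fp
| FIf (i c b : nat) of fp & fp.

(* Bit 0 of a position is the input letter, bit [j.+1] tells whether variable
   [j] has this position as value. *)
Definition posbit (X : word) (e : nat -> nat) a b : bool :=
  (a < size X) && (if b is j.+1 then e j == a else nth false X a).

Fixpoint den (X : word) (e : nat -> nat) (p : fp) : word :=
  match p with
  | FSkip => [::]
  | FEmit b => [:: b]
  | FSeq p q => den X e p ++ den X e q
  | FFor i j p => flatten [seq den X (fupd e i a) p | a <- iota 0 (e j)]
  | FIf i c b p q => if posbit X e (e i + c) b then den X e p else den X e q
  end.

Fixpoint fwf (L : seq nat) (p : fp) : bool :=
  match p with
  | FSkip | FEmit _ => true
  | FSeq p q => fwf L p && fwf L q
  | FFor i j p => [&& i < d, j < d, i != j, i \notin L & fwf (i :: L) p]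
  | FIf i c b p q => [&& i < d, b < D, fwf L p & fwf L q]
  end.

Definition envok (X : word) (L : seq nat) (e : nat -> nat) :=
  forall i, e i <= size X /\ (i \notin L -> e i = size X).

(* Layout of the query tape: blank at 0, a sentinel at 1, then one block of [D]
   bits for each position. *)
Definition pos a b := (a * D + b).+2.

Definition qenc (X : word) (e : nat -> nat) (p : nat) : sym :=
  if p is p'.+2 then
    if p' < size X * D then Some (posbit X e (p' %/ D) (p' %% D)) else None
  else if p is 1 then Some false else None.

Arguments qenc : simpl never.

Lemma qenc_pos X e a b : b < D ->
  qenc X e (pos a b) = if a < size X then Some (posbit X e a b) else None.
Proof.
move=> lb; rewrite /qenc /pos divnMDl // modnMDl divn_small // addn0 modn_small //.
congr (if _ then _ else _); apply/idP/idP => H; nia.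
Qed.

Lemma qenc_mark X e i a : i < d -> e i = size X -> a < size X ->
  fupd (qenc X e) (pos a i.+1) (Some true) = qenc X (fupd e i a).
Proof.
move=> li ei la; apply: functional_extensionality => p; rewrite {1}/fupd.
have liD : i.+1 < D by [].
case: eqP => [->|ne]; first by rewrite qenc_pos // la /posbit la /fupd /= !eqxx.
case: p ne => [|[|p]] // ne; rewrite /qenc; case: ifP => // lp; congr Some.
rewrite /posbit; congr andb; case E: (p %% D) => [//|j]; rewrite /fupd.
case: (j =P i) => // ej; rewrite ej in E *; rewrite ei.
have lt : p %/ D < size X by rewrite ltn_divLR.
rewrite gtn_eqF //; apply/esym/eqP => ea; apply: ne.
by rewrite /pos (divn_eq p D) E ea.
Qed.

Lemma qenc_unmark X e i a : i < d -> a < size X ->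
  fupd (qenc X (fupd e i a)) (pos a i.+1) (Some false) = qenc X (fupd e i (size X)).
Proof.
move=> li la; apply: functional_extensionality => p; rewrite {1}/fupd.
have liD : i.+1 < D by [].
case: eqP => [->|ne].
  by rewrite qenc_pos // la /posbit la /fupd /= !eqxx gtn_eqF.
case: p ne => [|[|p]] // ne; rewrite /qenc; case: ifP => // lp; congr Some.
rewrite /posbit; congr andb; case E: (p %% D) => [//|j]; rewrite /fupd.
case: (j =P i) => // ej; rewrite ej in E *.
have lt : p %/ D < size X by rewrite ltn_divLR.
rewrite (gtn_eqF lt); apply/eqP => ea; apply: ne.
by rewrite /pos (divn_eq p D) E ea.
Qed.

Definition mvb b1 b2 :=
  if b1 <= b2 then rpt (b2 - b1) (qmv DR) else rpt (b1 - b2) (qmv DL).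

Lemma exec_mvb a b1 b2 w h c :
  exec (mvb b1 b2) (Conf w h c (pos a b1)) (b1 + b2).+1 (Conf w h c (pos a b2)).
Proof.
rewrite /mvb; case: leqP => le.
  have -> : pos a b2 = pos a b1 + (b2 - b1) by rewrite /pos; lia.
  by apply: execW (exec_rptR _ _ _ _ _); lia.
have -> : pos a b2 = pos a b1 - (b1 - b2) by rewrite /pos; lia.
by apply: execW (exec_rptL _ _ _ _); rewrite /pos; lia.
Qed.

(** Bit [i.+1] of the first block is cell [i.+3], and strides of [D] keep to that bit. The scan
    stops at the mark of variable [i], or at the blank behind the last block, which is where
    [pos (e i) i.+1] lies if [e i = size X]. *)
Definition goto i :=
  PSeq (rpt i.+3 (qmv DR)) (PWhile (fun _ b => b == Some false) (rpt D (qmv DR))).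

(** The first loop crosses the blanks behind the blocks, the second one runs on to the blank at 0.
    The sentinel stops the first loop even if the word is empty. *)
Definition home :=
  PSeq (PWhile (fun _ b => b == None) (qmv DL)) (PWhile (fun _ b => b != None) (qmv DL)).

Definition ifblank p q := PIf (fun _ b => b == None) p q.
Definition qwrite v := Prim (fun a _ => (a, v, DN, DN)).

Lemma exec_goto X e i w h : i < d -> e i <= size X ->
  exec (goto i) (Conf w h (qenc X e) 0) (i + 5 + size X * D.+2)
    (Conf w h (qenc X e) (pos (e i) i.+1)).
Proof.
move=> li le; have liD : i.+1 < D by [].
apply: execS (exec_rptR _ _ _ _ _) _ _; first lia.
have E a : 0 + i.+3 + a * D = pos a i.+1 by rewrite /pos; lia.
rewrite -E; apply: execW (exec_goR _ _).
- have : e i * D.+2 <= size X * D.+2 by rewrite leq_mul2r le orbT.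
  lia.
- move=> a la; rewrite E qenc_pos // (leq_trans la le) /posbit /= (gtn_eqF la).
  by rewrite andbF.
- by rewrite E qenc_pos // /posbit; case: ltnP => //= _; rewrite eqxx.
Qed.

Lemma exec_home X e w h k : 0 < k ->
  exec home (Conf w h (qenc X e) k) (k.*2.+2) (Conf w h (qenc X e) 0).
Proof.
move=> lk; pose m := minn k (size X * D).+1.
have nb p : (qenc X e p == None) = (p == 0) || (p > (size X * D).+1).
  by case: p => [|[|p]] //; rewrite /qenc !ltnS; case: ltnP.
have Hm : k - (k - m) = m by rewrite subKn // geq_minl.
have lm : m <= k by rewrite geq_minl.
apply: (@ESeq _ _ _ (Conf w h (qenc X e) m) _ (k - m).*2.+1 m.*2.+1).
- have := @exec_goL (fun _ b => b == None) w h (qenc X e) k (k - m) (leq_subr _ _).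
  rewrite Hm; apply=> [p lp|]; rewrite nb; lia.
- have := @exec_goL (fun _ b => b != None) w h (qenc X e) m m (leqnn _).
  rewrite subnn; apply=> [p lp|//]; rewrite nb; lia.
- lia.
Qed.

Definition place i := PSeq (rpt i.+3 (qmv DR)) (PSeq (ifblank skip (qwrite (Some true))) home).
Definition clear i := PSeq (goto i) (PSeq (ifblank skip (qwrite (Some false))) home).

Lemma exec_place X e i w h : i < d -> e i = size X ->
  exec (place i) (Conf w h (qenc X e) 0) (5 * i + 20) (Conf w h (qenc X (fupd e i 0)) 0).
Proof.
move=> li ei; have liD : i.+1 < D by [].
apply: execS (exec_rptR _ _ _ _ _) _ _; first lia.
apply: (@execS _ _ _ (Conf w h (qenc X (fupd e i 0)) (0 + i.+3)) _ 2).
- apply: (@EIf _ _ _ _ _ 1) => //.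
  have E : i.+3 = pos 0 i.+1 by rewrite /pos; lia.
  rewrite /= add0n E qenc_pos //; case: ltnP => // l0 /=.
    rewrite -qenc_mark //; exact: exec_qwrite.
  (* For an empty word 0 equals [size X]: there is no block to mark and the environment does not
     change. *)
  rewrite (_ : fupd e i 0 = e); first exact: exec_skip.
  have e0 : e i = 0 by lia.
  by rewrite -e0 fupd_id.
- lia.
- apply: execW (exec_home _ _ _ _ _) => //; lia.
Qed.

Lemma exec_clear X e i w h : i < d -> e i <= size X ->
  exec (clear i) (Conf w h (qenc X e) 0) (5 * i + 20 + size X * D.+2 + 2 * (size X * D))
    (Conf w h (qenc X (fupd e i (size X))) 0).
Proof.
move=> li le; have liD : i.+1 < D by [].
apply: execS (exec_goto _ _ _ _) _ _ => //; first lia.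
apply: (@execS _ _ _ (Conf w h (qenc X (fupd e i (size X))) (pos (e i) i.+1)) _ 2).
- apply: (@EIf _ _ _ _ _ 1) => //.
  rewrite /= qenc_pos //; case: ltnP => // l0 /=.
    by rewrite -(@qenc_unmark X e i (e i)) // fupd_id; exact: exec_qwrite.
  rewrite (_ : fupd e i _ = e); first exact: exec_skip.
  have eN : e i = size X by lia.
  by rewrite -eN fupd_id.
- lia.
- apply: execW (exec_home _ _ _ _ _) => //.
  rewrite /pos; have : e i * D <= size X * D by rewrite leq_mul2r le orbT.
  lia.
Qed.

(** The marks on the tape are the loop counters, so a finite control suffices. The bound of a loop
    is tested by looking for the mark of [j] in the block that holds the mark of [i]; the blank
    behind the last block also ends the loop, which covers [e j = size X]. *)
Fixpoint fcomp (p : fp) : prog :=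
  match p with
  | FSkip => skip
  | FEmit b => Prim (fun _ q => (Some b, q, DR, DN))
  | FSeq p q => PSeq (fcomp p) (fcomp q)
  | FFor i j p =>
      PSeq (place i) (PSeq (goto i) (PSeq (mvb i.+1 j.+1)
      (PSeq (PWhile (fun _ b => b == Some false)
               (PSeq home (PSeq (fcomp p) (PSeq (goto i) (PSeq (qwrite (Some false))
               (PSeq (rpt D (qmv DR)) (PSeq (ifblank skip (qwrite (Some true)))
               (mvb i.+1 j.+1))))))))
      (PSeq home (clear i)))))
  | FIf i c b p q =>
      PSeq (goto i) (PSeq (rpt (c * D) (qmv DR)) (PSeq (mvb i.+1 b)
      (PIf (fun _ b => b == Some true) (PSeq home (fcomp p)) (PSeq home (fcomp q)))))
  end.

Definition wout (w : nat -> sym) h (o : word) (p : nat) : sym :=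
  if h <= p < h + size o then Some (nth false o (p - h)) else w p.

Lemma wout0 w h : wout w h [::] = w.
Proof. by apply: functional_extensionality => p; rewrite /wout ifF //=; lia. Qed.

Lemma wout_cat w h o1 o2 : wout (wout w h o1) (h + size o1) o2 = wout w h (o1 ++ o2).
Proof.
apply: functional_extensionality => p; rewrite /wout size_cat nth_cat.
case: ifP => H1; first by rewrite ifT ?ifF; [congr (Some (nth _ _ _)); lia|lia|lia].
case: ifP => H2; first by rewrite ifT ?ifT //; lia.
by rewrite ifF //; lia.
Qed.

Lemma envok_upd X L e i a : envok X L e -> a <= size X -> envok X (i :: L) (fupd e i a).
Proof.
move=> ok la k; rewrite /fupd inE; case: eqP => [//|_ /=]; exact: ok.
Qed.

Lemma pbounded_lin a b : pbounded (fun n => a * n + b).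
Proof.
apply: pbounded_add (pbounded_const b); apply: pbounded_mul; first exact: pbounded_const.
exact: pbounded_id.
Qed.

(** The time bound is uniform in the environment, because the rounds of a loop run their body in
    different environments. *)
Lemma exec_comp p : exists2 F, pbounded F & forall L X e w h, fwf L p -> envok X L e ->
  exec (fcomp p) (Conf w h (qenc X e) 0) (F (size X))
    (Conf (wout w h (den X e p)) (h + size (den X e p)) (qenc X e) 0).
Proof.
elim: p => [|b|p [F1 P1 H1] q [F2 P2 H2]|i j p [F P H]|i c b p [F1 P1 H1] q [F2 P2 H2]].
- exists (fun=> 1); first exact: pbounded_const.
  by move=> L X e w h _ _; rewrite wout0 addn0; exact: exec_skip.
- exists (fun=> 1); first exact: pbounded_const.
  move=> L X e w h _ _; apply: EPrim => //=; rewrite fupd_id addn1; congr Conf.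
  apply: functional_extensionality => k; rewrite /wout /fupd /=.
  case: eqP => [->|ne]; first by rewrite leqnn addn1 ltnS leqnn subnn.
  by rewrite ifF //; lia.
- exists (fun n => F1 n + F2 n); first exact: pbounded_add.
  move=> L X e w h /andP[w1 w2] ok.
  apply: ESeq (H1 _ _ _ _ _ w1 ok) _ (leqnn _) => /=.
  by rewrite size_cat addnA -wout_cat; exact: H2 w2 ok.
(* [F n] pays for the body and the linear part for the head movements of one round. The total allows
   [n] rounds and the price of 20 more for preparation and cleanup. *)
- pose G n := F n + (10 * D * n + 10 * D + 3 * i + 3 * j + 50).
  exists (fun n => n * G n + 20 * G n).
    have PG : pbounded G.
      apply: pbounded_add => //; apply: pbounded_le (pbounded_lin (10 * D) (10 * D + 3 * i + 3 * j + 50)).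
      by move=> n; lia.
    apply: pbounded_add; apply: pbounded_mul => //; last exact: pbounded_const.
    exact: pbounded_id.
  move=> L X e w h /and5P[li lj ne iL wp] ok.
  set N := size X.
  have ei : e i = N by have [_ ->] := ok i.
  have lej : e j <= N by have [] := ok j.
  have liD : i.+1 < D by []. have ljD : j.+1 < D by [].
  have bd a : a <= N -> a * D <= N * D by move=> la; rewrite leq_mul2r la orbT.
  pose body a := den X (fupd e i a) p.
  pose out a m := flatten [seq body k | k <- iota a m].
  (* Loop invariant: [i] is marked at [a], the query head is on the bit of [j] in that block, and
     [m] rounds remain. *)
  have loop m a w0 h0 : a + m = e j ->
    exec (PWhile (fun _ b => b == Some false)
               (PSeq home (PSeq (fcomp p) (PSeq (goto i) (PSeq (qwrite (Some false))
               (PSeq (rpt D (qmv DR)) (PSeq (ifblank skip (qwrite (Some true)))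
               (mvb i.+1 j.+1))))))))
      (Conf w0 h0 (qenc X (fupd e i a)) (pos a j.+1)) (m * G N).+1
      (Conf (wout w0 h0 (out a m)) (h0 + size (out a m))
         (qenc X (fupd e i (e j))) (pos (e j) j.+1)).
    elim: m a w0 h0 => [|m IH] a w0 h0 eam.
      rewrite /out /= wout0 addn0 -eam addn0; apply: EWhileF => //=.
      rewrite qenc_pos //; case: ltnP => //= la.
      rewrite /posbit la /= /fupd ifF; last by apply/eqP => E; rewrite E eqxx in ne.
      by rewrite -eam addn0 eqxx.
    have la : a < e j by lia.
    have laN : a < N by lia.
    have Dle : (a.+1) * D <= N * D by exact: bd.
    have ND : N <= N * D by rewrite leq_pmulr.
    apply: (@EWhileT _ _ _ (Conf (wout w0 h0 (body a)) (h0 + size (body a))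
        (qenc X (fupd e i a.+1)) (pos a.+1 j.+1)) _ (G N).-1 (m * G N).+1).
    + rewrite /= qenc_pos // laN /posbit laN /= /fupd ifF; last by apply/eqP => E; rewrite E eqxx in ne.
      by rewrite gtn_eqF.
    + apply: (@execS _ _ _ _ _ (2 * (a * D + j) + 8)).
      * by apply: execW (exec_home _ _ _ _ _) => //; rewrite /pos; lia.
      * by rewrite /G; lia.
      apply: (@execS _ _ _ _ _ (F N)).
      * by apply: (H _ _ _ _ _ wp); apply: envok_upd => //; exact: ltnW.
      * by rewrite /G; lia.
      have fa : fupd e i a i = a by rewrite /fupd eqxx.
      apply: execS (exec_goto _ _ _ _) _ _; rewrite ?fa //; first exact: ltnW.
        by rewrite /G -/N; lia.
      apply: execS (exec_qwrite _ _ _ _ _) _ _; first by rewrite /G -/N; lia.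
      rewrite qenc_unmark //.
      apply: execS (exec_rptR _ _ _ _ _) _ _; first by rewrite /G -/N; lia.
      apply: (@execS _ _ _ (Conf (wout w0 h0 (body a)) (h0 + size (body a))
          (qenc X (fupd e i a.+1)) (pos a.+1 i.+1)) _ 2).
      * apply: (@EIf _ _ _ _ _ 1) => //.
        have -> : pos a i.+1 + D = pos a.+1 i.+1 by rewrite /pos; lia.
        rewrite /= qenc_pos //.
        have E v : fupd e i v = fupd (fupd e i N) i v.
          by apply: functional_extensionality => k; rewrite /fupd; case: eqP.
        case: ltnP => laS /=.
          rewrite (E a.+1) -(@qenc_mark X (fupd e i N) i a.+1) //; first exact: exec_qwrite.
          by rewrite /fupd eqxx.
        have -> : a.+1 = N by lia.
        exact: exec_skip.
      * by rewrite /G -/N; lia.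
      * by apply: execW (exec_mvb _ _ _ _ _ _); rewrite /G -/N; lia.
    + have -> : out a m.+1 = body a ++ out a.+1 m by [].
      rewrite size_cat addnA -wout_cat; apply: IH; lia.
    + rewrite mulSn; have : 0 < G N by rewrite /G; lia.
      lia.
  have G0 : 10 * D * N + 10 * D + 3 * i + 3 * j + 50 <= G N by rewrite /G; lia.
  have leG : e j * G N <= N * G N by rewrite leq_mul2r lej orbT.
  have bd1 := bd _ lej.
  have ND : N <= N * D by rewrite leq_pmulr.
  set T := N * G N + 20 * G N.
  apply: execS (exec_place _ _ _ _) _ _ => //; first by rewrite /T; lia.
  have f0 : fupd e i 0 i = 0 by rewrite /fupd eqxx.
  apply: execS (exec_goto _ _ _ _) _ _; rewrite ?f0 //; first by rewrite /T -/N; lia.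
  apply: execS (exec_mvb _ _ _ _ _ _) _ _; first by rewrite /T -/N; lia.
  apply: execS (loop (e j) 0 _ _ (add0n _)) _ _; first by rewrite /T -/N; lia.
  apply: execS (exec_home _ _ _ _ _) _ _ => //; first by rewrite /T /pos -/N; lia.
  have E : fupd (fupd e i (e j)) i N = e.
    by apply: functional_extensionality => k; rewrite /fupd; case: eqP => // ->.
  have fj : fupd e i (e j) i <= size X by rewrite /fupd eqxx.
  have := exec_clear (wout w h (out 0 (e j))) (h + size (out 0 (e j))) li fj.
  rewrite E; apply: execW; rewrite /T /pos -/N; lia.
- pose G n := F1 n + F2 n + (10 * D * n + 10 * D * (c + 1) + 3 * i + 3 * b + 50).
  exists G.
    apply: pbounded_add; first exact: pbounded_add.
    apply: pbounded_le (pbounded_lin (10 * D) (10 * D * (c + 1) + 3 * i + 3 * b + 50)).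
    by move=> n; lia.
  move=> L X e w h /and4P[li lb w1 w2] ok.
  have liD : i.+1 < D by [].
  have lei : e i <= size X by have [] := ok i.
  have bd : e i * D <= size X * D by rewrite leq_mul2r lei orbT.
  have ND : size X <= size X * D by rewrite leq_pmulr.
  set T := G (size X).
  have GE : T = F1 (size X) + F2 (size X) +
    (10 * D * size X + 10 * D * (c + 1) + 3 * i + 3 * b + 50) by [].
  apply: execS (exec_goto _ _ _ _) _ _ => //; first lia.
  apply: execS (exec_rptR _ _ _ _ _) _ _; first lia.
  have -> : pos (e i) i.+1 + c * D = pos (e i + c) i.+1 by rewrite /pos mulnDl; lia.
  apply: execS (exec_mvb _ _ _ _ _ _) _ _; first lia.
  apply: (@EIf _ _ _ _ _ ((pos (e i + c) b).*2.+2 + (F1 (size X) + F2 (size X)))).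
    rewrite /= qenc_pos //.
    rewrite (_ : (_ == Some true) = posbit X e (e i + c) b); last first.
      by rewrite /posbit; case: ltnP => //= _; case: (X in Some X) => [].
    case: (posbit _ _ _ _).
      by apply: ESeq (exec_home _ _ _ _ _) (H1 _ _ _ _ _ w1 ok) _ => //; lia.
    by apply: ESeq (exec_home _ _ _ _ _) (H2 _ _ _ _ _ w2 ok) _ => //; lia.
  rewrite /pos; lia.
Qed.

End ForPrograms.

(** * Loading the input, clearing the query tape, and chaining two loop programs *)

Lemma exec_wgoL (cnd : sym -> sym -> bool) w h c k m : m <= h ->
  (forall p, h - m < p <= h -> cnd (w p) (c k)) -> cnd (w (h - m)) (c k) = false ->
  exec (PWhile cnd (wmv DL)) (Conf w h c k) (m.*2.+1) (Conf w (h - m) c k).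
Proof.
elim: m h => [|m IH] h le H1 H0.
  by rewrite subn0 in H0 *; apply: EWhileF.
case: h le H1 H0 => // h le H1 H0; rewrite subSS in H1 H0 *.
apply: (@EWhileT _ _ _ (Conf w h c k) _ 1 m.*2.+1).
- by apply: (H1 h.+1); lia.
- exact: exec_wmv.
- by apply: IH => // p lp; apply: H1; lia.
- by rewrite doubleS; lia.
Qed.

Definition listcells (l : word) (p : nat) : sym :=
  if p is p'.+1 then nth None (map Some l) p' else None.

Lemma listcells_rcons l b :
  fupd (listcells l) (size l).+1 (Some b) = listcells (rcons l b).
Proof.
apply: functional_extensionality => -[|p] //; rewrite /fupd /listcells eqSS map_rcons nth_rcons size_map.
case: ltngtP => // lt; by rewrite nth_default ?size_map // ltnW.
Qed.

Lemma listcells_take l m : m < size l ->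
  fupd (listcells (take m.+1 l)) m.+1 None = listcells (take m l).
Proof.
move=> lm; rewrite (take_nth false lm) -listcells_rcons size_takel 1?ltnW //.
apply: functional_extensionality => p; rewrite /fupd; case: eqP => // ->.
by rewrite /= nth_default // size_map size_takel // ltnW.
Qed.

Definition qput b := Prim (fun a _ => (a, Some b, DN, DR)).

Lemma exec_qput b w h l : exec (qput b) (Conf w h (listcells l) (size l).+1) 1
  (Conf w h (listcells (rcons l b)) (size (rcons l b)).+1).
Proof. by apply: EPrim => //=; rewrite fupd_id listcells_rcons size_rcons. Qed.

Lemma exec_qputs b n w h l : exec (rpt n (qput b)) (Conf w h (listcells l) (size l).+1) n.+1
  (Conf w h (listcells (l ++ nseq n b)) (size (l ++ nseq n b)).+1).
Proof.
elim: n l => [|n IH] l /=; first by rewrite cats0; exact: exec_skip.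
by rewrite -cat_rcons; apply: ESeq (exec_qput _ _ _ _) (IH _) _; rewrite add1n.
Qed.

Definition reads (w : nat -> sym) h (x : word) :=
  forall i, w (h + i) = nth None (map Some x) i.

Section Phase.

Variable d : nat.
Let D := d.+1.

Definition blocks (x : word) : word := flatten [seq b :: nseq d false | b <- x].

Lemma size_blocks x : size (blocks x) = size x * D.
Proof. by elim: x => //= b x IH; rewrite size_cat IH size_nseq mulSn. Qed.

Lemma nth_blocks x p : nth None (map Some (blocks x)) p =
  if p < size x * D then Some (if p %% D == 0 then nth false x (p %/ D) else false) else None.
Proof.
elim: x p => [|b x IH] p; first by rewrite nth_default.
rewrite /blocks /= -/(blocks x) mulSn.
case: (ltnP p D) => lp.
  rewrite ltn_addr // modn_small // divn_small //.
  case: p lp => [|p] lp //=; rewrite map_cat nth_cat size_map size_nseq ifT //.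
  by rewrite (nth_map false) ?size_nseq // nth_nseq if_same.
have -> : p = (p - D) + D by rewrite subnK.
rewrite modnDr divnDr // divnn addn1 [_ + D]addnC ltn_add2l -IH.
by rewrite addSn /= map_cat nth_cat size_map size_nseq ltnNge leq_addr /= addKn.
Qed.

Lemma qenc_init x : qenc d x (fun=> size x) = listcells (false :: blocks x).
Proof.
apply: functional_extensionality => -[|[|p]] //; rewrite /qenc /listcells /=.
rewrite nth_blocks; case: ifP => // lp; congr Some.
have lt : p %/ D < size x by rewrite ltn_divLR.
by rewrite /posbit lt /=; case: (p %% D) => //= j; rewrite gtn_eqF.
Qed.

Lemma qenc_list x e : exists2 l, qenc d x e = listcells l & size l = (size x * D).+1.
Proof.
exists (mkseq (fun p => odflt false (qenc d x e p.+1)) (size x * D).+1); last by rewrite size_mkseq.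
apply: functional_extensionality => -[|p] //; rewrite /listcells.
case: (ltnP p (size x * D).+1) => lp.
  rewrite (nth_map false) ?size_mkseq // nth_mkseq //.
  by case: p lp => [|p] //; rewrite ltnS /qenc => ->.
rewrite nth_default ?size_map ?size_iota //.
by case: p lp => [|p] //; rewrite ltnS /qenc => lp; rewrite ltnNge lp.
Qed.

(** The copy puts [d] unset marks after each letter. The work head ends one cell beyond the blank
    after the input, so that this blank separates input and output. *)
Definition setup :=
  PSeq (qmv DR) (PSeq (qput false)
  (PSeq (PWhile (fun a _ => a != None)
           (PSeq (Prim (fun a _ => (a, a, DR, DR))) (rpt d (qput false))))
  (PSeq (wmv DR) home))).

Lemma exec_setup x w h : reads w h x ->
  exec setup (Conf w h (fun=> None) 0) (10 + size x * (3 * D + 10))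
    (Conf w (h + size x).+1 (qenc d x (fun=> size x)) 0).
Proof.
move=> rx.
have -> : (fun=> None) = listcells [::].
  by apply: functional_extensionality => -[|p] //; rewrite /listcells nth_nil.
apply: execS (exec_qmv _ _ _ _) _ _ => //.
apply: execS (exec_qput false _ _ [::]) _ _ => //.
have loop y l k : reads w k y ->
  exec (PWhile (fun a _ => a != None)
           (PSeq (Prim (fun a _ => (a, a, DR, DR))) (rpt d (qput false))))
    (Conf w k (listcells l) (size l).+1) (size y * (D + 2)).+1
    (Conf w (k + size y) (listcells (l ++ blocks y)) (size (l ++ blocks y)).+1).
  elim: y l k => [|b y IH] l k ry.
    rewrite addn0 cats0; apply: EWhileF => //=.
    by have := ry 0; rewrite addn0 => ->.
  have rk : w k = Some b by have := ry 0; rewrite addn0.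
  apply: (@EWhileT _ _ _ (Conf w k.+1 (listcells (rcons l b ++ nseq d false))
     (size (rcons l b ++ nseq d false)).+1) _ (D + 1) (size y * (D + 2)).+1).
  - by rewrite /= rk.
  - apply: (@ESeq _ _ _ (Conf w k.+1 (listcells (rcons l b)) (size (rcons l b)).+1) _ 1 D).
    + by apply: EPrim => //=; rewrite fupd_id rk listcells_rcons size_rcons.
    + exact: exec_qputs.
    + by rewrite addnC.
  - have -> : k + size (b :: y) = k.+1 + size y by rewrite addSnnS.
    have -> : l ++ blocks (b :: y) = (rcons l b ++ nseq d false) ++ blocks y.
      by rewrite cat_rcons -!catA.
    by apply: IH => i; have := ry i.+1; rewrite addSnnS => ->.
  - rewrite /=; lia.
apply: execS (loop x _ h rx) _ _; first by lia.
apply: execS (exec_wmv _ _ _ _) _ _ => //; first by lia.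
have -> : listcells ([:: false] ++ blocks x) = qenc d x (fun=> size x) by rewrite qenc_init.
have := @exec_home d x (fun=> size x) w (h + size x).+1 _ (ltn0Sn (size ([:: false] ++ blocks x))).
by apply: execW; rewrite /= size_blocks; lia.
Qed.

(** Erasing the query tape restores the initial condition of [setup], so phases can be chained; the
    blank to the left of the output guides the work head back to its first letter. *)
Definition finish :=
  PSeq (qmv DR) (PSeq (PWhile (fun _ b => b != None) (rpt 1 (qmv DR)))
  (PSeq (qmv DL) (PSeq (PWhile (fun _ b => b != None) (Prim (fun a _ => (a, None, DN, DL))))
  (PSeq (wmv DL) (PSeq (PWhile (fun a _ => a != None) (wmv DL)) (wmv DR)))))).

Lemma exec_finish x e w h o : 0 < h -> w h.-1 = None -> reads w h o ->
  exec finish (Conf w (h + size o) (qenc d x e) 0)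
    (20 + 5 * (size x * D).+1 + 2 * size o) (Conf w h (fun=> None) 0).
Proof.
move=> h0 wh ro; have [l -> sl] := qenc_list x e.
apply: execS (exec_qmv _ _ _ _) _ _ => //.
have := @exec_goR (fun _ b => b != None) w (h + size o) (listcells l) 1 1 (size l).
move=> H; apply: execS (H _ _) _ _.
- by move=> a la; rewrite muln1 add1n /= (nth_map false).
- by rewrite muln1 add1n /= nth_default ?size_map.
- by rewrite sl; lia.
apply: execS (exec_qmv _ _ _ _) _ _ => //; first by rewrite sl; lia.
have loop m : m <= size l ->
  exec (PWhile (fun _ b => b != None) (Prim (fun a _ => (a, None, DN, DL))))
    (Conf w (h + size o) (listcells (take m l)) m) m.*2.+1
    (Conf w (h + size o) (fun=> None) 0).
  elim: m => [|m IH] lm.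
    rewrite take0; have -> : listcells [::] = fun=> None.
      by apply: functional_extensionality => -[|p] //; rewrite /listcells nth_nil.
    exact: EWhileF.
  apply: (@EWhileT _ _ _ (Conf w (h + size o) (listcells (take m l)) m) _ 1 m.*2.+1).
  - rewrite /= (nth_map false) // size_takel //.
  - by apply: EPrim => //=; rewrite fupd_id listcells_take.
  - by apply: IH; exact: ltnW.
  - by rewrite doubleS; lia.
have E : mvh DL (1 + size l * 1) = size l by rewrite muln1.
have := loop _ (leqnn _); rewrite take_size -[in X in Conf _ _ _ X]E => {}loop.
apply: execS loop _ _; first by rewrite sl; lia.
apply: execS (exec_wmv _ _ _ _) _ _; first by rewrite /= addn_gt0 h0.
  by rewrite sl; lia.
have E2 : mvh DL (h + size o) - size o = h.-1 by rewrite /=; lia.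
have E3 : mvh DR h.-1 = h by rewrite /= prednK.
apply: (@execS _ _ _ (Conf w h.-1 (fun=> None) 0) _ (size o).*2.+1).
- rewrite -E2; apply: exec_wgoL; rewrite /=; first by lia.
    move=> p lp; have -> : p = h + (p - h) by lia.
    by rewrite ro (nth_map false) //; lia.
  by rewrite E2 wh.
- by rewrite sl; lia.
- rewrite -[X in exec _ _ _ (Conf _ X _ _)]E3.
  by apply: execW (exec_wmv _ _ _ _) => //; rewrite sl; lia.
Qed.

Definition fprun (p : fp) (x : word) : word := den x (fun=> size x) p.

Lemma pbounded_size_den (p : fp) : exists2 F, pbounded F & forall L X e,
  fwf d L p -> envok X L e -> size (den X e p) <= F (size X).
Proof.
elim: p => [|b|p [F1 P1 H1] q [F2 P2 H2]|i j p [F P H]|i c b p [F1 P1 H1] q [F2 P2 H2]].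
- by exists (fun=> 0) => //; exact: pbounded_const.
- by exists (fun=> 1) => //; exact: pbounded_const.
- exists (fun n => F1 n + F2 n); first exact: pbounded_add.
  move=> L X e /= /andP[w1 w2] ok; rewrite size_cat.
  by apply: leq_add; [exact: H1 ok|exact: H2 ok].
- exists (fun n => n * F n); first by apply: pbounded_mul => //; exact: pbounded_id.
  move=> L X e /= /and5P[li lj ne iL wp] ok.
  have [lej _] := ok j.
  rewrite size_flatten /shape -map_comp sumnE big_map.
  apply: (@leq_trans (\sum_(a <- iota 0 (e j)) F (size X))).
    rewrite big_seq [X in _ <= X]big_seq; apply: leq_sum => a; rewrite mem_iota add0n => la.
    by apply: (H _ _ _ wp); apply: envok_upd => //; apply: leq_trans lej; exact: ltnW.
  by rewrite big_const_seq count_predT iter_addn_0 size_iota mulnC leq_mul2r lej orbT.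
- exists (fun n => F1 n + F2 n); first exact: pbounded_add.
  move=> L X e /= /and4P[li lb w1 w2] ok; case: ifP => _.
    by apply: leq_trans (leq_addr _ _); exact: H1 ok.
  by apply: leq_trans (leq_addl _ _); exact: H2 ok.
Qed.

Definition phase (p : fp) := PSeq setup (PSeq (fcomp d p) finish).

Lemma envok_init x : envok x [::] (fun=> size x).
Proof. by move=> i; split. Qed.

Lemma exec_phase p : fwf d [::] p -> exists2 F, pbounded F & forall x w h, reads w h x ->
  exists w' h', exec (phase p) (Conf w h (fun=> None) 0) (F (size x)) (Conf w' h' (fun=> None) 0)
    /\ reads w' h' (fprun p x).
Proof.
move=> wf; have [F1 P1 H1] := exec_comp d p; have [F2 P2 H2] := pbounded_size_den p.
exists (fun n => (10 + n * (3 * D + 10)) + (F1 n + (20 + 5 * (n * D).+1 + 2 * F2 n))).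
  have C := pbounded_const; have I := pbounded_id.
  apply: pbounded_add; first by apply: pbounded_add => //; exact: pbounded_mul.
  apply: pbounded_add => //; apply: pbounded_add; last exact: pbounded_mul.
  apply: pbounded_add => //; apply: pbounded_mul => //.
  apply: (@pbounded_le _ (fun n => n * D + 1)); first by move=> n; rewrite addn1.
  by apply: pbounded_add => //; exact: pbounded_mul.
move=> x w h rx; have ok := envok_init x.
exists (wout w (h + size x).+1 (fprun p x)), (h + size x).+1.
have ro : reads (wout w (h + size x).+1 (fprun p x)) (h + size x).+1 (fprun p x).
  move=> i; rewrite /wout; case: (ltnP i (size (fprun p x))) => li.
    by rewrite (nth_map false) // leq_addr ltn_add2l li addKn.
  rewrite ifF; last by lia.
  rewrite nth_default ?size_map //.
  by rewrite addSn -addnS -addnA rx nth_default // size_map; lia.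
split=> //.
apply: ESeq (exec_setup rx) _ (leqnn _).
apply: ESeq (H1 [::] _ _ _ _ wf ok) _ (leqnn _).
apply: execW (exec_finish _ _ _ _ ro) => //.
- by rewrite !leq_add2l leq_mul2l /=; exact: H2 wf ok.
- by rewrite /= /wout ltnn /= rx nth_default // size_map.
Qed.

End Phase.

Lemma trep_input x : trep (input_tape x) (fun p => if p is p'.+1 then nth None (map Some x) p' else None) 1.
Proof.
by case: x => [|b x]; split => //= -[|i].
Qed.

(** One phase will pad the input and the other will print over the padded word. The bound of the
    second phase is composed with the length of the first output, which is polynomial by
    [pbounded_size_den]. *)
Theorem fprun_poly_computable d1 p1 d2 p2 : fwf d1 [::] p1 -> fwf d2 [::] p2 ->
  poly_computable (fun x => fprun p2 (fprun p1 x)).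
Proof.
move=> w1 w2; have [F1 P1 H1] := exec_phase w1; have [F2 P2 H2] := exec_phase w2.
have [F3 P3 H3] := pbounded_size_den d1 p1.
case: P2 => c Hc.
have PB : pbounded (fun n => F1 n + c * (F3 n + 1) ^ c).
  apply: pbounded_add => //.
  apply: (@pbounded_comp (fun n => c * n ^ c) (fun n => F3 n + 1)).
    by exists c => n; rewrite leq_mul2l; case: (c) => // c'; rewrite leq_exp2r // leqnSn orbT.
  by apply: pbounded_add => //; exact: pbounded_const.
have [k Hk] := pbounded_poly PB.
exists (otm (PSeq (phase d1 p1) (phase d2 p2))), k => x.
pose w0 p := if p is p'.+1 then nth None (map Some x) p' else None : sym.
have r0 : reads w0 1 x by move=> i; rewrite add1n.
have [u1 [h1 [E1 r1]]] := H1 _ _ _ r0.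
have [u2 [h2 [E2 r2]]] := H2 _ _ _ r1.
have R0 : rep (input_tape x, blank_tape) (Conf w0 1 (fun=> None) 0).
  by split; [exact: trep_input|split => //= i; rewrite ?nth_nil].
have [z [Hz [[t1 t2 t3] _]]] := exec_zrun (ESeq E1 E2 (leqnn _)) R0.
rewrite /init.
have -> : @Cfg (otm (PSeq (phase d1 p1) (phase d2 p2))) (q0 (otm (PSeq (phase d1 p1) (phase d2 p2)))) (input_tape x) blank_tape = @Cfg (otm (PSeq (phase d1 p1) (phase d2 p2))) (Some (start (PSeq (phase d1 p1) (phase d2 p2)))) (input_tape x, blank_tape).1 (input_tape x, blank_tape).2 by [].
apply: (@zrun_all_halt _ _ _ _ z (fun o => o = fprun p2 (fprun p1 x))).
  apply: zrunW Hz; apply: leq_trans (Hk _); rewrite leq_add2l.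
  apply: leq_trans (Hc _) _; rewrite leq_mul2l; case: (c) => // c'.
  by rewrite leq_exp2r // addn1 ltnS (H3 [::] _ _ w1 (envok_init _)) orbT.
rewrite /tape_out t1.
have ts : forall (l : seq sym) o, (forall i, nth None l i = nth None (map Some o) i) -> takeSome l = o.
  elim=> [|a l IH] [|b o] //= H; first by have := H 0.
    by have /= -> := H 0.
  by have /= -> := H 0; congr cons; apply: IH => i; have := H i.+1.
apply: ts => -[|i] /=; first by have := r2 0; rewrite addn0 => ->.
by rewrite t2 /=; have := r2 i.+1; rewrite addnS => ->.
Qed.

(** * First-order sentences over a word and their propositional expansion *)

Definition enc_unary v : word := nseq v true ++ [:: false].

Fixpoint encf (f : form) : word :=
  match f with
  | FConst b => [:: false; false; b]
  | FVar v => [:: false; true] ++ enc_unary v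
  | FNot g => [:: true; false] ++ encf g
  | FAnd g h => [:: true; true; false] ++ encf g ++ encf h
  | FOr g h => [:: true; true; true] ++ encf g ++ encf h
  end.

Definition enc_blocks (ms : seq nat) : word := flatten [seq true :: enc_unary m | m <- ms].

Definition enc_inst (ms : seq nat) (f : form) : word := enc_blocks ms ++ false :: encf f.

Lemma dec_unary_enc v r : dec_unary (enc_unary v ++ r) = Some (v, r).
Proof. by rewrite /enc_unary; elim: v => //= v ->. Qed.

Lemma dec_unaryP s v r : dec_unary s = Some (v, r) -> s = enc_unary v ++ r.
Proof.
elim: s v => //= -[] s IH v; last by case=> <- <-.
by case: dec_unary IH => // -[k r'] IH [<- e] /=; rewrite (IH k) ?e.
Qed.

Lemma dec_sizes_enc n ms r : size ms < n ->
  dec_sizes n (enc_blocks ms ++ false :: r) = Some (ms, r).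
Proof.
elim: n ms => // n IH [|m ms] //= lt.
by rewrite -/(enc_blocks ms) -catA dec_unary_enc IH.
Qed.

Lemma dec_sizesP n s ms r : dec_sizes n s = Some (ms, r) -> s = enc_blocks ms ++ false :: r.
Proof.
elim: n s ms r => //= n IH [//|[] s] ms r; last by case=> <- <-.
case E: dec_unary => [[m r1]|//]; case E2: dec_sizes => [[ms' r2]|//] [<- <-].
by rewrite (dec_unaryP E) (IH _ _ _ E2) /enc_blocks /= -catA.
Qed.

Lemma dec_form_enc n f r : size (encf f) <= n -> dec_form n (encf f ++ r) = Some (f, r).
Proof.
elim: n f r => [|n IH] [b|v|g|g h|g h] r //= le.
- by rewrite dec_unary_enc.
- by rewrite IH //; lia.
- by rewrite -catA !IH //; rewrite size_cat in le; lia.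
- by rewrite -catA !IH //; rewrite size_cat in le; lia.
Qed.

Lemma dec_formP n s f r : dec_form n s = Some (f, r) -> s = encf f ++ r.
Proof.
elim: n s f r => //= n IH [//|[] [//|[] s]] f r.
- case: s => // c s; case E: dec_form => [[g r1]|//]; case E2: dec_form => [[h r2]|//] [<- <-].
  by rewrite (IH _ _ _ E) (IH _ _ _ E2); case: c; rewrite /= catA.
- by case E: dec_form => [[g r1]|//] [<- <-]; rewrite (IH _ _ _ E).
- by case E: dec_unary => [[v r1]|//] [<- <-]; rewrite (dec_unaryP E).
- by case: s => // b s [<- <-].
Qed.

Lemma size_enc_blocks ms : size ms <= size (enc_blocks ms).
Proof. by elim: ms => //= m ms IH; rewrite size_cat -/(enc_blocks ms); lia. Qed.

Lemma decodeP s ms f : decode s = Some (ms, f) <->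
  [/\ s = enc_inst ms f, all (fun m => 0 < m) ms & maxvar1 f <= sumn ms].
Proof.
rewrite /decode; split.
  case E: dec_sizes => [[ms' r]|//]; case E2: dec_form => [[f' r']|//].
  case: ifP => // /and3P[/eqP r0 H1 H2] [<- <-]; split=> //.
  by rewrite (dec_sizesP E) (dec_formP E2) r0 cats0.
case=> -> H1 H2; rewrite dec_sizes_enc; last first.
  by rewrite size_cat /=; have := size_enc_blocks ms; lia.
rewrite -[encf f]cats0 dec_form_enc ?H1 ?H2 //.
by rewrite !size_cat /=; lia.
Qed.

Lemma enc_unary_inj u v r r' : enc_unary u ++ r = enc_unary v ++ r' -> u = v /\ r = r'.
Proof. by move/(congr1 dec_unary); rewrite !dec_unary_enc => -[-> ->]. Qed.

(* First-order formulas over the positions of a word, with binary relation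
   variables; the variable names 0, 1 are used for printing and the name 2
   stands for the length of the word, as an upper bound of quantifiers. *)
Inductive fo :=
| OC of bool
| OR (b r i j : nat)
| OT (i c b : nat)
| ON of fo
| OA of fo & fo
| OO of fo & fo
| OI of fo & fo
| OE (i j : nat) of fo
| OF (i j : nat) of fo.

Fixpoint fsem (X : word) (A : nat -> nat -> nat -> nat -> bool) (e : nat -> nat)
    (f : fo) : Prop :=
  match f with
  | OC b => b
  | OR b r i j => A b r (e i) (e j)
  | OT i c b => posbit X e (e i + c) b
  | ON f => ~ fsem X A e f
  | OA f h => fsem X A e f /\ fsem X A e h
  | OO f h => fsem X A e f \/ fsem X A e h
  | OI f h => fsem X A e f -> fsem X A e h
  | OE i j f => exists a, a < e j /\ fsem X A (fupd e i a) f
  | OF i j f => forall a, a < e j -> fsem X A (fupd e i a) f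
  end.

Section Print.

Variable K : nat.

(** The word is known when the formula is printed, so [OT] becomes a constant. Only relation entries
    become variables, numbered by block, relation, row and column. *)
Fixpoint expand (X : word) (e : nat -> nat) (f : fo) : form :=
  match f with
  | OC b => FConst b
  | OR b r i j => FVar (((b * K + r) * size X + e i) * size X + e j)
  | OT i c b => FConst (posbit X e (e i + c) b)
  | ON f => FNot (expand X e f)
  | OA f h => FAnd (expand X e f) (expand X e h)
  | OO f h => FOr (expand X e f) (expand X e h)
  | OI f h => FOr (FNot (expand X e f)) (expand X e h)
  | OE i j f => foldr FOr (FConst false) [seq expand X (fupd e i a) f | a <- iota 0 (e j)]
  | OF i j f => foldr FAnd (FConst true) [seq expand X (fupd e i a) f | a <- iota 0 (e j)]
  end.

Definition relof N (y : seq bool) g i j := nth false y ((g * N + i) * N + j).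

Lemma eval_expand X pre f e : eval pre (expand X e f) <-> fsem X (fun b r => relof (size X) pre (b * K + r)) e f.
Proof.
elim: f e => [b|bl r i j|i c b|f IH|f IHf h IHh|f IHf h IHh|f IHf h IHh|i j f IH|i j f IH] e //=.
- by rewrite -IH; split=> /negP.
- by rewrite -IHf -IHh; split=> /andP.
- by rewrite -IHf -IHh; split=> /orP.
- by rewrite -IHf -IHh; case: (eval _ _); split=> //= H; apply: H.
- have -> : eval pre (foldr FOr (FConst false) [seq expand X (fupd e i a) f | a <- iota 0 (e j)])
      = has (fun a => eval pre (expand X (fupd e i a) f)) (iota 0 (e j)).
    by elim: (iota _ _) => //= a s ->.
  split.
    by case/hasP => a; rewrite mem_iota add0n => la /IH H; exists a.
  by case=> a [la /IH H]; apply/hasP; exists a => //; rewrite mem_iota.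
- have -> : eval pre (foldr FAnd (FConst true) [seq expand X (fupd e i a) f | a <- iota 0 (e j)])
      = all (fun a => eval pre (expand X (fupd e i a) f)) (iota 0 (e j)).
    by elim: (iota _ _) => //= a s ->.
  split.
    by move/allP => H a la; apply/IH/H; rewrite mem_iota.
  by move=> H; apply/allP => a; rewrite mem_iota add0n => la; apply/IH/H.
Qed.

Definition emits (l : word) : fp := foldr (fun b => FSeq (FEmit b)) FSkip l.
Definition reps n (p : fp) : fp := iter n (FSeq p) FSkip.

Definition square : fp := FFor 0 2 (FFor 1 2 (FEmit true)).

(** The number of a variable is written in unary by consecutive loops for [(b * K + r) * N * N],
    [e i * N] and [e j], where [N] is the length. A quantifier prints one connective per instance
    and closes with the neutral constant, as in the right nested [foldr]. *)
Fixpoint tr (f : fo) : fp :=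
  match f with
  | OC b => emits [:: false; false; b]
  | OR b r i j => FSeq (emits [:: false; true]) (FSeq (reps (b * K + r) square)
      (FSeq (FFor 0 i (FFor 1 2 (FEmit true))) (FSeq (FFor 0 j (FEmit true)) (FEmit false))))
  | OT i c b => FIf i c b (emits [:: false; false; true]) (emits [:: false; false; false])
  | ON f => FSeq (emits [:: true; false]) (tr f)
  | OA f h => FSeq (emits [:: true; true; false]) (FSeq (tr f) (tr h))
  | OO f h => FSeq (emits [:: true; true; true]) (FSeq (tr f) (tr h))
  | OI f h => FSeq (emits [:: true; true; true; true; false]) (FSeq (tr f) (tr h))
  | OE i j f => FSeq (FFor i j (FSeq (emits [:: true; true; true]) (tr f)))
                  (emits [:: false; false; false])
  | OF i j f => FSeq (FFor i j (FSeq (emits [:: true; true; false]) (tr f)))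
                  (emits [:: false; false; true])
  end.

Section Wf.

Variables (d n : nat).

Fixpoint owf (L : seq nat) (f : fo) : bool :=
  match f with
  | OC _ => true
  | OR b r i j => [&& b < n, r < K, i \in L & j \in L]
  | OT i c b => (i < d) && (b <= d)
  | ON f => owf L f
  | OA f h | OO f h | OI f h => owf L f && owf L h
  | OE i j f | OF i j f => [&& 2 < i, i < d, j < d, i != j, i \notin L & owf (i :: L) f]
  end.

Lemma fwf_reps L c p : fwf d L p -> fwf d L (reps c p).
Proof. by move=> w; elim: c => //= c ->; rewrite w. Qed.

Lemma den_reps X e c p m b : den X e p = nseq m b -> den X e (reps c p) = nseq (c * m) b.
Proof. by move=> H; elim: c => //= c IH; rewrite IH H -nseqD mulSn. Qed.

Lemma flatten_const T (s : seq nat) (h : nat -> seq T) b m : (forall a, a \in s -> h a = nseq m b) ->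
  flatten [seq h a | a <- s] = nseq (size s * m) b.
Proof.
elim: s => //= a s IH H; rewrite (H a) ?mem_head // IH; first by rewrite mulSn nseqD.
by move=> c cs; apply: H; rewrite inE cs orbT.
Qed.

Lemma den_square X e : e 2 = size X -> den X e square = nseq (size X * size X) true.
Proof.
move=> e2 /=; rewrite e2 (@flatten_const _ _ _ true (size X)) ?size_iota // => a _.
rewrite {1}/fupd /= e2 (@flatten_const _ _ _ true 1) ?size_iota ?muln1 //.
Qed.

Lemma den_tr L X e f : envok X L e -> all (fun i => 2 < i) L -> owf L f ->
  den X e (tr f) = encf (expand X e f).
Proof.
elim: f L e => [b|bl r i j|i c b|f IH|f IHf h IHh|f IHf h IHh|f IHf h IHh|i j f IH|i j f IH] L e ok aL //=.
- move=> _; have e2 : e 2 = size X.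
    have [_ -> //] := ok 2.
    by apply/negP => L2; have := allP aL _ L2.
  rewrite (@den_reps _ _ _ _ _ true (den_square e2)).
  rewrite (@flatten_const _ _ _ true (size X)); last first.
    move=> a _; rewrite {1}/fupd /= e2 (@flatten_const _ _ _ true 1) ?size_iota ?muln1 //.
  rewrite (@flatten_const _ _ _ true 1) // !size_iota muln1 /enc_unary.
  by move: (bl * K + r) => g; do 2!congr cons; rewrite mulnDl !nseqD mulnA -!catA.
- by move=> _; case: posbit.
- by move=> w; rewrite (IH L).
1-3: by move=> /andP[w1 w2]; rewrite (IHf L) // (IHh L).
- case/and5P=> i2 id jd ij /andP[iL w]; have [lej _] := ok j.
  have : forall a, a \in iota 0 (e j) -> a <= size X.
    by move=> a; rewrite mem_iota => /andP[_ la]; apply: leq_trans lej; exact: ltnW.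
  elim: (iota 0 (e j)) => [//|a s IHs] H /=.
  rewrite (IH (i :: L)) //=; last by rewrite i2.
    by rewrite -catA IHs // => b bs; apply: H; rewrite inE bs orbT.
  by apply: envok_upd => //; apply: H; rewrite mem_head.
- case/and5P=> i2 id jd ij /andP[iL w]; have [lej _] := ok j.
  have : forall a, a \in iota 0 (e j) -> a <= size X.
    by move=> a; rewrite mem_iota => /andP[_ la]; apply: leq_trans lej; exact: ltnW.
  elim: (iota 0 (e j)) => [//|a s IHs] H /=.
  rewrite (IH (i :: L)) //=; last by rewrite i2.
    by rewrite -catA IHs // => b bs; apply: H; rewrite inE bs orbT.
  by apply: envok_upd => //; apply: H; rewrite mem_head.
Qed.

Lemma fwf_tr L f : 2 < d -> all (fun i => 2 < i < d) L -> owf L f -> fwf d L (tr f).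
Proof.
move=> d2; elim: f L => [b|bl r i j|i c b|f IH|f IHf h IHh|f IHf h IHh|f IHf h IHh|i j f IH|i j f IH] L aL //.
- case/and4P=> _ _ /(allP aL)/andP[i2 id] /(allP aL)/andP[j2 jd].
  have n0 : 0 \notin L by apply/negP => /(allP aL).
  have n1 : 1 \notin L by apply/negP => /(allP aL).
  have [d0 d1] : 0 < d /\ 1 < d by lia.
  rewrite /= fwf_reps /= ?d0 ?d1 ?d2 ?id ?jd ?n0 ?inE ?n1 //=.
  by case: i i2 {id} => // i _; case: j j2 {jd}.
- by case/andP=> id bd /=; rewrite id ltnS bd.
- exact: IH.
1-3: by case/andP=> w1 w2 /=; rewrite IHf // IHh.
- case/and5P=> i2 id jd ij /andP[iL w] /=; rewrite id jd ij iL IH //=.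
  by rewrite i2 id.
- case/and5P=> i2 id jd ij /andP[iL w] /=; rewrite id jd ij iL IH //=.
  by rewrite i2 id.
Qed.

Lemma maxvar1_expand L X e f : envok X L e -> (forall i, i \in L -> e i < size X) -> owf L f ->
  maxvar1 (expand X e f) <= n * K * size X * size X.
Proof.
elim: f L e => [b|bl r i j|i c b|f IH|f IHf h IHh|f IHf h IHh|f IHf h IHh|i j f IH|i j f IH] L e ok lv //=.
- case/and4P=> lb lr /lv li /lv lj.
  have lg : bl * K + r < n * K by nia.
  nia.
- exact: IH.
1-3: by case/andP=> w1 w2; rewrite geq_max (IHf L) // (IHh L).
- case/and5P=> i2 id jd ij /andP[iL w]; have [lej _] := ok j.
  have : forall a, a \in iota 0 (e j) -> a < size X.
    by move=> a; rewrite mem_iota => /andP[_ la]; exact: leq_trans lej.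
  elim: (iota 0 (e j)) => [//|a s IHs] H /=.
  rewrite geq_max IHs ?andbT; last by move=> b bs; apply: H; rewrite inE bs orbT.
  apply: (IH (i :: L)) => //; first by apply: envok_upd => //; apply/ltnW/H/mem_head.
  move=> k; rewrite inE /fupd; case: eqP => [_ _|_ /=]; [exact/H/mem_head|exact: lv].
- case/and5P=> i2 id jd ij /andP[iL w]; have [lej _] := ok j.
  have : forall a, a \in iota 0 (e j) -> a < size X.
    by move=> a; rewrite mem_iota => /andP[_ la]; exact: leq_trans lej.
  elim: (iota 0 (e j)) => [//|a s IHs] H /=.
  rewrite geq_max IHs ?andbT; last by move=> b bs; apply: H; rewrite inE bs orbT.
  apply: (IH (i :: L)) => //; first by apply: envok_upd => //; apply/ltnW/H/mem_head.
  move=> k; rewrite inE /fupd; case: eqP => [_ _|_ /=]; [exact/H/mem_head|exact: lv].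
Qed.

Definition print_inst (f : fo) : fp :=
  FSeq (reps n (FSeq (FEmit true) (FSeq (reps K square) (FEmit false))))
    (FSeq (FEmit false) (tr f)).

Lemma fprun_print_inst f X : owf [::] f ->
  fprun (print_inst f) X = enc_inst (nseq n (K * (size X * size X))) (expand X (fun=> size X) f).
Proof.
move=> w; rewrite /fprun /= (@den_tr [::] X _ f (envok_init X) isT w).
congr cat; elim: (n) => //= c ->; rewrite (@den_reps _ _ _ _ _ true (den_square _)) //.
Qed.

Lemma fwf_print_inst f : 2 < d -> owf [::] f -> fwf d [::] (print_inst f).
Proof.
move=> d2 w; rewrite /= fwf_tr // andbT; apply: fwf_reps => /=; rewrite andbT.
apply: fwf_reps; rewrite /= d2 !andbT; lia.
Qed.

End Wf.

End Print.

(* The mark lets formulas recover [x]: its positions are those before the last [true]. *)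
Definition pad k c (x : word) : word := x ++ true :: nseq (c * size x ^ k + c) false.

Fixpoint nest k : fp := if k is k'.+1 then FFor (k'.+2) 1 (nest k') else FEmit false.

Definition print_pad k c : fp :=
  FSeq (FFor 0 1 (FIf 0 0 0 (FEmit true) (FEmit false)))
  (FSeq (FEmit true) (FSeq (reps c (nest k)) (reps c (FEmit false)))).

Lemma fprun_print_pad k c x : fprun (print_pad k c) x = pad k c x.
Proof.
rewrite /fprun /= /pad; congr cat; last first.
  congr cons; rewrite nseqD (@den_reps _ _ _ (FEmit false) 1 false) // muln1; congr cat.
  apply: den_reps; suff : forall e, e 1 = size x -> den x e (nest k) = nseq (size x ^ k) false by apply.
  elim: k => //= k IH e e1.
  rewrite e1 (@flatten_const _ _ _ false (size x ^ k)) ?size_iota ?expnS // => a _.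
  by apply: IH; rewrite /fupd.
rewrite -[RHS](mkseq_nth false) /mkseq.
have : forall a, a \in iota 0 (size x) -> a < size x by move=> a; rewrite mem_iota.
elim: (iota 0 (size x)) => //= a s IH H; rewrite IH; last by move=> b bs; apply: H; rewrite inE bs orbT.
rewrite /posbit {1 2}/fupd /= addn0 H ?mem_head //=; by case: nth.
Qed.

Lemma fwf_print_pad k c : fwf k.+3 [::] (print_pad k c).
Proof.
rewrite /= fwf_reps ?fwf_reps //.
have : forall k', k' <= k -> forall L, (forall i, i \in L -> k'.+1 < i) -> fwf k.+3 L (nest k').
  elim=> [//|k' IH] lk L H /=.
  rewrite IH ?ltnS ?(ltnW lk) //; last by move=> i; rewrite inE => /orP[/eqP-> //|/H]; exact: ltnW.
  rewrite andbT; apply/andP; split; first by lia.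
  by apply/negP => /H; rewrite ltnn.
by apply.
Qed.

Theorem fo_poly_computable d n K k c f : 2 < d -> owf K d n [::] f ->
  poly_computable (fun x => enc_inst (nseq n (K * (size (pad k c x) * size (pad k c x))))
    (expand K (pad k c x) (fun=> size (pad k c x)) f)).
Proof.
move=> d2 w.
have [M [k' H]] := fprun_poly_computable (fwf_print_pad k c) (fwf_print_inst d2 w).
by exists M, k' => x; have := H x; rewrite (fprun_print_inst _ w) fprun_print_pad.
Qed.

Lemma fupdE T (c : nat -> T) h a p : fupd c h a p = if p == h then a else c p.
Proof. by []. Qed.

(** * Abbreviations for first-order formulas, and the formulas for tape rows *)

Definition EX i f := OE i 2 f.
Definition ALL i f := OF i 2 f.
Definition IFF f g := OA (OI f g) (OI g f).
Definition LIT (b : bool) f := if b then f else ON f.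
Definition BALL (T : Type) (l : seq T) (F : T -> fo) := foldr (fun x => OA (F x)) (OC true) l.
Definition BEX (T : Type) (l : seq T) (F : T -> fo) := foldr (fun x => OO (F x)) (OC false) l.
(** Bit [j.+1] of a position is the mark of variable [j], so this atom says that [e j = e i + c] and
    that this is a position. *)
Definition Shift c i j := OT i c j.+1.
(** There is no position below [e i]. The variables 18 and 19 are reserved for [Lt] and [Zero]. *)
Definition Zero i := ON (OE 19 i (OC true)).
Definition Lt i j := OE 18 j (Shift 0 18 i).

Section Macros.

Variables (X : word) (B : nat -> nat -> nat -> nat -> bool).
Notation N := (size X).
Notation fs := (fsem X B).

Lemma fs_iff e f g : fs e (IFF f g) <-> (fs e f <-> fs e g).
Proof. by split=> [[]|[]]; split. Qed.

Lemma fs_lit e b f : fs e (LIT b f) <-> (if b then fs e f else ~ fs e f).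
Proof. by case: b. Qed.

Lemma fs_ball (T : eqType) e (l : seq T) F : fs e (BALL l F) <-> forall x, x \in l -> fs e (F x).
Proof.
elim: l => [|x l IH]; first by split.
rewrite /= -/(BALL l F) IH; split=> [[H1 H2] y|H].
  by rewrite inE => /orP[/eqP->|/H2].
by split=> [|y yl]; apply: H; rewrite inE ?eqxx ?yl ?orbT.
Qed.

Lemma fs_bex (T : eqType) e (l : seq T) F : fs e (BEX l F) <-> exists2 x, x \in l & fs e (F x).
Proof.
elim: l => [|x l IH]; first by split=> // -[].
rewrite /= -/(BEX l F) IH; split=> [[H|[y yl H]]|[y]].
- by exists x; rewrite ?inE ?eqxx.
- by exists y; rewrite ?inE ?yl ?orbT.
- by rewrite inE => /orP[/eqP->|yl] H; [left|right; exists y].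
Qed.

Lemma fs_shift e c i j : fs e (Shift c i j) <-> e j = e i + c /\ e i + c < N.
Proof.
rewrite /= /posbit; split=> [/andP[-> /eqP ->] //|[-> ->]]; exact: eqxx.
Qed.

Lemma fs_zero e i : fs e (Zero i) <-> e i = 0.
Proof.
rewrite -[fs e _]/(~ exists a, a < e i /\ true); split=> [H|-> [a [//]]].
by apply/eqP; rewrite -leqn0 leqNgt; apply/negP => lt; apply: H; exists 0.
Qed.

Lemma fs_lt e i j : i != 18 -> e j <= N -> fs e (Lt i j) <-> e i < e j.
Proof.
move=> ni le; rewrite -[fs e _]/(exists a, a < e j /\ fs (fupd e 18 a) (Shift 0 18 i)).
split=> [[a [la]]|lt].
  by rewrite fs_shift !fupdE eqxx (negPf ni) addn0 => -[-> _].
exists (e i); split=> //; rewrite fs_shift !fupdE eqxx (negPf ni) addn0; split=> //.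
exact: leq_trans lt le.
Qed.

End Macros.

(* Simplification must stop at these abbreviations, which the lemmas above interpret. *)
Global Opaque IFF LIT BALL BEX Shift Zero Lt.

(* Relations of block 0: 0 is the output bit, 1 the oracle answers, 2 the
   witnesses, 3 to 10 the cells of the two tapes, from 11 on the states. *)
Definition rc (tau sd b : bool) : nat := 3 + 4 * tau + 2 * sd + b.

Definition cellv (B : nat -> nat -> nat -> nat -> bool) tau sd t i : sym :=
  if B 0 (rc tau sd true) t i then Some true
  else if B 0 (rc tau sd false) t i then Some false else None.

Definition Cell tau sd t i (a : sym) : fo :=
  match a with
  | Some true => OR 0 (rc tau sd true) t i
  | Some false => OA (OR 0 (rc tau sd false) t i) (ON (OR 0 (rc tau sd true) t i))
  | None => OA (ON (OR 0 (rc tau sd false) t i)) (ON (OR 0 (rc tau sd true) t i))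
  end.

Lemma fs_cell X B e tau sd t i a :
  fsem X B e (Cell tau sd t i a) <-> cellv B tau sd (e t) (e i) = a.
Proof.
rewrite /cellv; case: a => [[]|] /=; case: (B 0 (rc tau sd true) (e t) (e i));
  case: (B 0 (rc tau sd false) (e t) (e i));
  by split=> H; first [done | by split | by case: H => H1 H2; first [done | by case: H1 | by case: H2]].
Qed.

Global Opaque Cell.

(* Cells of the tape after writing [a] and moving to direction [d]; the cells on
   the right include the one under the head, and all positions are cut at [N]. *)
Definition newcell N (cl : bool -> nat -> sym) a d (sd : bool) i : sym :=
  match d, sd with
  | DN, false => cl false i
  | DN, true => if i is _.+1 then cl true i else a
  | DR, false => if i is i'.+1 then cl false i' else a
  | DR, true => if i.+1 < N then cl true i.+1 else None
  | DL, false => if i.+1 < N then cl false i.+1 else None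
  | DL, true => match i with 0 => cl false 0 | 1 => a | i'.+1 => cl true i' end
  end.

(* The variable 3 is the position 0, and the step is from time 4 to time 5. *)
Definition ShiftDown tau sd b := EX 7 (OA (Shift 1 6 7) (Cell tau sd 4 7 (Some b))).
Definition AtZero F G := OO (OA (Zero 6) F) (EX 7 (OA (Shift 1 7 6) G)).

Definition New tau (sd : bool) (a : sym) d b : fo :=
  match d, sd with
  | DN, false => Cell tau false 4 6 (Some b)
  | DN, true => AtZero (OC (a == Some b)) (Cell tau true 4 6 (Some b))
  | DR, false => AtZero (OC (a == Some b)) (Cell tau false 4 7 (Some b))
  | DR, true => ShiftDown tau true b
  | DL, false => ShiftDown tau false b
  | DL, true => AtZero (Cell tau false 4 3 (Some b))
      (OO (OA (Zero 7) (OC (a == Some b))) (OA (ON (Zero 7)) (Cell tau true 4 7 (Some b))))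
  end.

Section Rows.

Variables (X : word) (B : nat -> nat -> nat -> nat -> bool).
Notation N := (size X).
Notation fs := (fsem X B).

Lemma fs_shiftdown e tau sd b : e 2 = N ->
  fs e (ShiftDown tau sd b) <->
  (if (e 6).+1 < N then cellv B tau sd (e 4) (e 6).+1 else None) = Some b.
Proof.
move=> e2 /=; rewrite e2; split=> [[a [la]]|].
  by rewrite fs_shift fs_cell !fupdE /= addn1 => -[[-> ->] ->].
case: ifP => // lt E; exists (e 6).+1; split=> //.
by rewrite fs_shift fs_cell !fupdE /= addn1.
Qed.

Lemma fs_atzero e F G P : e 2 = N -> e 6 < N ->
  (forall i, e 6 = i.+1 -> fs (fupd e 7 i) G <-> P i) ->
  fs e (AtZero F G) <-> (if e 6 is i.+1 then P i else fs e F).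
Proof.
move=> e2 l6 H.
rewrite -[fs e _]/((fs e (Zero 6) /\ fs e F) \/ exists a, a < e 2 /\
   (fs (fupd e 7 a) (Shift 1 7 6) /\ fs (fupd e 7 a) G)).
rewrite fs_zero e2; case E: (e 6) => [|i].
  split=> [[[]//|[a [_ []]]]|]; last by left.
  by rewrite fs_shift !fupdE /= E addn1 => -[].
split=> [[[]//|[a [la []]]]|HP].
  rewrite fs_shift !fupdE /= E addn1 => -[[<-] _].
  by case: (H _ E).
right; exists i; rewrite fs_shift !fupdE /= E addn1.
by split; [lia|split; [split=> //; lia|case: (H _ E) => _; apply]].
Qed.

Lemma fs_new e tau sd a d b : e 2 = N -> e 3 = 0 -> e 6 < N ->
  fs e (New tau sd a d b) <-> newcell N (fun sd => cellv B tau sd (e 4)) a d sd (e 6) = Some b.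
Proof.
move=> e2 e3 l6; case: d; case: sd; rewrite /New.
- rewrite (@fs_atzero _ _ _ (fun i => newcell N (fun sd => cellv B tau sd (e 4)) a DL true i.+1 = Some b)) //.
    by case: (e 6) => //=; rewrite fs_cell e3.
  move=> i ei; rewrite -[fs _ (OO _ _)]/((fs (fupd e 7 i) (Zero 7) /\ (a == Some b)) \/
    (~ fs (fupd e 7 i) (Zero 7) /\ fs (fupd e 7 i) (Cell tau true 4 7 (Some b)))).
  rewrite fs_zero fs_cell !fupdE /=; case: i {ei} => [|i]; split.
  + by case=> [[_ /eqP]|[]].
  + by move=> ->; left; rewrite eqxx.
  + by case=> [[]|[]].
  + by move=> H; right; split.
- exact: fs_shiftdown.
- exact: fs_shiftdown.
- rewrite (@fs_atzero _ _ _ (fun i => cellv B tau false (e 4) i = Some b)) //.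
    by case: (e 6) => //=; split=> /eqP.
  by move=> i ei; rewrite fs_cell !fupdE.
- rewrite (@fs_atzero _ _ _ (fun i => cellv B tau true (e 4) (e 6) = Some b)) //.
    by case: (e 6) => //=; split=> /eqP.
  by move=> i ei; rewrite fs_cell !fupdE.
- by rewrite fs_cell.
Qed.

Definition bools := [:: false; true].

Lemma in_bools b : b \in bools. Proof. by case: b. Qed.

Definition TapeC tau a d :=
  ALL 6 (BALL bools (fun sd => BALL bools (fun b => IFF (OR 0 (rc tau sd b) 5 6) (New tau sd a d b)))).

Lemma fs_tapec e tau a d : e 2 = N -> e 3 = 0 ->
  fs e (TapeC tau a d) <-> forall i sd b, i < N ->
    B 0 (rc tau sd b) (e 5) i <-> newcell N (fun sd => cellv B tau sd (e 4)) a d sd i = Some b.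
Proof.
move=> e2 e3; rewrite /= e2; split.
  move=> H i sd b li; have := H _ li; rewrite fs_ball => /(_ sd (in_bools _)).
  by rewrite fs_ball => /(_ b (in_bools _)); rewrite fs_iff fs_new.
move=> H i li; apply/fs_ball => sd _; apply/fs_ball => b _.
by rewrite fs_iff fs_new //; exact: H.
Qed.

Definition TapeBlank tau :=
  ALL 6 (BALL bools (fun sd => BALL bools (fun b => ON (OR 0 (rc tau sd b) 5 6)))).

Lemma fs_tapeblank e tau : e 2 = N ->
  fs e (TapeBlank tau) <-> forall i sd b, i < N -> ~ B 0 (rc tau sd b) (e 5) i.
Proof.
move=> e2; rewrite /= e2; split.
  move=> H i sd b li; have := H _ li; rewrite fs_ball => /(_ sd (in_bools _)).
  by rewrite fs_ball => /(_ b (in_bools _)).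
move=> H i li; apply/fs_ball => sd _; apply/fs_ball => b _.
exact: H.
Qed.

End Rows.
Global Opaque New TapeC TapeBlank.

(** * Simulation of the oracle machine *)

#[global] Arguments fupd T c h a p /.

Section Simulation.

Variables (M : OTM).
Notation Q := (state M).

Definition rs (q : Q) : nat := 11 + enum_rank q.

Definition StateIs tv (q' : Q) := BALL (enum Q) (fun q => LIT (q == q') (OR 0 (rs q) tv tv)).

Definition trip := enum {: Q * sym * sym}.

Lemma in_trip p : p \in trip. Proof. by rewrite mem_enum. Qed.

Definition ACT (p : Q * sym * sym) : fo :=
  let: (q, a, b) := p in
  OA (OR 0 (rs q) 4 4) (OA (Cell false true 4 3 a) (Cell true true 4 3 b)).

(** Repeating a halting configuration gives the tableau one row per position, however early the
    machine stops. *)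
Definition Row (p : Q * sym * sym) : fo :=
  let: (q, a, b) := p in
  match delta q a b with
  | Act q' w1 w2 d1 d2 => OA (StateIs 5 q') (OA (TapeC false w1 d1) (TapeC true w2 d2))
  | Ask qy qn =>
      OA (OA (OI (OR 0 1 4 4) (StateIs 5 qy)) (OI (ON (OR 0 1 4 4)) (StateIs 5 qn)))
        (OA (TapeC false a DN) (TapeBlank true))
  | Halt _ => OA (StateIs 5 q) (OA (TapeC false a DN) (TapeC true b DN))
  end.

Definition StepF := ALL 4 (ALL 5 (OI (Shift 1 4 5) (BALL trip (fun p => OI (ACT p) (Row p))))).

Definition InitF :=
  OA (StateIs 3 (q0 M))
  (ALL 6 (BALL bools (fun tau => BALL bools (fun sd => BALL bools (fun b =>
     IFF (OR 0 (rc tau sd b) 3 6)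
       (if ~~ tau && sd then OA (LIT b (OT 6 0 0)) (EX 7 (OA (Lt 6 7) (OT 7 0 0))) else OC false)))))).

Definition is_ask (p : Q * sym * sym) :=
  let: (q, a, b) := p in if delta q a b is Ask _ _ then true else false.

Definition is_halt (c : bool) (p : Q * sym * sym) :=
  let: (q, a, b) := p in if delta q a b is Halt c' then c' == c else false.

Definition AskAt := BEX (filter is_ask trip) ACT.

Definition HaltF :=
  EX 4 (BEX bools (fun c => BEX (filter (is_halt c) trip) (fun p => OA (ACT p) (LIT c (OR 0 0 3 3))))).

(** Forces to zero what no oracle check inspects: the answer bit at times without a query, and the
    witness row wherever the answer bit is zero. *)
Definition NonAskF :=
  ALL 4 (OA (OI (ON AskAt) (ON (OR 0 1 4 4))) (OI (ON (OR 0 1 4 4)) (ALL 6 (ON (OR 0 2 4 6))))).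

(** States and answers are sets of times, stored on the diagonal of binary relations, so the entries
    off the diagonal are forced to be false. The relations in [pins] are there because all blocks
    have equally many relations. *)
Definition PinF (pins : seq nat) :=
  ALL 4 (ALL 5 (OA (OI (OR 0 0 4 5) (OA (Zero 4) (Zero 5)))
    (OA (OI (OR 0 1 4 5) (Shift 0 4 5))
    (OA (BALL (enum Q) (fun q => OI (OR 0 (rs q) 4 5) (Shift 0 4 5)))
    (BALL pins (fun r => ON (OR 0 r 4 5))))))).

Section Semantics.

Variables (X : word) (B : nat -> nat -> nat -> nat -> bool).
Notation N := (size X).
Notation fs := (fsem X B).

Lemma fs_stateis e tv q' : fs e (StateIs tv q') <-> forall q, B 0 (rs q) (e tv) (e tv) = (q == q').
Proof.
rewrite fs_ball; split=> H q.
  have := H q; rewrite mem_enum => /(_ isT); rewrite fs_lit /=.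
  by case: (q == q') => [->|/negP/negbTE ->].
by move=> _; rewrite fs_lit /= H; case: (q == q').
Qed.

Definition act t (p : Q * sym * sym) : Prop :=
  [/\ B 0 (rs p.1.1) t t, cellv B false true t 0 = p.1.2 & cellv B true true t 0 = p.2].

Lemma fs_act e p : e 3 = 0 -> fs e (ACT p) <-> act (e 4) p.
Proof.
move=> e3; case: p => [[q a] b]; rewrite /= !fs_cell e3.
by split=> [[? []]|[]].
Qed.

Definition tapeeq tau t a d := forall i sd b, i < N ->
  B 0 (rc tau sd b) t.+1 i <-> newcell N (fun sd => cellv B tau sd t) a d sd i = Some b.

Definition statesat t (q' : Q) := forall q, B 0 (rs q) t t = (q == q').

Definition row t (p : Q * sym * sym) : Prop :=
  let: (q, a, b) := p in
  match delta q a b with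
  | Act q' w1 w2 d1 d2 =>
      [/\ statesat t.+1 q', tapeeq false t w1 d1 & tapeeq true t w2 d2]
  | Ask qy qn =>
      [/\ statesat t.+1 (if B 0 1 t t then qy else qn), tapeeq false t a DN &
          forall i sd b, i < N -> ~ B 0 (rc true sd b) t.+1 i]
  | Halt _ => [/\ statesat t.+1 q, tapeeq false t a DN & tapeeq true t b DN]
  end.

Lemma fs_row e p : e 2 = N -> e 3 = 0 -> e 5 = (e 4).+1 -> fs e (Row p) <-> row (e 4) p.
Proof.
move=> e2 e3 e5; case: p => [[q a] b] /=; case: delta => [q' w1 w2 d1 d2|qy qn|c] /=;
  rewrite !fs_tapec ?fs_tapeblank // !fs_stateis e5.
- by split=> [[? []]|[]].
- split=> [[[H1 H2] [H3 H4]]|[H1 H2 H3]]; split=> //.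
    by case E: (B 0 1 (e 4) (e 4)); [apply: H1|apply: H2; rewrite E].
  by split=> H; [move: H1; rewrite H|move/negP/negbTE: H H1 => ->].
- by split=> [[? []]|[]].
Qed.

Lemma fs_stepf e : e 2 = N -> e 3 = 0 ->
  fs e StepF <-> forall t p, t.+1 < N -> act t p -> row t p.
Proof.
move=> e2 e3; rewrite /= e2.
split.
  move=> H t p lt Hp; have := H t (ltnW lt) t.+1 lt.
  rewrite fs_shift /= addn1 fs_ball => /(_ (conj erefl lt) p (in_trip p)) /=.
  by rewrite fs_act ?fs_row //=; apply.
move=> H t lt t' lt'; rewrite fs_shift fs_ball /= addn1 => -[-> lt2] p _.
by rewrite /= fs_act ?fs_row //=; exact: H.
Qed.

Definition initcell (tau sd : bool) i : sym :=
  if ~~ tau && sd && has (nth false X) (iota i.+1 (N - i.+1)) then Some (nth false X i) else None.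

Lemma fs_initf e : e 2 = N -> e 3 = 0 ->
  fs e InitF <-> statesat 0 (q0 M) /\
    forall tau sd b i, i < N -> B 0 (rc tau sd b) 0 i <-> initcell tau sd i = Some b.
Proof.
move=> e2 e3; rewrite -[fs e InitF]/(fs e (StateIs 3 (q0 M)) /\ forall a, a < e 2 ->
  fs (fupd e 6 a) (BALL bools (fun tau => BALL bools (fun sd => BALL bools (fun b =>
     IFF (OR 0 (rc tau sd b) 3 6)
       (if ~~ tau && sd then OA (LIT b (OT 6 0 0)) (EX 7 (OA (Lt 6 7) (OT 7 0 0))) else OC false)))))).
rewrite fs_stateis e3 e2.
have E tau sd b i : i < N ->
  fs (fupd e 6 i) (IFF (OR 0 (rc tau sd b) 3 6)
    (if ~~ tau && sd then OA (LIT b (OT 6 0 0)) (EX 7 (OA (Lt 6 7) (OT 7 0 0))) else OC false)) <->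
  (B 0 (rc tau sd b) 0 i <-> initcell tau sd i = Some b).
  move=> li; rewrite fs_iff /initcell [fs _ (OR _ _ _ _)]/= e3.
  suff -> : fs (fupd e 6 i) (if ~~ tau && sd then
      OA (LIT b (OT 6 0 0)) (EX 7 (OA (Lt 6 7) (OT 7 0 0))) else OC false) <->
    (if ~~ tau && sd && has (nth false X) (iota i.+1 (N - i.+1)) then Some (nth false X i) else None) = Some b by [].
  case: (~~ tau && sd) => //=; rewrite fs_lit /= /posbit /= addn0 li e2.
  have -> : (exists a, a < N /\ fs (fupd (fupd e 6 i) 7 a) (Lt 6 7) /\
      (fupd (fupd e 6 i) 7 a 7 + 0 < N) && nth false X (fupd (fupd e 6 i) 7 a 7 + 0)) <->
      has (nth false X) (iota i.+1 (N - i.+1)).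
    split=> [[a [la]]|/hasP[a]].
      rewrite fs_lt //=; last exact: ltnW.
      by rewrite addn0 => -[lt /andP[_ Xa]]; apply/hasP; exists a; rewrite // mem_iota; lia.
    rewrite mem_iota => la Xa; exists a; rewrite fs_lt //= ?addn0; last by lia.
    by rewrite Xa; lia.
  case: has; last by split=> // -[].
  by case: b; case: (nth false X i); split=> //; case.
split=> -[H1 H2]; split=> //.
  move=> tau sd b i li; apply/E => //.
  by have := H2 i li; rewrite fs_ball => /(_ tau (in_bools _)); rewrite fs_ball =>
    /(_ sd (in_bools _)); rewrite fs_ball => /(_ b (in_bools _)).
move=> i li; apply/fs_ball => tau _; apply/fs_ball => sd _; apply/fs_ball => b _.
by apply/E => //; exact: H2.
Qed.

Definition askat t := exists2 p, is_ask p & act t p.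

Lemma fs_askat e : e 3 = 0 -> fs e AskAt <-> askat (e 4).
Proof.
move=> e3; rewrite fs_bex; split=> [[p]|[p ap Hp]].
  by rewrite mem_filter => /andP[ap _] /fs_act Hp; exists p => //; exact: Hp.
by exists p; [rewrite mem_filter ap in_trip|apply/fs_act].
Qed.

Lemma fs_haltf e : e 2 = N -> e 3 = 0 ->
  fs e HaltF <-> exists t p c, [/\ t < N, is_halt c p, act t p & B 0 0 0 0 = c].
Proof.
move=> e2 e3; rewrite /= e2; split.
  case=> t [lt]; rewrite fs_bex => -[c _]; rewrite fs_bex => -[p].
  rewrite mem_filter => /andP[hp _] /= []; rewrite fs_act ?fs_lit //= => Hp Hc.
  exists t, p, c; split=> //; move: Hc; rewrite /= e3.
  by case: (c) => [//|/negP/negbTE].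
case=> t [p [c [lt hp Hp Hc]]]; exists t; split=> //; apply/fs_bex; exists c; first exact: in_bools.
apply/fs_bex; exists p; first by rewrite mem_filter hp in_trip.
by rewrite /= fs_act ?fs_lit //=  /= e3; split=> //; rewrite Hc; case: (c).
Qed.

Lemma fs_nonaskf e : e 2 = N -> e 3 = 0 ->
  fs e NonAskF <-> forall t, t < N -> (~ askat t -> ~ B 0 1 t t) /\
    (~ B 0 1 t t -> forall v, v < N -> ~ B 0 2 t v).
Proof.
move=> e2 e3; rewrite /= e2; split=> H t lt; have := H t lt;
  by rewrite fs_askat //= e2.
Qed.

Lemma fs_pinf e pins : e 2 = N ->
  fs e (PinF pins) <-> forall i j, i < N -> j < N ->
    [/\ B 0 0 i j -> i = 0 /\ j = 0, B 0 1 i j -> i = j,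
        forall q, B 0 (rs q) i j -> i = j & forall r, r \in pins -> ~ B 0 r i j].
Proof.
move=> e2; rewrite /= e2; split=> [H|].
  move=> i j li lj; have := H i li j lj.
  rewrite !fs_zero !fs_shift !fs_ball /= => -[H1 [H2 [H3 H4]]]; split=> //.
  - by case/H2 => ->; rewrite addn0.
  - move=> q; have := H3 q; rewrite mem_enum => /(_ isT) /=.
    by rewrite !fs_shift /= addn0 => {}H3 /H3[].
move=> H i li j lj; have [H1 H2 H3 H4] := H i j li lj.
rewrite !fs_zero !fs_shift !fs_ball /= addn0; split=> //; split; [|split].
- by move/H2 => ->.
- by move=> q _ /=; rewrite !fs_shift /= addn0 => /H3 ->.
- by move=> r /H4.
Qed.

End Semantics.
End Simulation.

#[global] Instance and3_iff : Morphisms.Proper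
  (Morphisms.respectful iff (Morphisms.respectful iff (Morphisms.respectful iff iff))) and3.
Proof. by move=> P P' hP Q Q' hQ R R' hR; split=> -[/hP ? /hQ ? /hR ?]. Qed.

(** * Tableau rows as representations of the configurations of a run *)

Definition tcell (t : tape) (sd : bool) i : sym :=
  if sd then nth None (tcur t :: tright t) i else nth None (tleft t) i.

Definition ext t := size (tleft t) + size (tright t).

Lemma ext_move d a t : ext (move d (write a t)) <= (ext t).+1.
Proof.
by case: t => l c r; case: d; rewrite /ext /=; [case: l|case: r|] => //= *; lia.
Qed.

(** A tape that stores fewer than [N] cells beside the head is blank from [N] on, so a blank is the
    right value for a neighbour that is cut off. *)
Lemma tcell_move N t a d sd i : i < N -> ext t < N ->
  tcell (move d (write a t)) sd i = newcell N (tcell t) a d sd i.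
Proof.
case: t => l c r; rewrite /ext /= => li lN; case: d; case: sd => /=.
- by case: l lN => [|y l] lN; case: i li => [|[|i]] //=.
- case: l lN => [|y l] lN; rewrite /tcell /=; first by rewrite nth_nil if_same.
  case: ltnP => // le; rewrite nth_default // -ltnS (leq_trans _ le) //.
  by apply: leq_ltn_trans lN; rewrite /= addSn ltnW // ltnS leq_addr.
- case: r lN => [|y r] lN; rewrite /tcell /=.
    by case: i {li} => [|i] /=; rewrite ?nth_nil if_same.
  case: ltnP => // le; rewrite nth_default // -ltnS (leq_trans _ le) //.
  by apply: leq_ltn_trans lN; rewrite leq_addl.
- by case: r lN => [|y r] lN; case: i li => [|i].
- by case: i li.
- by [].
Qed.

Lemma newcell_ext N cl cl' a d sd i : i < N -> (forall sd j, j < N -> cl sd j = cl' sd j) ->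
  newcell N cl a d sd i = newcell N cl' a d sd i.
Proof.
move=> li H; case: d; case: sd => /=; last exact: H; last by case: i li => // i li; exact: H.
- by case: i li => [|[|i]] // li; apply: H => //; exact: ltnW.
- by case: ltnP => // lt; exact: H.
- by case: ltnP => // lt; exact: H.
- by case: i li => // i li; apply: H; exact: ltnW.
Qed.

Section Run.

Variables (M : OTM) (O : word -> bool).
Notation Q := (state M).

Definition ctape (c : cfg M) (tau : bool) := if tau then cquery c else cwork c.
Definition ccell c tau := tcell (ctape c tau).
Definition ctrip (c : cfg M) : Q * sym * sym := (cst c, tcur (cwork c), tcur (cquery c)).
Definition cext (c : cfg M) := ext (cwork c) + ext (cquery c).

(** Against an oracle that is a problem the machine is deterministic. Halting configurations are
    made fixed points, to match the repeated rows of the tableau. *)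
Definition stepf (c : cfg M) : cfg M :=
  match delta (cst c) (tcur (cwork c)) (tcur (cquery c)) with
  | Act q w1 w2 d1 d2 => Cfg q (move d1 (write w1 (cwork c))) (move d2 (write w2 (cquery c)))
  | Ask qy qn => Cfg (if O (tape_out (cquery c)) then qy else qn) (cwork c) blank_tape
  | Halt _ => c
  end.

Definition run t c := iter t stepf c.

Lemma cext_stepf (c : cfg M) : cext (stepf c) <= (cext c).+2.
Proof.
rewrite /stepf /cext; case: delta => [q w1 w2 d1 d2|qy qn|b] /=; last by lia.
  by have := ext_move d1 w1 (cwork c); have := ext_move d2 w2 (cquery c); lia.
by rewrite {2}/ext /=; lia.
Qed.

Lemma halted_stepf c b : halted c = Some b -> stepf c = c.
Proof. by rewrite /halted /stepf; case: delta. Qed.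

Lemma run_halted t c b : halted c = Some b -> run t c = c.
Proof. by move=> H; elim: t => //= t ->; exact: halted_stepf H. Qed.

Lemma cext_run t c : cext (run t c) <= cext c + 2 * t.
Proof. by elim: t => [|t IH] /=; [lia|have := cext_stepf (run t c); lia]. Qed.

Lemma all_halt_run (P : cfg M -> bool -> Prop) T c :
  all_halt (oracle_of (of_problem O)) P T c ->
  exists t b, [/\ t <= T, halted (run t c) = Some b & P (run t c) b].
Proof.
elim: T c => [|T IH] c /=; case E: (halted c) => [b|] //.
- by move=> H; exists 0, b.
- by move=> H; exists 0, b.
case=> _ H; have /H/IH[t [b [le H1 H2]]] : step (oracle_of (of_problem O)) c (stepf c).
  move: E; rewrite /halted /step /stepf; case: delta => // qy qn _.
  by exists (O (tape_out (cquery c))).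
by exists t.+1, b; rewrite /run iterSr.
Qed.

Section Represent.

Variables (X : word) (B : nat -> nat -> nat -> nat -> bool).
Notation N := (size X).

Definition represents t (c : cfg M) := statesat B t (cst c) /\
  forall tau sd b i, i < N -> B 0 (rc tau sd b) t i <-> ccell c tau sd i = Some b.

Lemma represents_cellv t c tau sd i : represents t c -> i < N ->
  cellv B tau sd t i = ccell c tau sd i.
Proof.
case=> _ H li; rewrite /cellv.
case E: (B 0 (rc tau sd true) t i); first by move/H: E => ->.
case E2: (B 0 (rc tau sd false) t i); first by move/H: E2 => ->.
case E3: ccell => [[]|] //; first by move/(H _ _ _ _ li): E3; rewrite E.
by move/(H _ _ _ _ li): E3; rewrite E2.
Qed.

Lemma represents_act t c p : represents t c -> 0 < N -> act B t p <-> p = ctrip c.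
Proof.
move=> R N0; rewrite /act !(represents_cellv _ _ R) //; case: (R) => -> _.
case: p => [[q a] b] /=; split=> [[/eqP-> <- <-] //|[-> -> ->]].
by rewrite eqxx.
Qed.

Lemma represents_tapeeq t c tau a d : represents t c -> ext (ctape c tau) < N ->
  tapeeq X B tau t a d <-> forall i sd b, i < N ->
    B 0 (rc tau sd b) t.+1 i <-> tcell (move d (write a (ctape c tau))) sd i = Some b.
Proof.
move=> R le; split=> H i sd b li.
  rewrite (@tcell_move N) // H //.
  by rewrite (@newcell_ext _ _ (tcell (ctape c tau))) // => sd' j lj; exact: represents_cellv.
rewrite H // (@tcell_move N) //.
by rewrite (@newcell_ext _ _ (tcell (ctape c tau))) // => sd' j lj; exact: represents_cellv.
Qed.

(** Only the state and scanned symbols of [c] satisfy [act] at time [t], so the step formula reduces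
    to a single row condition, and this condition determines the next row completely. *)
Lemma represents_step t c : represents t c -> cext c < N ->
  (is_ask (ctrip c) -> B 0 1 t t = O (tape_out (cquery c))) ->
  (forall p : Q * sym * sym, act B t p -> row X B t p) <-> represents t.+1 (stepf c).
Proof.
move=> R le ans; have N0 : 0 < N by lia.
have lw : ext (ctape c false) < N by rewrite /cext /= in le *; lia.
have lq : ext (ctape c true) < N by rewrite /cext /= in le *; lia.
have -> : (forall p : Q * sym * sym, act B t p -> row X B t p) <-> row X B t (ctrip c).
  split=> [H|H p Hp]; first by apply: H; exact: (represents_act (ctrip c) R N0).2 erefl.
  by move/(represents_act _ R N0): Hp => ->.
move: ans; rewrite /represents /stepf /ctrip /=.
case: delta => [q w1 w2 d1 d2|qy qn|b] /=.
- rewrite !(represents_tapeeq _ _ R) //; split=> [[H1 H2 H3]|[H1 H2]]; split=> //.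
  + by case=> sd b i li; [exact: H3|exact: H2].
  + by move=> i sd b li; exact: (H2 false).
  + by move=> i sd b li; exact: (H2 true).
- move=> -> //; rewrite !(represents_tapeeq _ _ R) //.
  split=> [[H1 H2 H3]|[H1 H2]]; split=> //.
  + case=> sd b i li; last by rewrite H2 //; case: (cwork c).
    rewrite /ccell /tcell; split=> [/(H3 _ _ _ li) //|].
    by case: sd => /=; [case: i {li} => [|i]|]; rewrite /= ?nth_nil.
  + by move=> i sd b li; rewrite (H2 false) //; case: (cwork c).
  + move=> i sd b li; rewrite (H2 true) // /ccell /tcell.
    by case: sd => /=; [case: i {li} => [|i]|]; rewrite /= ?nth_nil.
- move=> _; rewrite !(represents_tapeeq _ _ R) //.
  have E tau : move DN (write (tcur (ctape c tau)) (ctape c tau)) = ctape c tau.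
    by case: (ctape c tau).
  split=> [[H1 H2 H3]|[H1 H2]]; split=> //.
  + by case=> sd b' i li; [rewrite H3 // (E true)|rewrite H2 // (E false)].
  + by move=> i sd b' li; rewrite (E false); exact: (H2 false).
  + by move=> i sd b' li; rewrite (E true); exact: (H2 true).
Qed.

(** Reading only [N.-1] cells keeps the string shorter than [N], so that its end is a position as
    well, as the parsing gates require. *)
Definition strof t : word := takeSome [seq cellv B true true t i | i <- iota 0 N.-1].

Lemma takeSome_ext (l l' : seq sym) : (forall i, nth None l i = nth None l' i) -> takeSome l = takeSome l'.
Proof.
elim: l l' => [|a l IH] l' H.
  by case: l' H => //= a l' H; have /= <- := H 0.
case: l' H => [|a' l'] H /=; first by have /= -> := H 0.
by have /= -> := H 0; case: a' {H} (fun i => H i.+1) => // b H; rewrite (IH l').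
Qed.

Lemma represents_strof t c : represents t c -> (cext c).+1 < N -> strof t = tape_out (cquery c).
Proof.
move=> R le; apply: takeSome_ext => i.
case: (ltnP i N.-1) => li.
  rewrite (nth_map 0) ?size_iota // nth_iota // add0n (represents_cellv _ _ R) //.
  by apply: leq_trans li _; lia.
rewrite !nth_default // ?size_map ?size_iota //=.
have h : size (tright (cquery c)) <= cext c by rewrite /cext /ext addnA leq_addl.
by apply: leq_ltn_trans h _; lia.
Qed.

End Represent.
End Run.

Section Truth.

Variables (M : OTM) (O : word -> bool) (wit : word -> nat -> bool) (outb : bool).
Variables (x X : word) (m : nat).
Notation Q := (state M).
Notation N := (size X).
Notation crun t := (run O t (init M x)).

Hypothesis init_ok : forall i, i < N -> initcell X false true i = nth None (map Some x) i.
Hypothesis ext_ok : forall t, (cext (crun t)).+1 < N.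
Hypothesis halt_ok : exists2 t, t < N & halted (crun t) = Some outb.

Definition askc t := is_ask (ctrip (crun t)).
Definition queryc t := tape_out (cquery (crun t)).

(* The values of the relations of block 0 in the only accepted assignment. *)
Definition truth (r i j : nat) : bool :=
  if r == 0 then [&& i == 0, j == 0 & outb]
  else if r == 1 then [&& i == j, askc i & O (queryc i)]
  else if r == 2 then [&& askc i, O (queryc i) & wit (queryc i) j]
  else if r < 11 then
    ccell (crun i) (4 <= r - 3) (odd (r - 3)./2) j == Some (odd (r - 3))
  else (i == j) && (r == rs (cst (crun i))).

Lemma truth_rc tau sd b i j : truth (rc tau sd b) i j = (ccell (crun i) tau sd j == Some b).
Proof. by case: tau; case: sd; case: b. Qed.

Lemma truth_rs q i j : truth (rs q) i j = (i == j) && (q == cst (crun i)).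
Proof.
rewrite /truth /rs /=; congr andb.
by rewrite eqn_add2l (inj_eq val_inj) (inj_eq enum_rank_inj).
Qed.

Definition phi0 (B : nat -> nat -> nat -> nat -> bool) : Prop :=
  [/\ statesat B 0 (q0 M) /\
        (forall tau sd b i, i < N -> B 0 (rc tau sd b) 0 i <-> initcell X tau sd i = Some b),
      forall t (p : Q * sym * sym), t.+1 < N -> act B t p -> row X B t p,
      forall i j, i < N -> j < N ->
        [/\ B 0 0 i j -> i = 0 /\ j = 0, B 0 1 i j -> i = j,
            forall q : Q, B 0 (rs q) i j -> i = j & forall r, r \in iota (11 + #|Q|) m -> ~ B 0 r i j],
      forall t, t < N -> (~ askat M B t -> ~ B 0 1 t t) /\
        (~ B 0 1 t t -> forall v, v < N -> ~ B 0 2 t v)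
    & exists t (p : Q * sym * sym) c, [/\ t < N, is_halt c p, act B t p & B 0 0 0 0 = c]].

(** The part of correctness that takes the remaining quantifiers to express; [phi0] collects what is
    checked on block 0 directly. *)
Definition answers_ok (B : nat -> nat -> nat -> nat -> bool) : Prop :=
  forall t, t < N -> askat M B t ->
    B 0 1 t t = O (strof X B t) /\
    (B 0 1 t t -> forall v, v < N -> B 0 2 t v = wit (strof X B t) v).

Lemma N_gt0 : 0 < N. Proof. by have := ext_ok 0; lia. Qed.

Lemma is_haltP c b : halted c = Some b <-> is_halt b (ctrip c : Q * sym * sym).
Proof.
rewrite /halted /ctrip /=; case: delta => // c'; split=> [[->]|/eqP->] //; exact: eqxx.
Qed.

Lemma halted_inj t1 t2 b1 b2 : halted (crun t1) = Some b1 -> halted (crun t2) = Some b2 -> b1 = b2.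
Proof.
wlog le : t1 t2 b1 b2 / t1 <= t2.
  move=> H h1 h2; case: (leqP t1 t2) => [le|/ltnW le]; first exact: (H t1 t2).
  by apply/esym; exact: (H t2 t1).
move=> h1; have -> : crun t2 = crun t1 by rewrite -(subnK le) /run iterD; exact: run_halted h1.
by rewrite h1 => -[].
Qed.

Lemma represents_init B : represents X B 0 (init M x) <->
  statesat B 0 (q0 M) /\
  (forall tau sd b i, i < N -> B 0 (rc tau sd b) 0 i <-> initcell X tau sd i = Some b).
Proof.
have E tau sd i : i < N -> ccell (init M x) tau sd i = initcell X tau sd i.
  move=> li; case: tau; case: sd; rewrite ?[initcell X true _ _]/= ?[initcell X false false _]/=.
  - by rewrite /ccell /tcell /=; case: i {li} => [|i] //=; rewrite nth_nil.
  - by rewrite /ccell /tcell /= nth_nil.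
  - rewrite init_ok // /ccell /tcell /=; case: (x) => [|b y] //=; case: i {li} => [|i] //=.
    by rewrite nth_nil.
  - by rewrite /ccell /tcell /=; case: (x) => [|b y]; rewrite nth_nil.
split=> -[H1 H2]; split=> // tau sd b i li; first by rewrite -E //; exact: H2.
by rewrite E //; exact: H2.
Qed.

Lemma askat_askc B t : represents X B t (crun t) -> askat M B t <-> askc t.
Proof.
move=> R; split=> [[p ap /(represents_act _ R N_gt0) E]|ap]; first by rewrite E in ap.
by exists (ctrip (crun t)) => //; apply/(represents_act _ R N_gt0).
Qed.

(** Induction on time: if row [t] represents the run, the string written there is the actual query,
    so the answer is the true one and the next row follows. The remaining relations are then forced
    entry by entry. *)
Lemma phi0_truth B : phi0 B -> answers_ok B ->
  forall r i j, r < 11 + #|Q| + m -> i < N -> j < N -> B 0 r i j = truth r i j.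
Proof.
case=> H1 H2 H3 H4 [th [p [c [lth hp ap Bc]]]] ans.
have R t : t < N -> represents X B t (crun t).
  elim: t => [_|t IH lt]; first exact/represents_init.
  have {}IH := IH (ltnW lt).
  apply/(represents_step IH (ltnW (ext_ok t))); last by move=> p'; exact: H2.
  move=> /(askat_askc IH) a; have [-> _] := ans t (ltnW lt) a.
  by rewrite (represents_strof IH) // ext_ok.
have S t : t < N -> strof X B t = queryc t.
  by move=> lt; apply: represents_strof (R t lt) _; exact: ext_ok.
have A1 i : i < N -> B 0 1 i i = askc i && O (queryc i).
  move=> li; have [n1 _] := H4 i li.
  case a: (askc i) => /=.
    by have [-> _] := ans i li ((askat_askc (R i li)).2 a); rewrite S.
  by apply/negP; apply: n1 => /(askat_askc (R i li)); rewrite a.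
move=> r i j lr li lj; have [P0 P1 P2 P3] := H3 i j li lj.
rewrite /truth; case: (r =P 0) => [->|r0].
  (* The halting time claimed by the tableau may differ from the given one, but halting
     configurations repeat, so the output bits agree. *)
  have Bo : B 0 0 0 0 = outb.
    have [t lt ht] := halt_ok; move/(represents_act _ (R th lth) N_gt0): ap hp => ->.
    by rewrite Bc => /is_haltP /(halted_inj ht) ->.
  apply/idP/idP => [E|/and3P[/eqP-> /eqP-> o]]; last by rewrite Bo.
  by have [i0 j0] := P0 E; rewrite i0 j0 Bo in E; rewrite i0 j0 E.
case: (r =P 1) => [->|r1].
  case: (i =P j) => [<-|ne] /=; first exact: A1.
  by apply/negP => /P1.
case: (r =P 2) => [->|r2].
  have := A1 i li; case E: (B 0 1 i i) => E2.
    have /(askat_askc (R i li)).2 a : askc i by case/esym/andP: E2.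
    have [_ /(_ E) W] := ans i li a.
    by rewrite andbA -E2 /= W // S.
  have [_ W] := H4 i li; rewrite andbA -E2 /=; apply/negP; apply: W => //; exact/negP/negbT.
case: ltnP => lr11.
  (* [rc] enumerates 3 to 10 in binary; that [truth] reads its three bits back correctly is
     confirmed by evaluation. *)
  have /allP H8 : all (fun r => r == rc (4 <= r - 3) (odd (r - 3)./2) (odd (r - 3))) (iota 3 8) by [].
  have /H8/eqP Er : r \in iota 3 8 by rewrite mem_iota; lia.
  rewrite {1}Er; apply/idP/eqP.
    by case: (R i li) => _ H /(H _ _ _ _ lj).
  by case: (R i li) => _ H /(H _ _ _ _ lj).
case: (ltnP r (11 + #|Q|)) => lrQ.
  have lq : r - 11 < #|Q| by lia.
  have [q Er] : exists q : Q, r = rs q.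
    by exists (enum_val (Ordinal lq)); rewrite /rs enum_valK /=; lia.
  case: (i =P j) => [<-|ne] /=.
    rewrite {1}Er; case: (R i li) => -> _.
    by rewrite Er /rs eqn_add2l (inj_eq val_inj) (inj_eq enum_rank_inj).
  by rewrite Er; apply/negP => /P2.
have : ~ B 0 r i j by apply: P3; rewrite mem_iota lrQ lr.
move/negP/negbTE ->; apply/esym/negP => /andP[_ /eqP Er].
by move: lrQ; rewrite Er /rs leq_add2l leqNgt ltn_ord.
Qed.

Lemma truth_phi0 B :
  (forall r i j, r < 11 + #|Q| + m -> i < N -> j < N -> B 0 r i j = truth r i j) ->
  phi0 B /\ answers_ok B.
Proof.
move=> H.
have lrc tau sd b : rc tau sd b < 11 + #|Q| + m.
  have : rc tau sd b < 11 by case: tau; case: sd; case: b.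
  by move=> lt; rewrite -addnA ltn_addr.
have lrs (q : Q) : rs q < 11 + #|Q| + m by rewrite /rs -addnA ltn_add2l; apply: ltn_addr; exact: ltn_ord.
have R t : t < N -> represents X B t (crun t).
  move=> lt; split=> [q|tau sd b i li]; first by rewrite H // truth_rs eqxx.
  by rewrite H // truth_rc; split=> /eqP.
have S t : t < N -> strof X B t = queryc t.
  by move=> lt; apply: represents_strof (R t lt) _; exact: ext_ok.
have A1 i : i < N -> B 0 1 i i = askc i && O (queryc i).
  by move=> li; rewrite H ?/truth /= ?eqxx //; lia.
have A2 i j : i < N -> j < N -> B 0 2 i j = [&& askc i, O (queryc i) & wit (queryc i) j].
  by move=> li lj; rewrite H //; lia.
split; last first.
  move=> t lt /(askat_askc (R t lt)) a; rewrite A1 // S // a; split=> // Ot v lv.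
  by rewrite A2 // a (Ot : O _).
split.
- exact/represents_init/R/N_gt0.
- move=> t p lt; move: p; apply/(represents_step (R t (ltnW lt)) (ltnW (ext_ok t))); last exact: R.
  by move=> a; rewrite A1 ?(ltnW lt) // /askc a.
- move=> i j li lj; split.
  + by rewrite H // => /and3P[/eqP-> /eqP->].
  + by rewrite H // => /and3P[/eqP->].
  + by move=> q; rewrite H // truth_rs => /andP[/eqP].
  + move=> r; rewrite mem_iota => /andP[l1 l2]; rewrite H // /truth.
    have [-> -> -> ->] : [/\ (r == 0) = false, (r == 1) = false, (r == 2) = false & (r < 11) = false].
      by split; lia.
    by case/andP=> _ /eqP Er; move: l1; rewrite Er /rs leq_add2l leqNgt ltn_ord.
- move=> t lt; rewrite A1 //; split.
    by move=> na; apply/negP; rewrite negb_and; apply/orP; left; apply/negP => /(askat_askc (R t lt)).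
  by move/negP => na v lv; rewrite A2 // andbA (negbTE na).
- have [t lt ht] := halt_ok; exists t, (ctrip (crun t)), outb; split=> //.
  + exact/is_haltP.
  + exact/(represents_act _ (R t lt) N_gt0).
  + by rewrite H ?N_gt0.
Qed.

End Truth.

(** * Parsing and evaluating the selected query *)

Section Strings.

Variable (s : word).

(* The query is parsed by predicates with recursive equations: a unary code from
   [p] to [q] ([UnS]), a sequence of [j] block sizes with sum [o], which ends at
   position [o + 2 * j] ([BOS]), a variable read at [p] after [v] ones already
   counted, with value [b] ([VS]), and a formula from [p] to [q] with value [b]
   ([ES]). *)
Definition bit_at b i := i < size s /\ nth false s i = b.

Lemma bit_atP b i : bit_at b i <-> drop i s = b :: drop i.+1 s.
Proof.
split=> [[li <-]|H]; first exact: drop_nth.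
have li : i < size s.
  by rewrite ltnNge; apply/negP => le; rewrite drop_oversize in H.
by split=> //; move: H; rewrite (drop_nth false li) => -[].
Qed.

Lemma drop_add p u t : drop p s = u ++ t -> drop (p + size u) s = t.
Proof. by move=> E; rewrite addnC -drop_drop E drop_size_cat. Qed.

Lemma drop_inj p q : drop p s = drop q s -> p <= size s -> q <= size s -> p = q.
Proof. by move/(congr1 size); rewrite !size_drop => E lp lq; lia. Qed.

Definition UnS p q := exists u, drop p s = enc_unary u ++ drop q s /\ q <= size s.

Lemma drop_le p c t : drop p s = c :: t -> p < size s.
Proof. by move=> E; rewrite ltnNge; apply/negP => le; rewrite drop_oversize in E. Qed.

(** The right side mentions [UnS] only at a larger position. Equations of this kind have one
    solution over bounded positions, and this is what makes the gate values unique. *)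
Lemma UnS_eq p q : UnS p q <-> (bit_at false p /\ q = p.+1) \/ (bit_at true p /\ UnS p.+1 q).
Proof.
split=> [[[|u] [E lq]]|[[/bit_atP E ->]|[/bit_atP E [u [E2 lq]]]]].
- left; have lp := drop_le E; have E2 := drop_nth false lp.
  rewrite E2 in E; case: E => b0 /drop_inj ->//; split=> //; by split.
- right; have lp := drop_le E; have E2 := drop_nth false lp.
  rewrite E2 in E; case: E => b0 E; split; first by split.
  by exists u.
- by exists 0; split=> //; exact: drop_le E.
- by exists u.+1; rewrite E E2.
Qed.

Lemma UnS_lt p q : UnS p q -> p < q <= size s.
Proof.
case=> u [E lq]; rewrite lq andbT.
have lp : p < size s by case: u E => [|u] /drop_le.
by move/(congr1 size): E; rewrite size_cat /enc_unary size_cat !size_drop /= => E; lia.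
Qed.

(** The sum is recorded instead of the end position because it is also the number of the first
    variable after these blocks. A size [m] takes [m + 2] bits, which gives the end. *)
Definition BOS j o := exists ms, [/\ size ms = j, all (fun m => 0 < m) ms, sumn ms = o,
  s = enc_blocks ms ++ drop (o + 2 * j) s & o + 2 * j <= size s].

Lemma size_enc_unary u : size (enc_unary u) = u.+1.
Proof. by rewrite size_cat size_nseq addn1. Qed.

Lemma size_enc_blocks_eq ms : size (enc_blocks ms) = sumn ms + 2 * size ms.
Proof. by elim: ms => //= m ms IH; rewrite size_cat size_enc_unary -/(enc_blocks ms) IH; lia. Qed.

Lemma BOS0 o : BOS 0 o <-> o = 0.
Proof.
split=> [[ms [/size0nil -> _ <- _ _]] //|->].
by exists [::]; split; rewrite //= drop0.
Qed.

Lemma enc_blocks_rcons ms m : enc_blocks (rcons ms m) = enc_blocks ms ++ true :: enc_unary m.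
Proof. by rewrite /enc_blocks map_rcons flatten_rcons. Qed.

(** The second [true] is the first bit of the unary code; it says that the block size is positive,
    as [decode] demands. *)
Lemma BOS_S j o' : BOS j.+1 o' <-> exists o, [/\ BOS j o, bit_at true (o + 2 * j),
  bit_at true (o + 2 * j).+1 & UnS (o + 2 * j).+1 (o' + 2 * j).+2].
Proof.
split.
  case=> ms; case/lastP: ms => [[]//|ms m] [sz]; rewrite all_rcons => /andP[m0 am] so E le.
  move: sz so; rewrite size_rcons => -[sz]; rewrite sumn_rcons => so.
  exists (sumn ms).
  have se := size_enc_blocks_eq ms; rewrite sz in se.
  have D : drop (sumn ms + 2 * j) s = true :: enc_unary m ++ drop (o' + 2 * j.+1) s.
    by rewrite {1}E enc_blocks_rcons -catA drop_size_cat.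
  have lt := drop_le D.
  have b1 : bit_at true (sumn ms + 2 * j).
    by split=> //; move: D; rewrite (drop_nth false lt) => -[].
  have D1 : drop (sumn ms + 2 * j).+1 s = enc_unary m ++ drop (o' + 2 * j.+1) s.
    by move: D; rewrite (drop_nth false lt) => -[].
  have Eo : (o' + 2 * j).+2 = o' + 2 * j.+1 by lia.
  split=> //.
  - exists ms; split=> //; last exact: ltnW.
    by rewrite {1}E enc_blocks_rcons D -catA.
  - case: m m0 D1 {so E D} => // m _ D1; have lt1 := drop_le D1.
    by split=> //; move: D1; rewrite (drop_nth false lt1) => -[].
  - by exists m; rewrite Eo.
case=> o [[ms [sz am so E le]] /bit_atP b0 b1 [u [U lU]]].
have u0 : 0 < u by case: u U => // U; move/bit_atP: b1; rewrite U.
have Eu : o' = o + u.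
  have lt := proj1 b1.
  move/(congr1 size): U; rewrite size_cat size_enc_unary !size_drop => U; lia.
exists (rcons ms u); rewrite size_rcons sz all_rcons u0 am sumn_rcons so Eu; split=> //.
  rewrite {1}E enc_blocks_rcons b0 U -catA Eu; congr (_ ++ _ :: _ ++ drop _ _); lia.
by move: lU; rewrite Eu; lia.
Qed.

Lemma BOS_le j o : BOS j o -> o + 2 * j <= size s.
Proof. by case=> ms []. Qed.

Lemma BOS_inj j o1 o2 : BOS j o1 -> BOS j o2 -> o1 = o2.
Proof.
elim: j o1 o2 => [|j IH] o1 o2; first by rewrite !BOS0 => -> ->.
rewrite !BOS_S => -[a1 [H1 _ _ [u1 [U1 l1]]]] [a2 [H2 _ _ [u2 [U2 l2]]]].
rewrite -(IH _ _ H1 H2) U1 in U2.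
by have [_ /drop_inj] := enc_unary_inj U2; lia.
Qed.

Section Values.

Variables (bound : nat) (VA : bool -> nat -> Prop).

Definition VS b p v := exists u r, [/\ drop p s = enc_unary u ++ r, v + u < bound & VA b (v + u)].

Lemma VS_eq b p v : VS b p v <->
  (bit_at false p /\ v < bound /\ VA b v) \/ (bit_at true p /\ VS b p.+1 v.+1).
Proof.
split=> [[[|u] [r [E lv H]]]|[[/bit_atP E [lv H]]|[/bit_atP E [u [r [E2 lv H]]]]]].
- left; have lp := drop_le E; rewrite addn0 in lv H; split=> //; split=> //.
  by move: E; rewrite (drop_nth false lp) => -[].
- right; have lp := drop_le E; have E2 := drop_nth false lp; rewrite E2 in E.
  case: E => b0 E; split; first by split.
  by exists u, r; rewrite addSnnS.
- by exists 0, (drop p.+1 s); rewrite addn0.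
- by exists u.+1, r; rewrite E E2 -addSnnS.
Qed.

Lemma VS_lt b p v : VS b p v -> p < size s /\ v < bound.
Proof. by case=> u [r [E lv _]]; split; [case: u E {lv} => [|u] /drop_le|lia]. Qed.

(** Both truth values are derived positively. A variable outside the assignment has no derivable
    value, so deriving a value includes the test of [maxvar1] in [decode]. *)
Fixpoint Ev (b : bool) (f : form) : Prop :=
  match f with
  | FConst c => c = b
  | FVar v => v < bound /\ VA b v
  | FNot g => Ev (~~ b) g
  | FAnd g h => exists b1 b2, [/\ Ev b1 g, Ev b2 h & b1 && b2 = b]
  | FOr g h => exists b1 b2, [/\ Ev b1 g, Ev b2 h & b1 || b2 = b]
  end.

Definition ES b p q := exists f, [/\ drop p s = encf f ++ drop q s, q <= size s & Ev b f].

Lemma ES_lt b p q : ES b p q -> p < q <= size s.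
Proof.
case=> f [E lq _]; rewrite lq andbT.
have h : 0 < size (encf f) by case: (f).
have lp : p < size s by move: E; case: (encf f) h => // c t _ /drop_le.
move/(congr1 size): E; rewrite size_cat !size_drop => E; lia.
Qed.

Lemma bit_at2 b c p t : drop p s = b :: c :: t -> [/\ bit_at b p, bit_at c p.+1 & drop p.+2 s = t].
Proof.
move=> E; have l := drop_le E; rewrite (drop_nth false l) in E; case: E => E1 E.
have l' := drop_le E; rewrite (drop_nth false l') in E; case: E => E2 E.
by split.
Qed.

Lemma ES_eq b p q : ES b p q <->
  [\/ [/\ bit_at false p, bit_at false p.+1, bit_at b p.+2 & q = p.+3],
      [/\ bit_at false p, bit_at true p.+1, UnS p.+2 q & VS b p.+2 0],
      [/\ bit_at true p, bit_at false p.+1 & ES (~~ b) p.+2 q]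
    | [/\ bit_at true p, bit_at true p.+1 & exists c r b1 b2,
        [/\ bit_at c p.+2, ES b1 p.+3 r, ES b2 r q & (if c then b1 || b2 else b1 && b2) = b]]].
Proof.
split.
  case=> -[c|v|g|g h|g h] [E lq].
  - move=> /= cb; have [H1 H2 E2] := bit_at2 E; constructor 1.
    have l := drop_le E2; rewrite (drop_nth false l) in E2; case: E2 => E3 /drop_inj E4.
    by split=> //; [split=> //; rewrite E3|rewrite E4].
  - case=> lv H; have [H1 H2 E2] := bit_at2 E; constructor 2; split=> //; first by exists v.
    by exists v, (drop q s).
  - move=> H; have [H1 H2 E2] := bit_at2 E; constructor 3; split=> //; by exists g.
  - case=> b1 [b2 [Hg Hh bb]]; have [H1 H2 E2] := bit_at2 E; constructor 4; split=> //.
    have l := drop_le E2; rewrite (drop_nth false l) in E2; case: E2 => E3 E4'.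
    have E4 : drop p.+3 s = (encf g ++ encf h) ++ drop q s := E4'; rewrite -catA in E4.
    have E5 := drop_add E4.
    exists false, (p.+3 + size (encf g)), b1, b2; split=> //.
      by exists g; rewrite E4 E5; split=> //; rewrite leqNgt; apply/negP => /ltnW/drop_oversize; rewrite E5; case: (h).
    by exists h; rewrite E5.
  - case=> b1 [b2 [Hg Hh bb]]; have [H1 H2 E2] := bit_at2 E; constructor 4; split=> //.
    have l := drop_le E2; rewrite (drop_nth false l) in E2; case: E2 => E3 E4'.
    have E4 : drop p.+3 s = (encf g ++ encf h) ++ drop q s := E4'; rewrite -catA in E4.
    have E5 := drop_add E4.
    exists true, (p.+3 + size (encf g)), b1, b2; split=> //.
      by exists g; rewrite E4 E5; split=> //; rewrite leqNgt; apply/negP => /ltnW/drop_oversize; rewrite E5; case: (h).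
    by exists h; rewrite E5.
case=> -[/bit_atP E1 /bit_atP E2].
- move=> B3 ->; have l := proj1 B3; move/bit_atP: B3 => E3.
  by exists (FConst b); rewrite E1 E2 E3.
- case=> v [E3 lq] [u [r [E4 lu H]]]; rewrite E3 in E4; have [uv _] := enc_unary_inj E4.
  by exists (FVar v); rewrite E1 E2 E3 uv; split=> //=; rewrite -[u]add0n.
- by case=> g [E3 lq H]; exists (FNot g); rewrite E1 E2 E3.
- case=> c [r [b1 [b2 [/bit_atP E3 [g [E4 lr Hg]] [h [E5 lq Hh]] bb]]]].
  case: c E3 bb => E3 bb.
    by exists (FOr g h); rewrite E1 E2 E3 E4 E5 /= -catA; split=> //; exists b1, b2.
  by exists (FAnd g h); rewrite E1 E2 E3 E4 E5 /= -catA; split=> //; exists b1, b2.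
Qed.

End Values.
End Strings.

Lemma takeSome_bit_at (l : seq sym) b i :
  bit_at (takeSome l) b i <-> nth None l i = Some b /\ forall u, u < i -> nth None l u <> None.
Proof.
rewrite /bit_at; elim: l i => [|[c|] l IH] [|i] /=; rewrite ?nth_nil; split; try by case.
- by case=> _ ->.
- by case=> -[->].
- case=> li H; have [H1 H2] := (IH i).1 (conj li H); split=> // -[|u] // lu; exact: H2.
- case=> H1 H2; apply/IH; split=> // u lu; exact: (H2 u.+1).
- by case=> _ /(_ 0 isT).
Qed.

Lemma size_takeSome (l : seq sym) : size (takeSome l) <= size l.
Proof. by elim: l => //= -[c|] l IH. Qed.

Definition EXs c i j F := EX j (OA (Shift c i j) F).

Lemma fs_exs X B e c i j F : e 2 = size X -> i != j ->
  fsem X B e (EXs c i j F) <-> e i + c < size X /\ fsem X B (fupd e j (e i + c)) F.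
Proof.
move=> e2 ij; rewrite -[fsem X B e _]/(exists a, a < e 2 /\
  (fsem X B (fupd e j a) (Shift c i j) /\ fsem X B (fupd e j a) F)).
split=> [[a [la []]]|[lt H]].
  by rewrite fs_shift !fupdE eqxx (negPf ij) => -[-> lt].
exists (e i + c); rewrite e2; split=> //; split=> //.
by rewrite fs_shift !fupdE eqxx (negPf ij).
Qed.

Global Opaque EXs.

(* Block [l] is the last one, so that queries have [l] blocks; its relations 3 to
   11 and [12 + j] are the gates which describe the selected query. *)
Section Gates.

Variable l : nat.

Definition Sg (b : bool) i := OR l (3 + b) i i.
Definition Ag (b : bool) i := OR l (5 + b) i i.
Definition Vg (b : bool) i j := OR l (7 + b) i j.
Definition Eg (b : bool) i j := OR l (9 + b) i j.
Definition Ug i j := OR l 11 i j.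
Definition Bg k i := OR l (12 + k) i i.

(* The word for block 1 also selects a time and a mode.  Without [Mode], the
   witness for the query made at this time is checked, and block [k] of the query
   is read from block [k]; with [Mode], block 1 is a candidate for a better
   witness, and block [k] of the query is read from block [k.+1]. *)
Definition Sel := OA (OR 1 1 4 4) (OF 8 4 (ON (OR 1 1 8 8))).
Definition Mode := EX 8 (OR 1 2 8 8).

(** [EXs 1 6 7] is the cut at [N.-1] from [strof], and the last conjunct ends the string at the
    first blank, as [takeSome] does. *)
Definition GStr := ALL 6 (BALL bools (fun b => IFF (Sg b 6)
  (OA (EXs 1 6 7 (OC true)) (EX 4 (OA Sel (OA (Cell true true 4 6 (Some b))
    (OF 7 6 (ON (Cell true true 4 7 None))))))))).

Definition GUn := ALL 6 (ALL 7 (IFF (Ug 6 7)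
  (OO (OA (Sg false 6) (Shift 1 6 7)) (OA (Sg true 6) (EXs 1 6 8 (Ug 8 7)))))).

Definition GB := BALL (iota 0 l.+1) (fun k => ALL 6 (IFF (Bg k 6)
  (if k is j.+1 then
     EX 7 (OA (Bg j 7) (EXs (2 * j) 7 8 (OA (Sg true 8) (EXs 1 8 9 (OA (Sg true 9)
       (EXs (2 * j).+2 6 10 (Ug 9 10)))))))
   else Zero 6))).

Definition In k := EX 7 (EX 8 (OA (Bg k 7) (OA (Bg k.+1 8) (OA (ON (Lt 6 7)) (Lt 6 8))))).

Definition Src k := OO (OA Mode (OR k.+1 0 6 6))
  (OA (ON Mode) (if k is 0 then EX 4 (OA Sel (OR 0 2 4 6)) else OR k 0 6 6)).

Definition GA := ALL 6 (BALL bools (fun b => IFF (Ag b 6)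
  (BEX (iota 0 l) (fun k => OA (In k) (LIT b (Src k)))))).

Definition GV := BALL bools (fun b => ALL 6 (ALL 7 (IFF (Vg b 6 7)
  (OO (OA (Sg false 6) (Ag b 7)) (OA (Sg true 6) (EXs 1 6 8 (EXs 1 7 9 (Vg b 8 9)))))))).

Definition combos b := [seq p : bool * bool * bool <- enum {: bool * bool * bool} |
  (if p.1.1 then p.1.2 || p.2 else p.1.2 && p.2) == b].

(** These are the four cases of [ES_eq]. Variable 3 is the position 0 and serves as the initial
    count of [Vg]. *)
Definition ERhs b := EXs 1 6 8 (EXs 1 8 9
  (OO (OA (Sg false 6) (OA (Sg false 8) (OA (Sg b 9) (Shift 1 9 7))))
  (OO (OA (Sg false 6) (OA (Sg true 8) (OA (Ug 9 7) (Vg b 9 3))))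
  (OO (OA (Sg true 6) (OA (Sg false 8) (Eg (~~ b) 9 7)))
      (OA (Sg true 6) (OA (Sg true 8) (EXs 1 9 10 (EX 11 (BEX (combos b) (fun p =>
         OA (Sg p.1.1 9) (OA (Eg p.1.2 10 11) (Eg p.2 11 7)))))))))))).

Definition GE := BALL bools (fun b => ALL 6 (ALL 7 (IFF (Eg b 6 7) (ERhs b)))).

Section Semantics.

Variables (X : word) (B : nat -> nat -> nat -> nat -> bool).
Notation N := (size X).
Notation fs := (fsem X B).

Definition gS (b : bool) i := i < N /\ B l (3 + b) i i.
Definition gA (b : bool) i := i < N /\ B l (5 + b) i i.
Definition gV (b : bool) i j := [/\ i < N, j < N & B l (7 + b) i j].
Definition gE (b : bool) i j := [/\ i < N, j < N & B l (9 + b) i j].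
Definition gU i j := [/\ i < N, j < N & B l 11 i j].
Definition gB k i := i < N /\ B l (12 + k) i i.

Definition selected t := [/\ t < N, B 1 1 t t & forall u, u < t -> ~ B 1 1 u u].
Definition modeB := exists2 i, i < N & B 1 2 i i.

Lemma selected_inj t u : selected t -> selected u -> t = u.
Proof.
case=> _ t1 t2 [_ u1 u2]; case: (ltngtP t u) => // lt; first by case: (u2 _ lt).
by case: (t2 _ lt).
Qed.

(** The gates need consistent values even if block 1 selects no time; they then describe the empty
    string. *)
Definition selstr s := (exists2 t, selected t & s = strof X B t) \/
  ((forall t, ~ selected t) /\ s = [::]).

Lemma fs_sel e : e 4 < N -> fs e Sel <-> selected (e 4).
Proof. by move=> lt; split=> [[H1 H2]|[_ H1 H2]]; split. Qed.

Lemma fs_mode e : e 2 = N -> fs e Mode <-> modeB.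
Proof. by move=> e2 /=; rewrite e2; split=> [[i []]|[i]]; exists i. Qed.

Variables (e : nat -> nat) (s : word).
Hypotheses (e2 : e 2 = N) (e3 : e 3 = 0) (N0 : 0 < N).
Hypothesis Hs : selstr s.

Lemma size_sel : size s < N.
Proof.
case: Hs => [[t _ ->]|[_ ->]] //.
by apply: leq_ltn_trans (size_takeSome _) _; rewrite size_map size_iota; lia.
Qed.

Definition ConsS := forall b i, gS b i <-> bit_at s b i.

Lemma sel_bit b i : i < N -> bit_at s b i <-> i + 1 < N /\ exists2 t, selected t &
  cellv B true true t i = Some b /\ forall u, u < i -> cellv B true true t u <> None.
Proof.
move=> li; case: Hs => [[t st ->]|[H ->]]; last first.
  by split=> [[]//|[_ [t /H]]].
have E u : nth None [seq cellv B true true t i | i <- iota 0 N.-1] u =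
    if u < N.-1 then cellv B true true t u else None.
  case: ltnP => lu; first by rewrite (nth_map 0) ?size_iota // nth_iota.
  by rewrite nth_default // size_map size_iota.
rewrite takeSome_bit_at E; split=> [[]|[l1 [t' /(selected_inj st) <- [H1 H2]]]].
  case: ltnP => // lt H1 H2; split; first by lia.
  exists t => //; split=> // u lu; have := H2 u lu; rewrite E ifT //; exact: ltn_trans lu lt.
rewrite ifT; last by lia.
by split=> // u lu; rewrite E ifT; [exact: H2|lia].
Qed.

Lemma fs_gstr : fs e GStr <-> ConsS.
Proof.
have E i b : i < N -> fs (fupd e 6 i) (IFF (Sg b 6)
    (OA (EXs 1 6 7 (OC true)) (EX 4 (OA Sel (OA (Cell true true 4 6 (Some b))
    (OF 7 6 (ON (Cell true true 4 7 None)))))))) <-> (B l (3 + b) i i <-> bit_at s b i).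
  move=> li; rewrite fs_iff sel_bit //=; rewrite fs_exs //= e2.
  have T : is_true true by [].
  suff -> : (exists a, a < N /\ (B 1 1 a a /\ (forall a0, a0 < a -> ~ B 1 1 a0 a0)) /\
     fs (fupd (fupd e 6 i) 4 a) (Cell true true 4 6 (Some b)) /\
     (forall a0, a0 < i -> ~ fs (fupd (fupd (fupd e 6 i) 4 a) 7 a0) (Cell true true 4 7 None))) <->
    exists2 t, selected t & cellv B true true t i = Some b /\
       forall u, u < i -> cellv B true true t u <> None by tauto.
  split=> [[t [lt [[H1 H2] []]]]|[t [lt H1 H2] [H3 H4]]].
    rewrite fs_cell /= => H3 H4; exists t; first by split.
    by split=> // u lu Hu; apply: (H4 u lu); rewrite fs_cell.
  exists t; rewrite fs_cell /=; split=> //; split=> //; split=> // u lu; rewrite fs_cell /=.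
  exact: H4.
rewrite /= e2; split=> [H b i|H i li].
  case: (ltnP i N) => li; last first.
    by split=> [[]|[lt _]]; [|have := size_sel]; rewrite ?ltnNge ?li //; lia.
  have := H i li; rewrite fs_ball => /(_ b (in_bools _)); rewrite E // /gS => <-.
  by split=> [[]|].
by apply/fs_ball => b _; rewrite E // -(H b i) /gS; split=> [|[]].
Qed.

Hypothesis HS : ConsS.

Definition ConsU := forall p q, gU p q <-> UnS s p q.

Lemma UnS_N p q : UnS s p q -> p < N /\ q < N.
Proof. by move/UnS_lt => H; have := size_sel; lia. Qed.

Lemma fs_gun : fs e GUn <-> ConsU.
Proof.
have E p q : p < N -> q < N -> fs (fupd (fupd e 6 p) 7 q) (IFF (Ug 6 7)
    (OO (OA (Sg false 6) (Shift 1 6 7)) (OA (Sg true 6) (EXs 1 6 8 (Ug 8 7))))) <->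
    (B l 11 p q <-> (bit_at s false p /\ q = p.+1) \/ (bit_at s true p /\ gU p.+1 q)).
  move=> lp lq; rewrite fs_iff /= fs_shift fs_exs //= addn1 -!HS /gS /gU.
  match goal with |- (_ <-> ?R) <-> (_ <-> ?R') => suff -> : R <-> R' by [] end.
  split.
    by case=> [[b1 [-> _]]|[b1 [l1 b2]]]; [left|right].
  case=> [[[_ b1] E]|[[_ b1] [l1 _ b2]]]; last by right.
  by left; split=> //; rewrite -E.
rewrite /= e2; split=> [H|H p lp q lq]; last first.
  apply/E => //; have -> : (B l 11 p q : Prop) <-> gU p q by split=> [|[]].
  rewrite (H p q) UnS_eq; split=> -[[H1 H2]|[H1 H2]]; [left|right|left|right]; split=> //; exact/H.
(* Induction from the right end of the word: the equation at [p] refers to the gates at [p.+1]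
   only. *)
move=> p; have [m] := ubnP (N - p); elim: m p => // m IH p lm q.
case: (ltnP p N) => lp; last by split=> [[]|/UnS_N[]]; rewrite ltnNge lp.
case: (ltnP q N) => lq; last by split=> [[]|/UnS_N[]]; rewrite ?(ltnNge q) ?lq.
have -> : gU p q <-> (B l 11 p q : Prop) by split=> [[]|].
have [H1 H2] := (E p q lp lq).1 (H p lp q lq).
have IHp : gU p.+1 q <-> UnS s p.+1 q by apply: IH; lia.
rewrite UnS_eq -IHp; exact: (conj H1 H2).
Qed.

Definition ConsB := forall k o, k <= l -> gB k o <-> BOS s k o.

Hypothesis HU : ConsU.

Lemma BOS_N k o : BOS s k o -> o < N.
Proof. by move/BOS_le => H; have := size_sel; lia. Qed.

Lemma fs_gb : fs e GB <-> ConsB.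
Proof.
have E0 o : o < N -> fs (fupd e 6 o) (IFF (Bg 0 6) (Zero 6)) <-> (B l 12 o o <-> o = 0).
  by move=> lo; rewrite fs_iff fs_zero.
have ES j o' : o' < N -> fs (fupd e 6 o') (IFF (Bg j.+1 6)
     (EX 7 (OA (Bg j 7) (EXs (2 * j) 7 8 (OA (Sg true 8) (EXs 1 8 9 (OA (Sg true 9)
       (EXs (2 * j).+2 6 10 (Ug 9 10))))))))) <->
   (B l (12 + j.+1) o' o' <-> exists o, [/\ gB j o, bit_at s true (o + 2 * j),
      bit_at s true (o + 2 * j).+1 & UnS s (o + 2 * j).+1 (o' + 2 * j).+2]).
  move=> lo; rewrite fs_iff.
  suff -> : fs (fupd e 6 o') (EX 7 (OA (Bg j 7) (EXs (2 * j) 7 8 (OA (Sg true 8) (EXs 1 8 9 (OA (Sg true 9)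
       (EXs (2 * j).+2 6 10 (Ug 9 10)))))))) <-> exists o, [/\ gB j o, bit_at s true (o + 2 * j),
      bit_at s true (o + 2 * j).+1 & UnS s (o + 2 * j).+1 (o' + 2 * j).+2] by [].
  rewrite -[fs _ (EX _ _)]/(exists o, o < e 2 /\ (B l (12 + j) o o /\ fs (fupd (fupd e 6 o') 7 o)
    (EXs (2 * j) 7 8 (OA (Sg true 8) (EXs 1 8 9 (OA (Sg true 9) (EXs (2 * j).+2 6 10 (Ug 9 10)))))))).
  rewrite e2; split=> -[o].
    rewrite fs_exs //= fs_exs //= fs_exs //= !addn1 !addnS ?addn0.
    case=> l1 [b1 [l2 [b2 [l3 [b3 [l4 b4]]]]]].
    by exists o; split; [split|apply/HS; split|apply/HS; split|apply/HU; split].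
  case=> -[l1 b1] /HS[l2 b2] /HS[l3 b3] /HU[l4 l5 b4]; exists o; split=> //; split=> //.
  by rewrite fs_exs //= fs_exs //= fs_exs //= !addn1 !addnS ?addn0.
rewrite fs_ball; split=> [H|H k].
  elim=> [|k IH] o lk.
    rewrite BOS0; split=> [[lo]|->]; have := H 0 isT; rewrite /= e2.
      by move/(_ o lo)/(E0 o lo) => ->.
    by move/(_ 0 N0)/(E0 0 N0) => h; split=> //; exact/h.
  have Hk : forall o, o < N -> (B l (12 + k.+1) o o <-> BOS s k.+1 o).
    move=> {}o lo; have := H k.+1; rewrite mem_iota add0n /= ltnS lk => /(_ isT).
    rewrite e2 => /(_ o lo)/(ES k o lo) ->; rewrite BOS_S.
    by split=> -[o1 [/(IH _ (ltnW lk)) ? ? ? ?]]; exists o1.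
  split=> [[lo /(Hk _ lo)] //|Bo]; have lo := BOS_N Bo.
  by split=> //; exact/Hk.
rewrite mem_iota add0n => /andP[_]; rewrite ltnS => lk /=; rewrite e2 => o lo.
have Bo : (B l (12 + k) o o : Prop) <-> BOS s k o.
  by rewrite -(H k o lk); split=> [|[]].
case: k lk Bo => [|k] lk Bo; first by apply/E0 => //; rewrite -(BOS0 s) -Bo.
apply/ES => //; rewrite Bo BOS_S.
by split=> -[o1 [/(H _ _ (ltnW lk)) ? ? ? ?]]; exists o1.
Qed.

Hypothesis HB : ConsB.

Definition inS k v := exists o o', [/\ BOS s k o, BOS s k.+1 o', o <= v & v < o'].

Definition srcP k v := (modeB /\ B k.+1 0 v v) \/
  (~ modeB /\ (if k is 0 then exists2 t, selected t & B 0 2 t v else B k 0 v v)).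

Definition asgP (b : bool) v := exists k, [/\ k < l, inS k v & if b then srcP k v else ~ srcP k v].

Definition ConsA := forall b v, gA b v <-> asgP b v.

Lemma asgP_N b v : asgP b v -> v < N.
Proof. by case=> k [_ [o [o' [_ /BOS_N lo _ lv]]] _]; exact: ltn_trans lv lo. Qed.

Lemma fs_src e' k : e' 2 = N -> fs e' (Src k) <-> srcP k (e' 6).
Proof.
move=> e2'; rewrite -[fs e' _]/((fs e' Mode /\ B k.+1 0 (e' 6) (e' 6)) \/ (~ fs e' Mode /\
  fs e' (if k is 0 then EX 4 (OA Sel (OR 0 2 4 6)) else OR k 0 6 6))).
rewrite fs_mode // /srcP; case: k => [|k] //=.
suff -> : (exists a, a < e' 2 /\ (B 1 1 a a /\ (forall a0, a0 < a -> ~ B 1 1 a0 a0)) /\ B 0 2 a (e' 6)) <->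
  exists2 t, selected t & B 0 2 t (e' 6) by [].
rewrite e2'; split=> [[t [lt [[H1 H2] H3]]]|[t [lt H1 H2] H3]]; exists t => //.
Qed.

Lemma fs_in e' k : e' 2 = N -> e' 6 < N -> k < l -> fs e' (In k) <-> inS k (e' 6).
Proof.
move=> e2' l6 lk; rewrite -[fs e' _]/(exists o, o < e' 2 /\ exists o', o' < e' 2 /\
  (B l (12 + k) o o /\ (B l (12 + k.+1) o' o' /\
   (~ fs (fupd (fupd e' 7 o) 8 o') (Lt 6 7) /\ fs (fupd (fupd e' 7 o) 8 o') (Lt 6 8))))).
rewrite e2'; split=> [[o [lo [o' [lo' [b1 [b2 []]]]]]]|[o [o' [b1 b2 le lt]]]].
  rewrite !fs_lt //= ?(ltnW lo) ?(ltnW lo') // => nl lt; exists o, o'; split=> //.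
  - by apply/HB; [exact: ltnW|split].
  - by apply/HB; [|split].
  - by rewrite leqNgt; exact/negP.
have [lo lo'] := (BOS_N b1, BOS_N b2).
exists o; split=> //; exists o'; split=> //; rewrite !fs_lt //= ?(ltnW lo) ?(ltnW lo') //.
have [_ ?] := (HB o (ltnW lk)).2 b1; have [_ ?] := (HB o' lk).2 b2.
by do 3!split=> //; apply/negP; rewrite -leqNgt.
Qed.

Lemma fs_ga : fs e GA <-> ConsA.
Proof.
have E v b : v < N -> fs (fupd e 6 v) (IFF (Ag b 6)
    (BEX (iota 0 l) (fun k => OA (In k) (LIT b (Src k))))) <-> (B l (5 + b) v v <-> asgP b v).
  move=> lv; rewrite fs_iff fs_bex.
  suff -> : (exists2 k, k \in iota 0 l & fs (fupd e 6 v) (OA (In k) (LIT b (Src k)))) <-> asgP b v by [].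
  split=> [[k]|[k [lk H1 H2]]].
    rewrite mem_iota add0n => lk.
    rewrite -[fs _ (OA _ _)]/(fs (fupd e 6 v) (In k) /\ fs (fupd e 6 v) (LIT b (Src k))).
    case=> H1 H2; exists k; split=> //; first by apply/(@fs_in (fupd e 6 v)).
    by move: H2; rewrite fs_lit; case: (b); rewrite fs_src.
  exists k; first by rewrite mem_iota.
  split; first by apply/fs_in.
  by rewrite fs_lit; move: H2; case: (b); rewrite fs_src.
rewrite /= e2; split=> [H b v|H v lv].
  case: (ltnP v N) => lv; last by split=> [[]|/asgP_N]; rewrite ltnNge lv.
  have := H v lv; rewrite fs_ball => /(_ b (in_bools _)); rewrite E // => <-.
  by split=> [[]|].
by apply/fs_ball => b _; rewrite E // -(H b v); split=> [|[]].
Qed.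

Hypothesis HA : ConsA.

Definition ConsV := forall b p v, gV b p v <-> VS s N asgP b p v.

Lemma VS_N b p v : VS s N asgP b p v -> p < N /\ v < N.
Proof. by move/VS_lt => [H1 H2]; split=> //; exact: ltn_trans H1 size_sel. Qed.

Lemma fs_gv : fs e GV <-> ConsV.
Proof.
have E b p v : p < N -> v < N -> fs (fupd (fupd e 6 p) 7 v) (IFF (Vg b 6 7)
    (OO (OA (Sg false 6) (Ag b 7)) (OA (Sg true 6) (EXs 1 6 8 (EXs 1 7 9 (Vg b 8 9)))))) <->
    (B l (7 + b) p v <-> (bit_at s false p /\ v < N /\ asgP b v) \/ (bit_at s true p /\ gV b p.+1 v.+1)).
  move=> lp lv; rewrite fs_iff /= fs_exs //= fs_exs //= !addn1 -!HS /gS /gV.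
  match goal with |- (_ <-> ?R) <-> (_ <-> ?R') => suff -> : R <-> R' by [] end.
  split.
    case=> [[b1 b2]|[b1 [l1 [l2 b2]]]]; [left|by right].
    by split=> //; split=> //; apply/HA.
  case=> [[[_ b1] [_ /HA[_ b2]]]|[[_ b1] [l1 l2 b2]]]; by [left|right].
rewrite fs_ball; split=> [H b|H b _]; last first.
  move=> p /=; rewrite e2 => lp v lv.
  apply/E => //; have -> : (B l (7 + b) p v : Prop) <-> gV b p v by split=> [|[]].
  rewrite (H b p v) VS_eq; split=> -[[H1 H2]|[H1 H2]]; [left|right|left|right]; split=> //; exact/H.
have {}H := H b (in_bools _).
move=> p; have [m] := ubnP (N - p); elim: m p => // m IH p lm v.
case: (ltnP p N) => lp; last by split=> [[]|/VS_N[]]; rewrite ltnNge lp.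
case: (ltnP v N) => lv; last by split=> [[]|/VS_N[]]; rewrite ?(ltnNge v) ?lv.
have -> : gV b p v <-> (B l (7 + b) p v : Prop) by split=> [[]|].
move: H; rewrite /= e2 => H.
have [H1 H2] := (E b p v lp lv).1 (H p lp v lv).
have IHp : gV b p.+1 v.+1 <-> VS s N asgP b p.+1 v.+1 by apply: IH; lia.
rewrite VS_eq -IHp; exact: (conj H1 H2).
Qed.

Hypothesis HV : ConsV.

Definition ConsE := forall b p q, gE b p q <-> ES s N asgP b p q.

Lemma ES_N b p q : ES s N asgP b p q -> p < N /\ q < N.
Proof. by move/ES_lt => H; have := size_sel; lia. Qed.

Definition rhsE b p q :=
  [\/ [/\ bit_at s false p, bit_at s false p.+1, bit_at s b p.+2 & q = p.+3],
      [/\ bit_at s false p, bit_at s true p.+1, UnS s p.+2 q & VS s N asgP b p.+2 0],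
      [/\ bit_at s true p, bit_at s false p.+1 & gE (~~ b) p.+2 q]
    | [/\ bit_at s true p, bit_at s true p.+1 & exists c r b1 b2,
        [/\ bit_at s c p.+2, gE b1 p.+3 r, gE b2 r q & (if c then b1 || b2 else b1 && b2) = b]]].

Lemma fs_rhsE b p q : p < N -> q < N -> fs (fupd (fupd e 6 p) 7 q) (IFF (Eg b 6 7) (ERhs b))
  <-> (B l (9 + b) p q <-> rhsE b p q).
Proof.
move=> lp lq; rewrite fs_iff.
match goal with |- (_ <-> fs ?e' ?F) <-> _ => suff -> : fs e' F <-> rhsE b p q by [] end.
rewrite fs_exs //= fs_exs //= fs_exs //= !addn1 fs_shift /= addn1 e2 e3; split.
  case=> l1 [l2 [[H1 [H2 [H3 [H4 _]]]]|[[H1 [H2 [H3 H4]]]|[[H1 [H2 H3]]|[H1 [H2 [l3 [r [lr]]]]]]]]].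
  - by constructor 1; split=> //; apply/HS; split.
  - by constructor 2; split; [apply/HS|apply/HS|apply/HU|apply/HV]; split.
  - by constructor 3; split; [apply/HS|apply/HS|]; split.
  - rewrite fs_bex => -[[[c b1] b2]]; rewrite mem_filter => /andP[/eqP E _] /= [H3 [H4 H5]].
    constructor 4; split; [apply/HS; split=> //|apply/HS; split=> //|exists c, r, b1, b2].
    by split=> //; apply/HS; split.
case=> [[/HS[l1 H1] /HS[l2 H2] /HS[l3 H3] E]|[/HS[l1 H1] /HS[l2 H2] /HU[l3 _ H3] /HV[_ _ H4]]
  |[/HS[l1 H1] /HS[l2 H2] [l3 _ H3]]|[/HS[l1 H1] /HS[l2 H2] [c [r [b1 [b2 [/HS[l3 H3] [l4 l5 H4] [_ _ H5] E]]]]]]];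
  split=> //; split=> //.
- by left; rewrite E in lq *.
- by right; left.
- by right; right; left.
- right; right; right; do 3!split=> //; exists r; split=> //.
  by apply/fs_bex; exists (c, b1, b2) => //; rewrite mem_filter mem_enum /= E eqxx.
Qed.

Lemma fs_ge : fs e GE <-> ConsE.
Proof.
rewrite fs_ball; split=> [H|H b _]; last first.
  move=> p /=; rewrite e2 => lp q lq.
  apply/fs_rhsE => //; have -> : (B l (9 + b) p q : Prop) <-> gE b p q by split=> [|[]].
  rewrite (H b p q) ES_eq /rhsE; split=> -[H1|H1|[H1 H2 H3]|[H1 H2 [c [r [b1 [b2 [K1 K2 K3 K4]]]]]]].
  - by constructor 1.
  - by constructor 2.
  - by constructor 3; split=> //; exact/H.
  - by constructor 4; split=> //; exists c, r, b1, b2; split=> //; exact/H.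
  - by constructor 1.
  - by constructor 2.
  - by constructor 3; split=> //; exact/H.
  - by constructor 4; split=> //; exists c, r, b1, b2; split=> //; exact/H.
move=> b p; have [m] := ubnP (N - p); elim: m p b => // m IH p b lm q.
case: (ltnP p N) => lp; last by split=> [[]|/ES_N[]]; rewrite ltnNge lp.
case: (ltnP q N) => lq; last by split=> [[]|/ES_N[]]; rewrite ?(ltnNge q) ?lq.
have -> : gE b p q <-> (B l (9 + b) p q : Prop) by split=> [[]|].
have := H b (in_bools _); rewrite /= e2 => /(_ p lp q lq)/(fs_rhsE b lp lq) ->.
have IHp p' b' q' : p < p' -> gE b' p' q' <-> ES s N asgP b' p' q' by move=> lt; apply: IH; lia.
rewrite ES_eq /rhsE; split=> -[H1|H1|[H1 H2 H3]|[H1 H2 [c [r [b1 [b2 [K1 K2 K3 K4]]]]]]].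
- by constructor 1.
- by constructor 2.
- by constructor 3; split=> //; apply/IHp => //; lia.
- constructor 4; split=> //; exists c, r, b1, b2.
  (* The second subformula starts at [r]; translating the first one back to [ES] shows that [r] lies
     beyond [p], so the induction hypothesis applies there too. *)
  have K2' : ES s N asgP b1 p.+3 r by apply/IHp => //; lia.
  by split=> //; apply/IHp => //; have := ES_lt K2'; lia.
- by constructor 1.
- by constructor 2.
- by constructor 3; split=> //; apply/IHp => //; lia.
- constructor 4; split=> //; exists c, r, b1, b2; have := ES_lt K2 => lt.
  by split=> //; apply/IHp => //; lia.
Qed.

End Semantics.
End Gates.

Definition asb (P : Prop) : bool := if excluded_middle_informative P then true else false.

Lemma asbP P : asb P <-> P.
Proof. by rewrite /asb; case: excluded_middle_informative. Qed.

(** A variable keeps its global number [v] as its slot in the word of its block, so the formulas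
    never have to subtract the start of a block. *)
Fixpoint gat (src : nat -> nat -> bool) k off (ms : seq nat) : word :=
  if ms is m :: ms' then [seq src k v | v <- iota off m] ++ gat src k.+1 (off + m) ms' else [::].

Lemma size_gat src k off ms : size (gat src k off ms) = sumn ms.
Proof. by elim: ms k off => //= m ms IH k off; rewrite size_cat size_map size_iota IH. Qed.

Lemma nth_gat src k off ms j v : j < size ms -> sumn (take j ms) <= v < sumn (take j.+1 ms) ->
  nth false (gat src k off ms) v = src (k + j) (off + v).
Proof.
elim: ms k off j v => //= m ms IH k off [|j] v lj.
  rewrite /= take0 /= addn0 => lv; rewrite nth_cat size_map size_iota lv.
  by rewrite (nth_map 0) ?size_iota // nth_iota // addn0.
move=> /= lv; rewrite nth_cat size_map size_iota ltnNge.
have le : m <= v by lia.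
rewrite le /= (IH _ _ j) //; last by lia.
by congr src; lia.
Qed.

Lemma eq_gat src src' k off ms :
  (forall j v, k <= j -> off <= v < off + sumn ms -> src j v = src' j v) ->
  gat src k off ms = gat src' k off ms.
Proof.
elim: ms k off => //= m ms IH k off H; congr cat.
  by apply/eq_in_map => v; rewrite mem_iota => lv; apply: H => //; lia.
by apply: IH => j v lj lv; apply: H; lia.
Qed.

Lemma gat_shift src k off ms : gat src k.+1 off ms = gat (fun j => src j.+1) k off ms.
Proof. by elim: ms k off => //= m ms IH k off; rewrite IH. Qed.

Section Query.

Variables (l : nat) (X : word) (B : nat -> nat -> nat -> nat -> bool).
Notation N := (size X).
Notation fs := (fsem X B).

Definition srcb k v : bool := asb (srcP X B k v).

Variable s : word.
Hypothesis sN : size s < N.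

Lemma BOS_enc ms f k o : s = enc_inst ms f -> all (fun m => 0 < m) ms -> k <= size ms ->
  BOS s k o <-> o = sumn (take k ms).
Proof.
move=> E am lk.
have H : BOS s k (sumn (take k ms)).
  have sz : size (enc_blocks (take k ms)) = sumn (take k ms) + 2 * k.
    by rewrite size_enc_blocks_eq size_takel.
  have E2 : s = enc_blocks (take k ms) ++ enc_blocks (drop k ms) ++ false :: encf f.
    by rewrite E /enc_inst -{1}(cat_take_drop k ms) /enc_blocks map_cat flatten_cat -catA.
  exists (take k ms); split=> //.
  - by rewrite size_takel.
  - by apply/allP => m /mem_take /(allP am).
  - by rewrite -sz E2 drop_size_cat.
  - by rewrite E2 size_cat sz leq_addr.
by split=> [Ho|->//]; exact: BOS_inj Ho H.
Qed.

Lemma asgP_enc ms f b v : s = enc_inst ms f -> all (fun m => 0 < m) ms -> size ms = l ->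
  (v < N /\ asgP l X B s b v) <-> v < sumn ms /\ nth false (gat srcb 0 0 ms) v = b.
Proof.
move=> E am sl.
have lm : sumn ms < N.
  by apply: leq_ltn_trans sN; rewrite E size_cat size_enc_blocks_eq; lia.
have srcbP k c : (if c then srcP X B k v else ~ srcP X B k v) <-> srcb k v = c.
  rewrite /srcb; case: c; first exact: iff_sym (asbP _).
  by split=> [H|H /asbP]; [apply/negP => /asbP|rewrite H].
split.
  case=> _ [k [lk [o [o' [/(BOS_enc _ E am) Ho /(BOS_enc _ E am) Ho' le lt]]]]] /srcbP H.
  rewrite sl in Ho Ho'; move: le lt; rewrite Ho ?Ho' ?(ltnW lk) // => le lt.
  split; last by rewrite (@nth_gat _ _ _ _ k) ?sl ?le ?lt.
  apply: leq_trans lt _; rewrite -{2}(cat_take_drop k.+1 ms) sumn_cat; exact: leq_addr.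
case=> lv H.
have [k lk /andP[le lt]] : exists2 k, k < l & sumn (take k ms) <= v < sumn (take k.+1 ms).
  move: lv; rewrite -sl; elim: (ms) v {H srcbP} => //= m ms' IH v lv.
  case: (ltnP v m) => lvm; first by exists 0; rewrite //= take0 /= addn0.
  have [|k lk H] := IH (v - m); first by lia.
  by exists k.+1 => //=; lia.
split; first by lia.
exists k; split=> //.
  by exists (sumn (take k ms)), (sumn (take k.+1 ms)); split=> //; apply/(BOS_enc _ E am);
    rewrite // sl // ltnW.
by apply/srcbP; rewrite -H (@nth_gat _ _ _ _ k) ?sl ?le ?lt.
Qed.

Lemma Ev_enc a b f bd (VA : bool -> nat -> Prop) :
  (forall c v, (v < bd /\ VA c v) <-> v < size a /\ nth false a v = c) ->
  Ev bd VA b f <-> maxvar1 f <= size a /\ eval a f = b.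
Proof.
move=> H; elim: f b => [c|v|g IH|g IHg h IHh|g IHg h IHh] b /=.
- by split=> [->|[]].
- exact: H.
- by rewrite IH; split=> -[-> E]; split=> //; [rewrite E negbK|rewrite -E negbK].
- split=> [[b1 [b2 [/IHg[l1 E1] /IHh[l2 E2] E]]]|[]]; first by rewrite geq_max l1 l2 E1 E2.
  rewrite geq_max => /andP[l1 l2] E; exists (eval a g), (eval a h).
  by split=> //; [apply/IHg|apply/IHh].
- split=> [[b1 [b2 [/IHg[l1 E1] /IHh[l2 E2] E]]]|[]]; first by rewrite geq_max l1 l2 E1 E2.
  rewrite geq_max => /andP[l1 l2] E; exists (eval a g), (eval a h).
  by split=> //; [apply/IHg|apply/IHh].
Qed.

(** The absence of either bit at [q] means that [q] is the end of the string, so nothing follows the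
    formula. *)
Definition valueP (b : bool) := exists o q, [/\ BOS s l o, bit_at s false (o + 2 * l),
  ES s N (asgP l X B s) b (o + 2 * l).+1 q, ~ bit_at s false q & ~ bit_at s true q].

Lemma valueP_decode b : valueP b <-> exists ms f,
  [/\ decode s = Some (ms, f), size ms = l & eval (gat srcb 0 0 ms) f = b].
Proof.
split.
  case=> o [q [[ms [sl am so E le]] b0 [f [D lq HE]] n0 n1]].
  have qs : q = size s.
    apply/eqP; rewrite eqn_leq lq leqNgt; apply/negP => lt.
    by case E1: (nth false s q); [apply: n1|apply: n0].
  have E2 : s = enc_inst ms f.
    by move/bit_atP: b0 => b0; rewrite {1}E b0 D qs drop_size cats0.
  have := HE; rewrite (@Ev_enc (gat srcb 0 0 ms)); last first.
    by move=> c v; rewrite size_gat; exact: asgP_enc E2 am sl.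
  rewrite size_gat => -[mv ev].
  by exists ms, f; split=> //; apply/decodeP.
case=> ms [f [/decodeP[E am mv] sl ev]].
have ES_ : s = enc_blocks ms ++ false :: encf f := E.
have sz := size_enc_blocks_eq ms; rewrite sl in sz.
have D : drop (sumn ms + 2 * l) s = false :: encf f by rewrite ES_ -sz drop_size_cat.
have b0 := drop_le D.
have D1 : drop (sumn ms + 2 * l).+1 s = encf f.
  by move: D; rewrite (drop_nth false b0) => -[].
exists (sumn ms), (size s); split.
- by apply/(BOS_enc _ E am); rewrite -?sl ?take_size.
- by apply/bit_atP; rewrite D D1.
- exists f; split; rewrite ?drop_size ?cats0 //.
  rewrite (@Ev_enc (gat srcb 0 0 ms)) ?size_gat // => c v.
  exact: asgP_enc E am sl.
- by case; rewrite ltnn.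
- by case; rewrite ltnn.
Qed.

End Query.

(** * The check of one selected query *)

Section Checks.

Variable l : nat.

Definition Value (b : bool) := EX 6 (OA (Bg l l 6) (EXs (2 * l) 6 7 (OA (Sg l false 7)
  (EXs 1 7 8 (EX 9 (OA (Eg l b 8 9) (OA (ON (Sg l false 9)) (ON (Sg l true 9))))))))).

(** A witness row has as many entries as there are positions; those beyond the first block are
    forced to zero to keep the row unique. [Bg l 1] holds at the size of the first block. *)
Definition Supp := ALL 6 (OI (OR 0 2 4 6) (EX 7 (OA (Bg l 1 7) (Lt 6 7)))).

Definition LexLt := EX 6 (OA (OR 0 2 4 6) (OA (ON (OR 1 0 6 6)) (OA (EX 7 (OA (Bg l 1 7) (Lt 6 7)))
  (OF 8 6 (IFF (OR 0 2 4 8) (OR 1 0 8 8)))))).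

(** A value is derivable exactly if the query encodes a function with [l] blocks. Otherwise [SAT]
    answers 0, which is what the first conjunct demands. *)
Definition CheckBody := OA (OI (ON (OO (Value true) (Value false))) (ON (OR 0 1 4 4)))
  (OI (OO (Value true) (Value false))
  (OA (OI (OA (ON Mode) (OR 0 1 4 4)) (OA Supp (Value true)))
      (OI (OA Mode (OO (ON (OR 0 1 4 4)) LexLt)) (Value false)))).

Definition CheckF (ask : fo) := ALL 4 (OI (OA Sel ask) CheckBody).

Definition ConsF := OA (GStr l) (OA (GUn l) (OA (GB l) (OA (GA l) (OA (GV l) (GE l))))).

Section Semantics.

Variables (X : word) (B : nat -> nat -> nat -> nat -> bool).
Notation N := (size X).
Notation fs := (fsem X B).

Definition supp t m := forall v, v < N -> B 0 2 t v -> v < m.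

Definition lexless t m := exists v, [/\ v < m, B 0 2 t v, ~~ B 1 0 v v &
  forall u, u < v -> B 0 2 t u = B 1 0 u u].

Definition check_query t : Prop :=
  let bad := ~ B 0 1 t t in
  match decode (strof X B t) with
  | Some (ms, f) =>
      if size ms == l then
        let val := eval (gat (srcb X B) 0 0 ms) f in
        (~ modeB X B -> B 0 1 t t -> supp t (head 0 ms) /\ val) /\
        (modeB X B -> ~ B 0 1 t t \/ lexless t (head 0 ms) -> ~~ val)
      else bad
  | None => bad
  end.

Variables (e : nat -> nat) (s : word) (askP : nat -> Prop).
Hypotheses (e2 : e 2 = N) (e3 : e 3 = 0) (N0 : 0 < N) (l0 : 0 < l).
Hypothesis Hs : selstr X B s.

Definition consP := [/\ ConsS l X B s, ConsU l X B s, ConsB l X B s &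
  [/\ ConsA l X B s, ConsV l X B s & ConsE l X B s]].

Lemma fs_consf : fs e ConsF <-> consP.
Proof.
rewrite -[fs e ConsF]/(fs e (GStr l) /\ (fs e (GUn l) /\ (fs e (GB l) /\ (fs e (GA l) /\
  (fs e (GV l) /\ fs e (GE l)))))).
split.
  case=> /(fs_gstr _ e2 e3 N0 Hs) HS [/(fs_gun e2 e3 N0 Hs HS) HU] [/(fs_gb e2 e3 N0 Hs HS HU) HB].
  case=> /(fs_ga e2 e3 N0 Hs HB) HA [/(fs_gv e2 e3 N0 Hs HS HA) HV].
  by move/(fs_ge e2 e3 N0 Hs HS HU HV).
case=> HS HU HB [HA HV HE].
split; first exact/(fs_gstr _ e2 e3 N0 Hs).
split; first exact/(fs_gun e2 e3 N0 Hs HS).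
split; first exact/(fs_gb e2 e3 N0 Hs HS HU).
split; first exact/(fs_ga e2 e3 N0 Hs HB).
split; first exact/(fs_gv e2 e3 N0 Hs HS HA).
exact/(fs_ge e2 e3 N0 Hs HS HU HV).
Qed.

Section Meaning.

Hypothesis HC : consP.

Let HS : ConsS l X B s. Proof. by case: HC. Qed.
Let HB : ConsB l X B s. Proof. by case: HC. Qed.
Let HE : ConsE l X B s. Proof. by case: HC => ? ? ? []. Qed.

Lemma fs_value e' b : e' 2 = N -> fs e' (Value b) <-> valueP l X B s b.
Proof.
move=> e2'; rewrite -[fs e' _]/(exists o, o < e' 2 /\ (B l (12 + l) o o /\
  fs (fupd e' 6 o) (EXs (2 * l) 6 7 (OA (Sg l false 7)
  (EXs 1 7 8 (EX 9 (OA (Eg l b 8 9) (OA (ON (Sg l false 9)) (ON (Sg l true 9)))))))))).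
have sN := size_sel e2 e3 N0 Hs.
rewrite e2'; split=> [[o [lo]]|[o [q [Ho H0 HEq n0 n1]]]].
  rewrite fs_exs //= fs_exs //= !addn1 e2'.
  case=> H [l1 [H1 [l2 [q [lq [H2 [n0 n1]]]]]]]; exists o, q; split.
  - by apply/HB.
  - exact/HS.
  - exact/HE.
  - by move/HS => -[].
  - by move/HS => -[].
have [lo Bo] := (HB o (leqnn l)).2 Ho; exists o; split=> //; split=> //.
have [l1 B1] := (HS _ _).2 H0; have [l2 lq B2] := (HE _ _ _).2 HEq.
rewrite fs_exs //= fs_exs //= !addn1 e2'; split=> //; split=> //; split=> //.
exists q; split=> //; split=> //; split.
  by move=> Bq; apply: n0; apply/HS.
by move=> Bq; apply: n1; apply/HS.
Qed.

Lemma bos1_head ms f o : decode s = Some (ms, f) -> size ms = l -> BOS s 1 o <-> o = head 0 ms.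
Proof.
case/decodeP=> E am _ sl; rewrite (BOS_enc _ E am) ?sl //.
by case: (ms) sl => [|m ms'] /=; rewrite ?take0 ?addn0 // => sl; move: l0; rewrite -sl.
Qed.

Lemma fs_bos1 e' ms f v : e' 2 = N -> e' 6 = v -> v < N -> decode s = Some (ms, f) -> size ms = l ->
  fs e' (EX 7 (OA (Bg l 1 7) (Lt 6 7))) <-> v < head 0 ms.
Proof.
move=> e2' e6 lv ds sl; rewrite -[fs e' _]/(exists o, o < e' 2 /\ (B l 13 o o /\
  fs (fupd e' 7 o) (Lt 6 7))); rewrite e2'; split.
  case=> o [lo [Bo]]; rewrite fs_lt ?(ltnW lo) //= e6.
  by have /(bos1_head _ ds sl) -> : BOS s 1 o by apply/HB.
have /(HB _ l0)[lo Bo] : BOS s 1 (head 0 ms) by apply/(bos1_head _ ds sl).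
by exists (head 0 ms); rewrite fs_lt ?(ltnW lo) //= e6.
Qed.

Lemma fs_checkf ask : (forall e', e' 2 = N -> e' 3 = 0 -> fs e' ask <-> askP (e' 4)) ->
  fs e (CheckF ask) <-> forall t, selected X B t -> askP t -> check_query t.
Proof.
move=> Hask.
have K t : selected X B t -> fs (fupd e 4 t) CheckBody <-> check_query t.
  move=> st.
  have sE : s = strof X B t by case: Hs => [[t' st' ->]|[/(_ t)//]]; rewrite (selected_inj st st').
  have e2' : fupd e 4 t 2 = N by [].
  rewrite -[fs _ CheckBody]/((~ (fs (fupd e 4 t) (Value true) \/ fs (fupd e 4 t) (Value false)) -> ~ B 0 1 t t) /\
   ((fs (fupd e 4 t) (Value true) \/ fs (fupd e 4 t) (Value false)) ->
    (((~ fs (fupd e 4 t) Mode /\ B 0 1 t t) -> (fs (fupd e 4 t) Supp /\ fs (fupd e 4 t) (Value true))) /\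
     ((fs (fupd e 4 t) Mode /\ (~ B 0 1 t t \/ fs (fupd e 4 t) LexLt)) -> fs (fupd e 4 t) (Value false))))).
  rewrite !fs_value // fs_mode //.
  have sN := size_sel e2 e3 N0 Hs.
  rewrite /check_query -sE.
  have bad : (forall ms f, decode s = Some (ms, f) -> size ms <> l) ->
      forall b, ~ valueP l X B s b.
    by move=> H b /(valueP_decode l B sN)[ms [f [ds sl _]]]; exact: H ds sl.
  case ds: (decode s) => [[ms f]|]; last first.
    have nv := bad (fun ms f (H : decode s = Some (ms, f)) => ltac:(by rewrite ds in H)).
    by split=> [[H _]|H]; [apply: H => -[] /nv|split=> // -[] /nv].
  case: eqP => sl; last first.
    have nv : forall b, ~ valueP l X B s b by apply: bad => ms' f'; rewrite ds => -[<- _].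
    by split=> [[H _]|H]; [apply: H => -[] /nv|split=> // -[] /nv].
  have V b : valueP l X B s b <-> eval (gat (srcb X B) 0 0 ms) f = b.
    rewrite valueP_decode //; split=> [[ms' [f' []]]|H]; last by exists ms, f.
    by rewrite ds => -[<- <-].
  rewrite !V.
  have Sp : fs (fupd e 4 t) Supp <-> supp t (head 0 ms).
    rewrite -[fs _ Supp]/(forall v, v < e 2 -> B 0 2 t v ->
      fs (fupd (fupd e 4 t) 6 v) (EX 7 (OA (Bg l 1 7) (Lt 6 7)))) e2.
    by split=> H v lv Bv; have := H v lv Bv; rewrite (@fs_bos1 _ ms f v).
  have Lx : fs (fupd e 4 t) LexLt <-> lexless t (head 0 ms).
    rewrite -[fs _ LexLt]/(exists v, v < e 2 /\ (B 0 2 t v /\ (~ B 1 0 v v /\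
      (fs (fupd (fupd e 4 t) 6 v) (EX 7 (OA (Bg l 1 7) (Lt 6 7))) /\
       forall u, u < v -> fs (fupd (fupd (fupd e 4 t) 6 v) 8 u) (IFF (OR 0 2 4 8) (OR 1 0 8 8)))))) e2.
    split=> [[v [lv [H1 [/negP H2 [/(fs_bos1 _ _ lv ds sl)-/(_ e2 erefl) H3 H4]]]]]|[v [H1 H2 /negP H3 H4]]].
      exists v; split=> // u lu; have := H4 u lu; rewrite fs_iff /= => -[a b].
      by apply/idP/idP.
    have lv : v < N.
      apply: ltn_trans H1 _; have /(HB _ l0)[] // : BOS s 1 (head 0 ms) by apply/(bos1_head _ ds sl).
    exists v; rewrite (@fs_bos1 _ ms f v) //; do 4!split=> //.
    by move=> u lu; rewrite fs_iff /= (H4 u lu).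
  rewrite Sp Lx; move: (eval _ _) => c.
  have V10 : c = true \/ c = false by case: (c); [left|right].
  have -> : (~~ c : Prop) <-> c = false by split=> [/negbTE|->].
  by rewrite /is_true in V10 *; tauto.
rewrite -[fs e _]/(forall t, t < e 2 -> fs (fupd e 4 t) Sel /\ fs (fupd e 4 t) ask -> fs (fupd e 4 t)
  CheckBody) e2.
split=> H t.
  move=> st a; apply/K => //; have lt : t < N by case: st.
  by apply: H => //; rewrite fs_sel // Hask.
by move=> lt; rewrite fs_sel // Hask // => -[st a]; apply/K => //; exact: H.
Qed.

End Meaning.
End Semantics.
End Checks.

(** * Alternating quantification over blocks *)

Definition rels := nat -> nat -> nat -> nat -> bool.

(* What remains of the relations without the gates. *)
Definition core (B : rels) : rels := fun b r i j => ((r < 3) || (b == 0)) && B b r i j.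

Lemma selstr_core X B s : selstr X (core B) s = selstr X B s. Proof. by []. Qed.
Lemma asgP_core l X B s : asgP l X (core B) s = asgP l X B s. Proof. by []. Qed.
(** The intended gate values. The predicates become bits by a classical decision, since only the
    existence of such a gate word matters. *)
Definition gateval l X B s r i j : bool :=
  match r with
  | 3 => asb (bit_at s false i) | 4 => asb (bit_at s true i)
  | 5 => asb (asgP l X B s false i) | 6 => asb (asgP l X B s true i)
  | 7 => asb (VS s (size X) (asgP l X B s) false i j)
  | 8 => asb (VS s (size X) (asgP l X B s) true i j)
  | 9 => asb (ES s (size X) (asgP l X B s) false i j)
  | 10 => asb (ES s (size X) (asgP l X B s) true i j)
  | 11 => asb (UnS s i j)
  | r => asb (BOS s (r - 12) i)
  end.

Lemma gates_consP l X B B' s : size s < size X -> core B' = core B ->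
  (forall r i j, 2 < r < 13 + l -> i < size X -> j < size X -> B' l r i j = gateval l X B s r i j) ->
  consP l X B' s.
Proof.
move=> sN E H; set N := size X in sN H *.
have EA : asgP l X B' s = asgP l X B s by rewrite -asgP_core E.
have bN b i : bit_at s b i -> i < N by case=> li _; exact: ltn_trans sN.
have BN k o : BOS s k o -> o < N by move/BOS_le => le; lia.
have AN b v : asgP l X B s b v -> v < N.
  by case=> k [_ [o [o' [_ /BN lo _ lv]]] _]; exact: ltn_trans lv lo.
split.
- move=> b i; split=> [[li]|Hb]; first by case: b; rewrite H //= asbP.
  by have li := bN _ _ Hb; split=> //; case: b Hb; rewrite H //= asbP.
- move=> p q; split=> [[lp lq]|Hb]; first by rewrite H //= asbP.
  by have := UnS_lt Hb => lt; split; [lia|lia|rewrite H /= ?asbP //; lia].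
- move=> k o lk; have E12 : (12 + k) - 12 = k by rewrite addKn.
  split=> [[lo]|Hb]; first by rewrite H //= ?asbP ?E12 //; lia.
  by have lo := BN _ _ Hb; split=> //; rewrite H //= ?asbP ?E12 //; lia.
- split.
  + move=> b v; rewrite EA; split=> [[lv]|Hb]; first by case: b; rewrite H //= asbP.
    by have lv := AN _ _ Hb; split=> //; case: b Hb; rewrite H //= asbP.
  + move=> b p v; rewrite EA; split=> [[lp lv]|Hb]; first by case: b; rewrite H //= asbP.
    have [lp lv] := VS_lt Hb; have lp' := ltn_trans lp sN.
    by split=> //; case: b Hb; rewrite H //= asbP.
  + move=> b p q; rewrite EA; split=> [[lp lq]|Hb]; first by case: b; rewrite H //= asbP.
    have lt := ES_lt Hb; have [lp lq] : p < N /\ q < N by lia.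
    by split=> //; case: b Hb; rewrite H //= asbP.
Qed.

Section Words.

Variables (K : nat) (X : word).
Notation N := (size X).
Definition wsize := K * (N * N).

Definition mkword (g : nat -> nat -> nat -> bool) : word :=
  mkseq (fun p => g (p %/ N %/ N) ((p %/ N) %% N) (p %% N)) wsize.

Lemma size_mkword g : size (mkword g) = wsize. Proof. by rewrite size_mkseq. Qed.

Lemma index_lt r i j : r < K -> i < N -> j < N -> (r * N + i) * N + j < wsize.
Proof. rewrite /wsize => *; nia. Qed.

Lemma relof_mkword g r i j : r < K -> i < N -> j < N -> relof N (mkword g) r i j = g r i j.
Proof.
move=> lr li lj; rewrite /relof nth_mkseq ?index_lt //.
have N0 : 0 < N by lia.
rewrite (divnMDl _ _ N0) (divn_small lj) addn0 !modnMDl (modn_small lj) (modn_small li).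
by rewrite (divnMDl _ _ N0) (divn_small li) addn0.
Qed.

Lemma word_ext y y' : size y = wsize -> size y' = wsize ->
  (forall r i j, r < K -> i < N -> j < N -> relof N y r i j = relof N y' r i j) -> y = y'.
Proof.
move=> sy sy' H; apply: (@eq_from_nth _ false); first by rewrite sy.
move=> p; rewrite sy => lp.
have N0 : 0 < N by move: lp; rewrite /wsize; case: N => //; rewrite !muln0.
have E : p = (p %/ N %/ N * N + (p %/ N) %% N) * N + p %% N by rewrite -!divn_eq.
rewrite E; apply: H; rewrite ?ltn_mod //.
by rewrite !ltn_divLR // -mulnA.
Qed.

(** Entries out of range read as false, so that cores can be compared by equality of functions. *)
Definition Bcl (ys : seq word) : rels := fun b r i j =>
  [&& i < N, j < N & r < K] && relof N (nth [::] ys b) r i j.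

Lemma Bcl_relof ys b r i j : all (fun y => size y == wsize) ys -> b < size ys ->
  r < K -> i < N -> j < N -> Bcl ys b r i j = relof N (flatten ys) (b * K + r) i j.
Proof.
move=> sz lb lr li lj; rewrite /Bcl li lj lr /= /relof.
elim: ys b sz lb => //= y ys IH [|b] /andP[/eqP sy sz] lb.
  by rewrite nth_cat sy index_lt.
have E : ((b.+1 * K + r) * N + i) * N + j = wsize + (((b * K + r) * N + i) * N + j).
  by rewrite /wsize; lia.
by rewrite IH // E nth_cat sy ltnNge leq_addr /= addKn.
Qed.

Lemma core_gates l zs y g : 0 < l -> size zs = l ->
  core (Bcl (rcons zs (mkword (fun r i j => if r < 3 then relof N y r i j else g r i j)))) =
  core (Bcl (rcons zs y)).
Proof.
move=> l0 sz; apply: functional_extensionality => b; apply: functional_extensionality => r.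
apply: functional_extensionality => i; apply: functional_extensionality => j.
rewrite /core /Bcl !nth_rcons sz.
case: (ltngtP b l) => // bl; rewrite bl gtn_eqF // orbF.
case: (ltnP r 3) => //= r3; case: (ltnP i N) => //= li; case: (ltnP j N) => //= lj.
by case: (ltnP r K) => //= lr; rewrite relof_mkword // r3.
Qed.

Fixpoint Qn (q : bool) k (P : seq word -> Prop) (ys : seq word) : Prop :=
  match k with
  | 0 => P ys
  | k'.+1 => if q then exists y, size y = wsize /\ Qn (~~ q) k' P (rcons ys y)
             else forall y, size y = wsize -> Qn (~~ q) k' P (rcons ys y)
  end.

Definition wordseq k (zs : seq word) := size zs = k /\ all (fun y => size y == wsize) zs.

Lemma Qn_mono q k (P P' : seq word -> Prop) ys ys' :
  (forall zs, wordseq k zs -> P (ys ++ zs) -> P' (ys' ++ zs)) -> Qn q k P ys -> Qn q k P' ys'.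
Proof.
elim: k q ys ys' => [|k IH] q ys ys' H /=.
  by have := H [::]; rewrite !cats0; apply.
have step y : size y = wsize -> Qn (~~ q) k P (rcons ys y) -> Qn (~~ q) k P' (rcons ys' y).
  move=> sy; apply: IH => zs [sz az]; rewrite !cat_rcons; apply: H.
  by split; rewrite /= ?sz // sy eqxx.
case: q step => step; first by case=> y [sy /step H']; exists y; split=> //; exact: H'.
by move=> H' y sy; apply: step => //; exact: H'.
Qed.

Lemma Qn_triv q k (P : seq word -> Prop) ys : (forall zs, wordseq k zs -> P (ys ++ zs)) -> Qn q k P ys.
Proof.
elim: k q ys => [|k IH] q ys H /=; first by rewrite -[ys]cats0; apply: H.
have step y : size y = wsize -> Qn (~~ q) k P (rcons ys y).
  move=> sy; apply: IH => zs [sz az]; rewrite cat_rcons; apply: H.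
  by split; rewrite /= ?sz // sy eqxx.
case: q step => step; last exact: step.
by exists (nseq wsize false); rewrite size_nseq; split=> //; apply: step; rewrite size_nseq.
Qed.

Lemma Qn_ex q k (P : seq word -> Prop) ys : Qn q k P ys -> exists2 zs, wordseq k zs & P (ys ++ zs).
Proof.
elim: k q ys => [|k IH] q ys /=; first by exists [::]; rewrite ?cats0.
have step y : size y = wsize -> Qn (~~ q) k P (rcons ys y) -> exists2 zs, wordseq k.+1 zs & P (ys ++ zs).
  move=> sy /IH[zs [sz az]]; rewrite cat_rcons => H; exists (y :: zs) => //.
  by split; rewrite /= ?sz // sy eqxx.
case: q step => step; first by case=> y [sy]; exact: step.
by move/(_ (nseq wsize false)); rewrite size_nseq => /(_ erefl); apply: step; rewrite size_nseq.
Qed.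

Lemma Qn_const q k (P : Prop) ys : Qn q k (fun=> P) ys <-> P.
Proof. by split=> [/Qn_ex[]|H] //; exact: Qn_triv. Qed.

(** [q (+) odd k] is the kind of the last of [k.+1] alternating quantifiers; the gates will be
    exchanged under that quantifier only. *)
Lemma Qn_last q k (P P' : seq word -> Prop) ys :
  (forall zs, wordseq k zs -> Qn (q (+) odd k) 1 P (ys ++ zs) -> Qn (q (+) odd k) 1 P' (ys ++ zs)) ->
  Qn q k.+1 P ys -> Qn q k.+1 P' ys.
Proof.
elim: k q ys => [|k IH] q ys H.
  by have := H [::]; rewrite !cats0 addbF; apply.
have step y : size y = wsize -> Qn (~~ q) k.+1 P (rcons ys y) -> Qn (~~ q) k.+1 P' (rcons ys y).
  move=> sy; apply: IH => zs [sz az]; rewrite !cat_rcons.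
  have -> : ~~ q (+) odd k = q (+) odd k.+1 by case: q {H}; rewrite /= ?negbK //; case: odd.
  by apply: H; split; rewrite /= ?sz // sy eqxx.
case: q step {IH H} => step; first by case=> y [sy /(step _ sy) H']; exists y.
by move=> H' y sy; apply: step => //; exact: H'.
Qed.

Lemma words_size m w : (w \in words m) = (size w == m).
Proof.
elim: m w => [|m IH] w /=; first by rewrite inE; case: w.
rewrite cats0 mem_cat; case: w => [|b w].
  by apply/negP => /orP[] /mapP[].
rewrite eqSS -IH; apply/orP/idP => [[] /mapP[u uw [_ ->]] //|ww].
by case: b; [right|left]; apply/mapP; exists w.
Qed.

Lemma qval_Qn F q k ys : qval q (nseq k wsize) (flatten ys) F <->
  Qn q k (fun zs => eval (flatten zs) F) ys.
Proof.
elim: k q ys => [|k IH] q ys //=.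
have E y : flatten ys ++ y = flatten (rcons ys y) by rewrite flatten_rcons.
case: q => /=.
  split=> [/hasP[y]|[y [sy /IH H]]]; last by apply/hasP; exists y; rewrite ?words_size ?sy // E.
  by rewrite words_size => /eqP sy; rewrite E => /IH H; exists y.
split=> [/allP H y sy|H]; first by apply/IH; rewrite -E; apply: H; rewrite words_size sy.
by apply/allP => y; rewrite words_size E => /eqP sy; apply/IH/H.
Qed.

Lemma qvalN q ms pre f : qval q ms pre (FNot f) = ~~ qval (~~ q) ms pre f.
Proof.
elim: ms q pre => //= m ms IH [] pre /=.
  by rewrite -has_predC; apply: eq_has => x; rewrite /= IH.
by rewrite -all_predC; apply: eq_all => x; rewrite /= IH.
Qed.

Hypothesis K0 : 0 < K.

Lemma slots_onto off (w : word) : off + size w <= N -> exists2 y, size y = wsize &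
  [seq relof N y 0 v v | v <- iota off (size w)] = w.
Proof.
move=> le; exists (mkword (fun r i j => nth false w (i - off))); first exact: size_mkword.
apply: (@eq_from_nth _ false); rewrite size_map size_iota // => i li.
rewrite (nth_map 0) ?size_iota // nth_iota // relof_mkword //; try lia.
by rewrite addKn.
Qed.

(** Quantifying over a whole word amounts to quantifying over the slots read from it: by
    [slots_onto] every string of length [m] occurs there, and the other bits are never read. Surplus
    quantifiers range over nonempty sets. *)
Lemma Qn_qval ms q k f ys pre : size ms <= k -> size pre + sumn ms <= N ->
  Qn q k (fun ws => eval (pre ++ gat (fun j v => Bcl ws (size ys + j) 0 v v) 0 (size pre) ms) f) ys
  <-> qval q ms pre f.
Proof.
elim: ms q k ys pre => [|m ms IH] q k ys pre lk le.
  by rewrite /= cats0; exact: Qn_const.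
case: k lk => // k lk; rewrite /= in le.
pose bits y := [seq Bcl (rcons ys y) (size ys) 0 v v | v <- iota (size pre) m].
have bitsE y : bits y = [seq relof N y 0 v v | v <- iota (size pre) m].
  apply/eq_in_map => v; rewrite mem_iota => lv; rewrite /Bcl nth_rcons ltnn eqxx.
  have lvN : v < N by lia.
  by rewrite K0 lvN.
have sb y : size (bits y) = m by rewrite size_map size_iota.
have step y : size y = wsize ->
    Qn (~~ q) k (fun ws => eval (pre ++ gat (fun j v => Bcl ws (size ys + j) 0 v v) 0 (size pre) (m :: ms)) f)
      (rcons ys y) <-> qval (~~ q) ms (pre ++ bits y) f.
  move=> sy; rewrite -(IH _ k (rcons ys y)) //; last by rewrite size_cat sb -addnA.
  have E zs : pre ++ gat (fun j v => Bcl (rcons ys y ++ zs) (size ys + j) 0 v v) 0 (size pre) (m :: ms)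
    = (pre ++ bits y) ++ gat (fun j v => Bcl (rcons ys y ++ zs) (size (rcons ys y) + j) 0 v v) 0
        (size (pre ++ bits y)) ms.
    rewrite -catA /=; congr (_ ++ (_ ++ _)).
      by apply/eq_map => v; rewrite addn0 /bits /Bcl cat_rcons nth_cat ltnn subnn nth_rcons ltnn eqxx.
    rewrite size_cat sb size_rcons gat_shift; apply: eq_gat => j v _ _.
    by rewrite addSnnS.
  by split; apply: Qn_mono => zs _; rewrite E.
case: q step => step /=.
  split.
    case=> y [sy /step H]; apply/hasP; exists (bits y) => //; first by rewrite words_size sb.
    exact: H.
  case/hasP=> w; rewrite words_size => /eqP sw H.
  have [|y sy Ey] := @slots_onto (size pre) w; first by rewrite sw; lia.
  by exists y; split=> //; apply/step => //; rewrite bitsE -sw Ey.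
split.
  move=> H; apply/allP => w; rewrite words_size => /eqP sw.
  have [|y sy Ey] := @slots_onto (size pre) w; first by rewrite sw; lia.
  by have /step := H y sy; rewrite bitsE -sw Ey; apply.
by move=> /allP H y sy; apply/step => //; apply: H; rewrite words_size sb.
Qed.

End Words.

(** * Lexicographically first witnesses *)

Fixpoint lexb (u v : word) : bool :=
  match u, v with
  | a :: u', b :: v' => (~~ a && b) || ((a == b) && lexb u' v')
  | _, _ => false
  end.

Fixpoint lexfirst m (G : word -> bool) : word :=
  if m is m'.+1 then
    if has (fun w => G (false :: w)) (words m')
    then false :: lexfirst m' (fun w => G (false :: w))
    else true :: lexfirst m' (fun w => G (true :: w))
  else [::].

Lemma size_lexfirst m G : size (lexfirst m G) = m.
Proof. by elim: m G => //= m IH G; case: ifP => _ /=; rewrite IH. Qed.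

Lemma has_words m (G : word -> bool) : reflect (exists2 w, size w = m & G w) (has G (words m)).
Proof.
apply: (iffP hasP) => -[w]; first by rewrite words_size => /eqP; exists w.
by move=> sw Gw; exists w; rewrite // words_size sw.
Qed.

Lemma has_wordsS m (G : word -> bool) : has G (words m.+1) =
  has (fun w => G (false :: w)) (words m) || has (fun w => G (true :: w)) (words m).
Proof. by rewrite /= cats0 has_cat !has_map. Qed.

(** The left side is the form in which the checks can speak of the first witness; the equation on
    the right shows that it has at most one solution. *)
Lemma lexfirstP m (G : word -> bool) w :
  [/\ size w = m, G w & forall u, size u = m -> lexb u w -> ~~ G u] <->
  has G (words m) /\ w = lexfirst m G.
Proof.
elim: m G w => [|m IH] G w.
  split=> [[/size0nil -> H _]|[]]; first by rewrite /= H.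
  by rewrite /= orbF => H ->; split=> // -[].
rewrite has_wordsS /=; split.
  case: w => [|b w] [sw Gw H] //; case: sw => sw.
  case: b Gw H => Gw H.
    have nf : has (fun w => G (false :: w)) (words m) = false.
      apply/negbTE/negP => /has_words[u su]; apply/negP; apply: H => //=; by rewrite su.
    have [|h ->] := (IH (fun w => G (true :: w)) w).1.
      by split=> // u su lu; apply: H; rewrite /= ?su.
    by rewrite nf h.
  have [|h ->] := (IH (fun w => G (false :: w)) w).1.
    by split=> // u su lu; apply: H; rewrite /= ?su ?lu ?orbT.
  by rewrite h.
case: ifP => [h [_ ->]|nf [/= h ->]].
  have [s1 G1 H1] := (IH (fun w => G (false :: w)) _).2 (conj h erefl).
  split=> //=; first by rewrite s1.
  case=> [//|[] u] [su] //= lu; exact: H1.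
have [s1 G1 H1] := (IH (fun w => G (true :: w)) _).2 (conj h erefl).
split=> //=; first by rewrite s1.
case=> [//|[] u] [su] //= lu; first exact: H1.
by apply/negP => Gu; move/negP: nf; apply; apply/has_words; exists u.
Qed.

Lemma lexbP m u w : size u = m -> size w = m -> lexb u w <-> exists v,
  [/\ v < m, nth false w v, ~~ nth false u v & forall k, k < v -> nth false w k = nth false u k].
Proof.
elim: m u w => [|m IH] [|a u] [|b w] //=.
  by move=> _ _; split=> // -[v []].
move=> [su] [sw]; split.
  case/orP=> [/andP[na hb]|/andP[/eqP -> /(IH _ _ su sw)[v [lv h1 h2 h3]]]].
    by exists 0.
  by exists v.+1; split=> // -[|k] //; exact: h3.
case=> -[|v] [/= lv h1 h2 h3]; first by rewrite h1 h2.
apply/orP; right; rewrite [b](h3 0) // eqxx /=; apply/(IH _ _ su sw).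
by exists v; split=> // k lk; exact: (h3 k.+1).
Qed.

Definition witness (s : word) (v : nat) : bool :=
  if decode s is Some (m :: ms, f) then
    nth false (lexfirst m (fun w => qval false ms w f)) v
  else false.

(** * Correctness of the oracle answers as an alternating statement *)

Section Answers.

Variables (M : OTM) (l' K : nat) (X y0 : word).
Let l := l'.+1.
Notation N := (size X).
Notation Bc := (Bcl K X).
Notation B0 := (Bcl K X [:: y0]).
Notation wsz := (wsize K X).
Hypotheses (K2 : 2 < K) (N0 : 0 < N).

Definition checks (ys : seq word) : Prop := forall t,
  selected X (Bc ys) t -> askat M (Bc ys) t -> check_query l X (Bc ys) t.

Lemma srcb_sel B t k v : selected X B t -> ~ modeB X B ->
  srcb X B k v = if k is 0 then B 0 2 t v else B k 0 v v.
Proof.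
move=> st nm; apply/idP/idP => [/asbP|H]; last first.
  by apply/asbP; right; split=> //; case: k H => // H; exists t.
case=> [[]//|[_]]; case: k => // -[t' st']; by rewrite (selected_inj st st').
Qed.

Lemma srcb_mode B k v : modeB X B -> srcb X B k v = B k.+1 0 v v.
Proof.
by move=> m; apply/idP/idP => [/asbP[[]//|[]//]|H]; apply/asbP; left.
Qed.

(** The slots of [y] are kept, so a strategy of the later quantifiers against this word also answers
    [y] in the check of time [t] with mode [c]. *)
Definition choose t (c : bool) (y : word) := mkword K X (fun r i j =>
  if r == 1 then (i == t) && (j == t) else if r == 2 then c else relof N y r i j).

Lemma choose_selected t c y zs : t < N -> selected X (Bc [:: y0, choose t c y & zs]) t.
Proof.
move=> lt; have K1 := ltnW K2; split=> //.
  by rewrite /Bcl lt K1 /= relof_mkword //= eqxx.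
move=> u lu; have luN := ltn_trans lu lt.
by rewrite /Bcl luN K1 /= relof_mkword //= (ltn_eqF lu).
Qed.

Lemma choose_mode t c y zs : modeB X (Bc [:: y0, choose t c y & zs]) <-> c.
Proof.
split=> [[i li]|cc]; first by rewrite /Bcl li K2 /= relof_mkword.
by exists 0 => //; rewrite /Bcl N0 K2 /= relof_mkword.
Qed.

Lemma choose_slots t c y zs k v :
  Bc [:: y0, choose t c y & zs] k 0 v v = Bc [:: y0, y & zs] k 0 v v.
Proof.
rewrite /Bcl; case: (ltnP v N) => //= lv; have K1 : 0 < K by lia.
by rewrite K1 /=; case: k => [|[|k]] //=; rewrite relof_mkword.
Qed.

Section Decoded.

Variables (t m : nat) (ms : seq nat) (f : form).
Hypothesis le_sumn : m + sumn ms <= N.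
Hypothesis sz : size ms = l'.

Notation Ans := (B0 0 1 t t).
Definition wbits := [seq B0 0 2 t v | v <- iota 0 m].

Definition PA (ws : seq word) : Prop :=
  supp X B0 t m /\ eval (wbits ++ gat (fun j v => Bc ws (1 + j) 0 v v) 0 m ms) f.

Definition PB (ws : seq word) : Prop := (~ Ans \/ lexless (Bc ws) t m) ->
  ~~ eval (gat (fun j v => Bc ws (1 + j) 0 v v) 0 0 (m :: ms)) f.

Lemma gat_A zs : selected X (Bc (y0 :: zs)) t -> ~ modeB X (Bc (y0 :: zs)) ->
  gat (srcb X (Bc (y0 :: zs))) 0 0 (m :: ms) =
  wbits ++ gat (fun j v => Bc (y0 :: zs) (1 + j) 0 v v) 0 m ms.
Proof.
move=> st nm /=; congr cat; first by apply/eq_map => v; rewrite (srcb_sel _ _ st nm).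
by rewrite gat_shift; apply: eq_gat => j v _ _; rewrite (srcb_sel _ _ st nm).
Qed.

Lemma gat_B zs : modeB X (Bc (y0 :: zs)) ->
  gat (srcb X (Bc (y0 :: zs))) 0 0 (m :: ms) =
  gat (fun j v => Bc (y0 :: zs) (1 + j) 0 v v) 0 0 (m :: ms).
Proof. by move=> md; apply: eq_gat => j v _ _; rewrite srcb_mode. Qed.

Lemma size_wbits : size wbits = m. Proof. by rewrite size_map size_iota. Qed.

(** The witness fills the first block of the query, so the bits of only [l'] of the [l] quantified
    words are read. *)
Lemma Qn_PA : Qn K X false l PA [:: y0] <-> supp X B0 t m /\ qval false ms wbits f.
Proof.
have K1 : 0 < K by lia.
have := @Qn_qval K X K1 ms false l f [:: y0] wbits.
rewrite size_wbits sz => /(_ (leqnSn _) le_sumn) <-.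
split=> [H|[H1 H2]]; last by apply: Qn_mono H2 => zs _ H2; split.
split; first by have [zs _ []] := Qn_ex H.
by apply: Qn_mono H => zs _ [].
Qed.

Lemma nth_wbits v : v < m -> nth false wbits v = B0 0 2 t v.
Proof. by move=> lv; rewrite (nth_map 0) ?size_iota // nth_iota. Qed.

(** Block 1 carries the candidate. There remain [l'] quantifiers, starting with an existential one,
    which is the prefix of the negated query by [qvalN]. *)
Lemma Qn_PB : Qn K X false l PB [:: y0] <->
  forall w, size w = m -> ~ Ans \/ lexb w wbits -> ~~ qval false ms w f.
Proof.
have K1 : 0 < K by lia.
pose bits y := [seq Bc [:: y0; y] 1 0 v v | v <- iota 0 m].
have sb y : size (bits y) = m by rewrite size_map size_iota.
have nb y v : v < m -> nth false (bits y) v = Bc [:: y0; y] 1 0 v v.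
  by move=> lv; rewrite (nth_map 0) ?size_iota // nth_iota.
have L y zs : lexless (Bc [:: y0, y & zs]) t m <-> lexb (bits y) wbits.
  rewrite (lexbP (sb y) size_wbits); split=> -[v [lv h1 h2 h3]]; exists v; split=> //.
  - by rewrite nth_wbits.
  - by rewrite nb.
  - by move=> k lk; rewrite nth_wbits ?nb ?(ltn_trans lk lv) //; exact: h3.
  - by move: h1; rewrite nth_wbits.
  - by rewrite nb in h2.
  - move=> k lk; have := h3 k lk; rewrite nth_wbits ?nb ?(ltn_trans lk lv) //.
have step y : Qn K X true l' PB [:: y0; y] <->
    (~ Ans \/ lexb (bits y) wbits -> ~~ qval false ms (bits y) f).
  have := @Qn_qval K X K1 ms true l' (FNot f) [:: y0; y] (bits y).
  rewrite sb sz => /(_ (leqnn _) le_sumn); rewrite qvalN => <-.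
  have E zs : gat (fun j v => Bc [:: y0, y & zs] (1 + j) 0 v v) 0 0 (m :: ms) =
      bits y ++ gat (fun j v => Bc [:: y0, y & zs] (2 + j) 0 v v) 0 m ms.
    by rewrite /= gat_shift.
  split=> [H c|H].
    by apply: Qn_mono H => zs _; rewrite /PB E => H; apply: H; rewrite (L y zs).
  (* The premise of [PB] depends on the two words fixed so far, so it can be decided before the
     later quantifiers. *)
  case: (classic (~ Ans \/ lexb (bits y) wbits)) => [c|nc].
    by apply: Qn_mono (H c) => zs _ /= {}H _; rewrite -[gat _ _ _ _]/(gat _ 0 0 (m :: ms)) E.
  by apply: Qn_triv => zs _ c; case: nc; rewrite -(L y zs).
split.
  move=> H w sw; have [|y sy Ey] := @slots_onto K X K1 0 w; first by lia.
  have := (step y).1 (H y sy); suff -> : bits y = w by [].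
  rewrite -Ey sw; apply/eq_in_map => v; rewrite mem_iota => lv.
  have lvN : v < N by lia.
  by rewrite /Bcl K1 lvN.
by move=> H y sy; apply/(step y)/H; rewrite sb.
Qed.

End Decoded.

Definition check_time t : Prop :=
  match decode (strof X B0 t) with
  | Some (m :: ms, f) =>
      if size ms == l' then (B0 0 1 t t -> Qn K X false l (PA t m ms f) [:: y0]) /\
                            Qn K X false l (PB t m ms f) [:: y0]
      else ~ B0 0 1 t t
  | _ => ~ B0 0 1 t t
  end.

(** The first universal word selects at most one time and one mode, so the joint condition splits
    into separate games, one per query and mode. Conversely the strategy of the selected game is
    played, and an arbitrary one if there is nothing to check. *)
Lemma Qn_checks : Qn K X false l checks [:: y0] <->
  forall t, t < N -> askat M B0 t -> check_time t.
Proof.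
have bad t : t < N -> askat M B0 t -> Qn K X false l checks [:: y0] ->
    (forall zs, check_query l X (Bc (y0 :: zs)) t -> ~ B0 0 1 t t) -> ~ B0 0 1 t t.
  move=> lt at_ H Hb; have /Qn_ex[zs _ C] := H (choose t false [::]) (size_mkword _ _ _).
  by apply: (Hb (choose t false [::] :: zs)); apply: C => //; exact: choose_selected.
split=> [H t lt at_|H].
  rewrite /check_time; case ds: (decode _) => [[[|m ms] f]|].
  (* [strof] reads block 0 only, so the further blocks disappear by conversion. *)
  - by apply: (bad t) => // zs; rewrite /check_query -[strof X _ _]/(strof X B0 t) ds.
  - have szl : (size (m :: ms) == l) = (size ms == l') by [].
    case: (size ms =P l') szl => sz szl; last first.
      by apply: (bad t) => // zs; rewrite /check_query -[strof X _ _]/(strof X B0 t) ds szl.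
    split=> [an y sy|y sy].
      apply: Qn_mono (H (choose t false y) (size_mkword _ _ _)) => zs _ C.
      have st := choose_selected false y zs lt.
      have nm : ~ modeB X (Bc [:: y0, choose t false y & zs]) by move/choose_mode.
      have := C t st at_; rewrite /check_query -[strof X _ _]/(strof X B0 t) ds szl.
      case=> /(_ nm an)[h1 h2] _; split=> //; move: h2; rewrite (gat_A _ _ st nm).
      by congr (is_true (eval (_ ++ _) _)); apply: eq_gat => j v _ _; exact: choose_slots.
    apply: Qn_mono (H (choose t true y) (size_mkword _ _ _)) => zs _ C.
    have st := choose_selected true y zs lt.
    have md : modeB X (Bc [:: y0, choose t true y & zs]) by apply/choose_mode.
    have := C t st at_; rewrite /check_query -[strof X _ _]/(strof X B0 t) ds szl.
    case=> _ /(_ md) h c; move: h; rewrite (gat_B _ _ md).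
    rewrite (@eq_gat _ (fun j v => Bc [:: y0, y & zs] (1 + j) 0 v v)); last first.
      by move=> j v _ _; exact: choose_slots.
    apply; case: c => [na|[v [lv h1 h2 h3]]]; [by left|right].
    exists v; split=> //; first by rewrite choose_slots.
    by move=> u lu; rewrite choose_slots; exact: h3.
  - by apply: (bad t) => // zs; rewrite /check_query -[strof X _ _]/(strof X B0 t) ds.
move=> y sy.
case: (classic (exists2 t, selected X (Bc [:: y0; y]) t & askat M B0 t)) => [[t st at_]|no]; last first.
  by apply: Qn_triv => zs _ t st at_; case: no; exists t.
have lt : t < N by case: st.
have triv (P : Prop) q : (forall zs, P -> check_query l X (Bc [:: y0, y & zs]) t) -> P ->
    Qn K X q l' checks [:: y0; y].
  move=> HP p; apply: Qn_triv => zs _ t' st' _; rewrite -(selected_inj st st'); exact: HP.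
have := H t lt at_; rewrite /check_time; case ds: (decode _) => [[[|m ms] f]|].
- by apply: triv => zs; rewrite /check_query -[strof X _ _]/(strof X B0 t) ds.
- have szl : (size (m :: ms) == l) = (size ms == l') by [].
  case: (size ms =P l') szl => sz szl; last first.
    by apply: triv => zs; rewrite /check_query -[strof X _ _]/(strof X B0 t) ds szl.
  case=> HA HB.
  have Hm (P : seq word -> Prop) : Qn K X false l P [:: y0] ->
     (forall zs, P [:: y0, y & zs] -> check_query l X (Bc [:: y0, y & zs]) t) ->
     Qn K X true l' checks [:: y0; y].
    move=> HP HC; apply: Qn_mono (HP y sy) => zs _ Pz t' st' _.
    by rewrite -(selected_inj st st'); exact: HC.
  case: (classic (modeB X (Bc [:: y0; y]))) => [md|nm].
    apply: (Hm _ HB) => zs h.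
    rewrite /check_query -[strof X _ _]/(strof X B0 t) ds szl; split=> // _ c.
    by rewrite (@gat_B _ _ (y :: zs)) //; apply: h.
  case an: (B0 0 1 t t).
    apply: (Hm _ (HA an)) => zs [h1 h2].
    rewrite /check_query -[strof X _ _]/(strof X B0 t) ds szl; split=> // _ _.
    by rewrite (@gat_A t _ _ (y :: zs)).
  apply: (@triv True) => // zs _.
  rewrite /check_query -[strof X _ _]/(strof X B0 t) ds szl; split=> // _.
  by rewrite -[Bc _ 0 1 t t]/(B0 0 1 t t) an.
- by apply: triv => zs; rewrite /check_query -[strof X _ _]/(strof X B0 t) ds.
Qed.

(** For a positive answer, minimality gives [lexfirst] on the first block, and [supp] gives zeros
    beyond it, where [nth] in [witness] falls back to false as well. *)
Lemma check_time_answers t : t < N -> check_time t <->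
  B0 0 1 t t = SAT l (strof X B0 t) /\
  (B0 0 1 t t -> forall v, v < N -> B0 0 2 t v = witness (strof X B0 t) v).
Proof.
move=> lt; have sN : size (strof X B0 t) < N.
  by apply: leq_ltn_trans (size_takeSome _) _; rewrite size_map size_iota; lia.
rewrite /check_time /SAT /witness.
case ds: (decode _) => [[[|m ms] f]|]; rewrite ?andbF.
- by rewrite /=; case: (B0 0 1 t t); split=> // -[].
- have szl : (size (m :: ms) == l) = (size ms == l') by [].
  case: (size ms =P l') szl => sz ->; last first.
    by rewrite /=; case: (B0 0 1 t t); split=> // -[].
  have le_sumn : m + sumn ms <= N.
    move: ds => /decodeP[E _ _]; apply: ltnW; apply: leq_ltn_trans sN.
    by rewrite E size_cat size_enc_blocks_eq /=; lia.
  rewrite (Qn_PA t f le_sumn sz) (Qn_PB t f le_sumn sz) andTb.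
  set G := fun w => qval false ms w f; set Ans := B0 0 1 t t.
  have -> : qval true (m :: ms) [::] f = has G (words m) by [].
  rewrite -[qval false ms (wbits t m) f]/(G (wbits t m)).
  have sw := size_wbits t m.
  split=> [[H1 H2]|[H1 H2]].
    case an: Ans H1 H2 => H1 H2.
      have [s1 s2] := H1 isT.
      have [|h E] := (lexfirstP m G (wbits t m)).1.
        by split=> // u su lu; apply: H2 => //; right.
      split=> [|_ v lv]; first by rewrite h.
      rewrite -E; case: (ltnP v m) => lvm; first by rewrite nth_wbits.
      rewrite nth_default ?sw //; apply/negP => /(s1 _ lv); by rewrite ltnNge lvm.
    split=> //; apply/esym/negbTE/negP => /has_words[w sw' Gw].
    by have /negP := H2 w sw' (or_introl (fun H => notF H)); apply.
  split=> [an|w sw' c].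
    have h : has G (words m) by rewrite -H1.
    have E : wbits t m = lexfirst m G.
      apply: (@eq_from_nth _ false); rewrite ?sw ?size_lexfirst // => v lv.
      by rewrite nth_wbits // H2 //; lia.
    have [_ G1 _] := (lexfirstP m G _).2 (conj h erefl).
    split; last by rewrite E.
    move=> v lv; rewrite (H2 an v lv) => nv; rewrite ltnNge; apply/negP => le.
    by rewrite nth_default ?size_lexfirst in nv.
  case an: Ans H1 c H2 => H1 c H2.
    have E : wbits t m = lexfirst m G.
      apply: (@eq_from_nth _ false); rewrite ?sw ?size_lexfirst // => v lv.
      by rewrite nth_wbits // H2 //; lia.
    have [_ _ H3] := (lexfirstP m G _).2 (conj (esym H1) E).
    by case: c => // lu; exact: H3.
  by apply/negP => Gw; move/esym/negbT/negP: H1; apply; apply/has_words; exists w.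
- by case: (B0 0 1 t t); split=> // -[].
Qed.

End Answers.

(** * The reduction *)

Lemma fsem_ext K d n L X (A A' : rels) e f : owf K d n L f -> envok X L e ->
  (forall i, i \in L -> e i < size X) ->
  (forall b r i j, b < n -> r < K -> i < size X -> j < size X -> A b r i j = A' b r i j) ->
  fsem X A e f <-> fsem X A' e f.
Proof.
move=> w ok lv H; elim: f L e w ok lv => [b|bl r i j|i c b|f IH|f IHf h IHh|f IHf h IHh|f IHf h IHh|i j f IH|i j f IH] L e //=.
- by case/and4P=> lb lr iL jL ok lv; rewrite H //; exact: lv.
- by move=> w ok lv; rewrite (IH L e).
1-3: by case/andP=> w1 w2 ok lv; rewrite (IHf L e) // (IHh L e).
- case/and5P=> i2 id jd ij /andP[iL w] ok lv; have [lej _] := ok j.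
  have E a : a < e j -> fsem X A (fupd e i a) f <-> fsem X A' (fupd e i a) f.
    move=> la; have laN := leq_trans la lej.
    apply: (IH (i :: L)) => //; first by apply: envok_upd => //; exact: ltnW.
    by move=> k; rewrite inE /fupd; case: (k =P i) => //= _ /lv.
  by split=> -[a [la /(E a la)]]; exists a.
- case/and5P=> i2 id jd ij /andP[iL w] ok lv; have [lej _] := ok j.
  have E a : a < e j -> fsem X A (fupd e i a) f <-> fsem X A' (fupd e i a) f.
    move=> la; have laN := leq_trans la lej.
    apply: (IH (i :: L)) => //; first by apply: envok_upd => //; exact: ltnW.
    by move=> k; rewrite inE /fupd; case: (k =P i) => //= _ /lv.
  by split=> Ha a la; apply/(E a la); exact: Ha.
Qed.

Section Sentence.

Variables (M : OTM) (l' : nat).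
Let l := l'.+1.
Notation Q := (state M).

(** Block 0 uses [11 + #|Q|] relations and the gates end at relation [12 + l], so [11 + l'.+3] are
    enough for the gate block. The sum bounds both, and block 0 pins its surplus. *)
Definition nrel := 11 + #|Q| + l'.+3.

Definition RunF := OA (InitF M) (OA (StepF M) (OA (PinF M (iota (11 + #|Q|) l'.+3))
  (OA (NonAskF M) (HaltF M)))).

(* The block of the gates is the last one, so that fixing their values amounts to
   an implication or a conjunction according to its quantifier. *)
Definition GateF :=
  if odd l then OI (ConsF l) (CheckF l (AskAt M)) else OA (ConsF l) (CheckF l (AskAt M)).

Definition Sentence := EX 3 (OA (Zero 3) (OA RunF
  GateF)).

Variable X : word.
Notation N := (size X).
Notation Bc := (Bcl nrel X).
Notation wsz := (wsize nrel X).
Hypothesis N0 : 0 < N.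

Definition gates_ok ws := exists2 s, selstr X (Bc ws) s & consP l X (Bc ws) s.

Lemma selstr_ex (B : rels) : exists s, selstr X B s.
Proof.
case: (classic (exists t, selected X B t)) => [[t st]|no]; first by exists (strof X B t); left; exists t.
by exists [::]; right; split=> // t st; apply: no; exists t.
Qed.

Definition gates_and_checks ws :=
  if odd l then gates_ok ws -> checks M l' nrel X ws else gates_ok ws /\ checks M l' nrel X ws.

Lemma fs_sentence ws : fsem X (Bc ws) (fun=> N) Sentence <->
  phi0 M X l'.+3 (Bc ws) /\ gates_and_checks ws.
Proof.
pose e := fupd (fun=> N) 3 0.
have e2 : e 2 = N by []. have e3 : e 3 = 0 by [].
have -> : fsem X (Bc ws) (fun=> N) Sentence <-> fsem X (Bc ws) e RunF /\ fsem X (Bc ws) e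
   GateF.
  rewrite -[fsem _ _ _ Sentence]/(exists a, a < N /\ (fsem X (Bc ws) (fupd (fun=> N) 3 a) (Zero 3) /\
    (fsem X (Bc ws) (fupd (fun=> N) 3 a) RunF /\ fsem X (Bc ws) (fupd (fun=> N) 3 a)
   GateF))).
  split=> [[a [la [/fs_zero E H]]]|H]; first by have E' : a = 0 := E; rewrite E' in H.
  by exists 0; split=> //; split=> //; apply/fs_zero.
rewrite -[fsem _ _ e RunF]/(fsem X (Bc ws) e (InitF M) /\ (fsem X (Bc ws) e (StepF M) /\
  (fsem X (Bc ws) e (PinF M (iota (11 + #|Q|) l'.+3)) /\ (fsem X (Bc ws) e (NonAskF M) /\ fsem X (Bc ws) e (HaltF M))))).
rewrite fs_initf // fs_stepf // fs_pinf // fs_nonaskf // fs_haltf //.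
have C : fsem X (Bc ws) e (ConsF l) <-> gates_ok ws.
  split=> [H|[s Hs H]]; last by apply/(@fs_consf l X (Bc ws) e s).
  by have [s Hs] := selstr_ex (Bc ws); exists s => //; apply/(@fs_consf l X (Bc ws) e s).
have D : gates_ok ws -> fsem X (Bc ws) e (CheckF l (AskAt M)) <-> checks M l' nrel X ws.
  case=> s Hs H; apply: (fs_checkf e2 e3 N0 (ltn0Sn l') Hs H) => e' e2' e3'; exact: fs_askat.
have G : fsem X (Bc ws) e GateF
    <-> gates_and_checks ws.
  rewrite /gates_and_checks /GateF; case: (odd l).
    rewrite -[fsem _ _ _ (OI _ _)]/(fsem X (Bc ws) e (ConsF l) -> fsem X (Bc ws) e (CheckF l (AskAt M))).
    by rewrite C; split=> H c; apply/(D c)/H.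
  rewrite -[fsem _ _ _ (OA _ _)]/(fsem X (Bc ws) e (ConsF l) /\ fsem X (Bc ws) e (CheckF l (AskAt M))).
  by rewrite C; split=> -[c H]; split=> //; apply/(D c).
rewrite G; split=> [[[H1 [H2 [H3 [H4 H5]]]] H6]|[[H1 H2 H3 H4 H5] H6]] //.
Qed.

Lemma checks_core ws ws' : core (Bc ws) = core (Bc ws') -> checks M l' nrel X ws -> checks M l' nrel X ws'.
Proof.
move=> E; have C ws0 : checks M l' nrel X ws0 = forall t, selected X (core (Bc ws0)) t ->
    askat M (core (Bc ws0)) t -> check_query l X (core (Bc ws0)) t by [].
by rewrite !C E.
Qed.

(** The checks read only the core of the relations, and every core extends to a last word with
    consistent gates. An existential last quantifier can supply this word, and a universal one can
    be instantiated with it. *)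
Lemma Qn_gates y : Qn nrel X false l gates_and_checks [:: y] <-> Qn nrel X false l (checks M l' nrel X) [:: y].
Proof.
have fix_gates ys y' : size ys = l -> exists y'', [/\ size y'' = wsz,
    core (Bc (rcons ys y'')) = core (Bc (rcons ys y')) & gates_ok (rcons ys y'')].
  move=> sz; have [s Hs] := selstr_ex (Bc (rcons ys y')).
  pose g := gateval l X (Bc (rcons ys y')) s.
  exists (mkword nrel X (fun r i j => if r < 3 then relof N y' r i j else g r i j)).
  have E := @core_gates nrel X l ys y' g (ltn0Sn l') sz.
  split=> //; first exact: size_mkword.
  exists s; first by rewrite -selstr_core E.
  have sN : size s < N.
    case: Hs => [[t _ ->]|[_ ->]] //.
    by apply: leq_ltn_trans (size_takeSome _) _; rewrite size_map size_iota; lia.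
  apply: gates_consP sN E _ => r i j /andP[r3 lr] li lj.
  have lK : r < nrel by rewrite /nrel; lia.
  by rewrite /Bcl li lj lK /= nth_rcons sz ltnn eqxx relof_mkword // ltnNge r3.
rewrite /l; split; apply: Qn_last => zs [sz _] /=; have szl : size (y :: zs) = l by rewrite /= sz.
  rewrite /gates_and_checks /l /=; case: (odd l') => /=.
    by case=> y' [sy [c H]]; exists y'.
  move=> H y' sy; have [y'' [sy'' E c]] := fix_gates (y :: zs) y' szl.
  exact: checks_core E (H y'' sy'' c).
rewrite /gates_and_checks /l /=; case: (odd l') => /=.
  case=> y' [sy H]; have [y'' [sy'' E c]] := fix_gates (y :: zs) y' szl.
  by exists y''; split=> //; split=> //; apply: checks_core (esym E) H.
by move=> H y' sy _; exact: H.
Qed.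

Hypothesis wfS : owf nrel 20 l'.+2 [::] Sentence.

Lemma qval_sentence y : size y = wsz ->
  qval false (nseq l wsz) y (expand nrel X (fun=> N) Sentence) <->
  phi0 M X l'.+3 (Bc [:: y]) /\ answers_ok M (SAT l) witness X (Bc [:: y]).
Proof.
move=> sy; have := @qval_Qn nrel X (expand nrel X (fun=> N) Sentence) false l [:: y].
rewrite [flatten [:: y]]/= cats0 => ->.
have E zs : wordseq nrel X l zs ->
   (eval (flatten (y :: zs)) (expand nrel X (fun=> N) Sentence) <->
    phi0 M X l'.+3 (Bc [:: y]) /\ gates_and_checks (y :: zs)).
  move=> [sz az]; rewrite eval_expand.
  rewrite (@fsem_ext nrel 20 l'.+2 [::] X _ (Bc (y :: zs)) _ _ wfS (envok_init X)) //.
    exact: fs_sentence.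
  by move=> b r i j lb lr li lj; rewrite Bcl_relof //= ?sz // sy eqxx.
have A : (forall t, t < N -> askat M (Bc [:: y]) t -> check_time l' nrel X y t) <->
    answers_ok M (SAT l) witness X (Bc [:: y]).
  split=> H t lt at_; first by apply/(@check_time_answers l' nrel X y _ N0 t lt); [|exact: H].
  by apply/(@check_time_answers l' nrel X y _ N0 t lt); [|exact: H].
rewrite -A -(@Qn_checks M l' nrel X y _ N0) //.
(* [phi0] reads block 0 only, so it moves out of the quantifiers over the other blocks. *)
split=> [H|[p H]].
  have [zs wz /(E zs wz)[p _]] := Qn_ex H; split=> //.
  by apply/Qn_gates; apply: Qn_mono H => zs' wz' /(E zs' wz')[].
by apply: Qn_mono ((Qn_gates y).2 H) => zs wz G; apply/(E zs wz).
Qed.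

End Sentence.

(* Well-formedness of the sentence, largely by evaluation of its abbreviations *)
Transparent IFF LIT BALL BEX Shift Zero Lt Cell New TapeC TapeBlank EXs.

Section WellFormed.

Variables (K d n : nat).
Notation wf := (owf K d n).

Lemma owf_ball (T : eqType) L (s : seq T) F : (forall x, x \in s -> wf L (F x)) -> wf L (BALL s F).
Proof.
elim: s => //= x s IH H; rewrite H ?mem_head //=; apply: IH => y ys.
by apply: H; rewrite inE ys orbT.
Qed.

Lemma owf_bex (T : eqType) L (s : seq T) F : (forall x, x \in s -> wf L (F x)) -> wf L (BEX s F).
Proof.
elim: s => //= x s IH H; rewrite H ?mem_head //=; apply: IH => y ys.
by apply: H; rewrite inE ys orbT.
Qed.

Lemma owf_iff L f g : wf L f -> wf L g -> wf L (IFF f g).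
Proof. by rewrite /= => -> ->. Qed.

Lemma owf_and L f g : wf L f -> wf L g -> wf L (OA f g).
Proof. by rewrite /= => -> ->. Qed.

Lemma owf_imp L f g : wf L f -> wf L g -> wf L (OI f g).
Proof. by rewrite /= => -> ->. Qed.

End WellFormed.

Section SentenceWf.

Variables (M : OTM) (l' : nat).
Notation Q := (state M).
Notation K := (nrel M l').
Notation wf := (owf K 20 l'.+2).

Lemma rs_lt (q : Q) : rs q < K.
Proof. by rewrite /rs /nrel -addnA ltn_add2l; apply: ltn_addr; exact: ltn_ord. Qed.

Lemma owf_state L tv (q : Q) : tv \in L -> wf L (StateIs tv q).
Proof. by move=> tL; apply: owf_ball => q' _; case: (q' == q); rewrite /= rs_lt tL. Qed.

Lemma owf_act L p : 3 \in L -> 4 \in L -> wf L (@ACT M p).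
Proof.
by move=> H3 H4; case: p => [[q [[]|]] [[]|]]; rewrite /= rs_lt H3 H4.
Qed.

Lemma owf_tapec tau a b : wf [:: 5; 4; 3] (TapeC tau a b).
Proof. by case: tau; case: b. Qed.

Lemma owf_row p : wf [:: 5; 4; 3] (@Row M p).
Proof.
case: p => [[q a] b]; rewrite /Row; case: delta => [q' w1 w2 d1 d2|qy qn|c].
- by apply: owf_and; [exact: owf_state|apply: owf_and; exact: owf_tapec].
- apply: owf_and; last by apply: owf_and; [exact: owf_tapec|].
  by apply: owf_and; apply: owf_imp; rewrite ?owf_state.
- by apply: owf_and; [exact: owf_state|apply: owf_and; exact: owf_tapec].
Qed.

Lemma owf_askat L : 3 \in L -> 4 \in L -> wf L (AskAt M).
Proof. by move=> H3 H4; apply: owf_bex => p _; exact: owf_act. Qed.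

Lemma owf_runf : wf [:: 3] (RunF M l').
Proof.
apply: owf_and; first by apply: owf_and; [exact: owf_state|].
apply: owf_and; first by rewrite /=; apply: owf_ball => p _; apply: owf_imp; [exact: owf_act|exact: owf_row].
apply: owf_and.
  suff : wf [:: 5; 4; 3] (OA (BALL (enum Q) (fun q => OI (OR 0 (rs q) 4 5) (Shift 0 4 5)))
      (BALL (iota (11 + #|Q|) l'.+3) (fun r => ON (OR 0 r 4 5)))) by [].
  apply: owf_and; first by apply: owf_ball => q _; rewrite /= rs_lt.
  by apply: owf_ball => r; rewrite mem_iota => /andP[_ lr] /=; rewrite /nrel lr.
apply: owf_and; first by rewrite /= !owf_askat.
rewrite /= !andbT; apply/andP; split;
  by apply: owf_bex => p _; apply: owf_and; [exact: owf_act|].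
Qed.

Notation l := l'.+1.

Lemma gate_lt r : r < l'.+2 -> 12 + r < K.
Proof. by move=> lr; rewrite /nrel; lia. Qed.

Lemma run_gate_lt : 11 < K.
Proof. by rewrite /nrel; lia. Qed.

Lemma owf_bg L j i : j <= l -> i \in L -> wf L (Bg l j i).
Proof. by move=> lj iL; rewrite /= iL ltnSn gate_lt. Qed.

Lemma owf_consf : wf [:: 3] (ConsF l).
Proof.
do 2!(apply: owf_and; first by rewrite /= ltnSn ?run_gate_lt).
apply: owf_and.
  apply: owf_ball => j; rewrite mem_iota add0n ltnS => /andP[_ lj].
  suff : wf [:: 6; 3] (IFF (Bg l j 6) (if j is j'.+1 then
     EX 7 (OA (Bg l j' 7) (EXs (2 * j') 7 8 (OA (Sg l true 8) (EXs 1 8 9 (OA (Sg l true 9)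
       (EXs (2 * j').+2 6 10 (Ug l 9 10))))))) else Zero 6)) by [].
  apply: owf_iff; first exact: owf_bg.
  case: j lj => // j lj.
  have /= g1 : 12 + j < K by apply: gate_lt; lia.
  by rewrite /= ltnSn run_gate_lt g1.
apply: owf_and.
  suff : forall b, wf [:: 6; 3] (IFF (Ag l b 6) (BEX (iota 0 l) (fun k => OA (In l k) (LIT b (Src k))))).
    move=> H; suff : wf [:: 6; 3] (BALL bools (fun b => IFF (Ag l b 6)
        (BEX (iota 0 l) (fun k => OA (In l k) (LIT b (Src k)))))) by [].
    by apply: owf_ball => b _; exact: H.
  move=> b; apply: owf_iff; first by case: b; rewrite /= ltnSn ?run_gate_lt.
  apply: owf_bex => k; rewrite mem_iota add0n => /andP[_ lk].
  apply: owf_and.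
    have W j : j <= l -> wf [:: 8; 7; 6; 3] (Bg l j 7) && wf [:: 8; 7; 6; 3] (Bg l j 8).
      by move=> lj; rewrite !owf_bg.
    have /andP[W1 _] := W k (ltnW lk); have /andP[_ W2] := W k.+1 lk.
    suff : wf [:: 8; 7; 6; 3] (OA (Bg l k 7) (OA (Bg l k.+1 8) (OA (ON (Lt 6 7)) (Lt 6 8)))) by [].
    by apply: owf_and => //; apply: owf_and.
  have W : wf [:: 6; 3] (Src k).
    by rewrite /= ltnS lk /=; case: k lk => //= k lk; rewrite ltnS (ltnW lk).
  by case: b.
apply: owf_and.
  suff : forall b, wf [:: 7; 6; 3] (IFF (Vg l b 6 7)
    (OO (OA (Sg l false 6) (Ag l b 7)) (OA (Sg l true 6) (EXs 1 6 8 (EXs 1 7 9 (Vg l b 8 9)))))).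
    by move=> H; move: (H true) (H false) => W1 W2; apply: owf_ball => -[].
  by case; rewrite /= ltnSn ?run_gate_lt.
suff : forall b, wf [:: 11; 10; 9; 8; 7; 6; 3] (BEX (combos b) (fun p =>
         OA (Sg l p.1.1 9) (OA (Eg l p.1.2 10 11) (Eg l p.2 11 7)))).
  move=> H; apply: owf_ball => b _; move: (H b) => {H} W.
  by case: b W => /= ->; rewrite ltnSn ?run_gate_lt.
by move=> b; apply: owf_bex => -[[c b1] b2] _; case: c; case: b1; case: b2; rewrite /= ltnSn ?run_gate_lt.
Qed.

Lemma owf_value b : wf [:: 4; 3] (Value l b).
Proof.
have /= g1 : 12 + l < K by apply: gate_lt.
by case: b; rewrite /= ltnSn g1.
Qed.

Lemma owf_checkf : wf [:: 3] (CheckF l (AskAt M)).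
Proof.
suff : wf [:: 4; 3] (OA (OA Sel (AskAt M)) (CheckBody l)) by [].
have [W1 W2] := (owf_value true, owf_value false).
have O : wf [:: 4; 3] (OO (Value l true) (Value l false)) by apply/andP; split.
apply: owf_and; first by apply: owf_and; [|exact: owf_askat].
apply: owf_and; first exact: owf_imp.
have g13 : 13 < K by exact: (@gate_lt 1).
apply: owf_imp => //; apply: owf_and; apply: owf_imp => //.
  by apply: owf_and => //; rewrite /= ltnSn g13.
by rewrite /= ltnSn g13.
Qed.

Lemma owf_sentence : wf [::] (Sentence M l').
Proof.
suff : wf [:: 3] (OA (RunF M l') (GateF M l')) by [].
have [W1 W2] := (owf_consf, owf_checkf).
by apply: owf_and; [exact: owf_runf|rewrite /GateF; case: ifP => _; [exact: owf_imp|exact: owf_and]].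
Qed.

End SentenceWf.

(** * The length of the padding and the final reduction *)

Lemma initcell_pad k c x i : initcell (pad k c x) false true i = nth None (map Some x) i.
Proof.
rewrite /initcell /= /pad.
have -> : has (nth false (x ++ true :: nseq (c * size x ^ k + c) false))
    (iota i.+1 (size (x ++ true :: nseq (c * size x ^ k + c) false) - i.+1)) = (i < size x).
  apply/hasP/idP => [[p]|li].
    rewrite mem_iota => /andP[lp _]; apply: contraTT; rewrite -leqNgt => le.
    rewrite nth_cat ltnNge (leq_trans le (ltnW lp)) /=.
    have -> : p - size x = (p - size x).-1.+1 by lia.
    by rewrite /= nth_nseq if_same.
  exists (size x); first by rewrite mem_iota size_cat /=; lia.
  by rewrite nth_cat ltnn subnn.
case: ltnP => li; first by rewrite (nth_map false) // nth_cat li.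
by rewrite nth_default // size_map.
Qed.

Lemma cext_init M x : cext (init M x) <= size x.
Proof. by case: x => [|b x]; rewrite /cext /ext //= size_map; lia. Qed.

(** Each step reaches at most one new cell per tape, hence the factor 2; after halting nothing
    changes. *)
Lemma cext_bound M O x T th b : th <= T -> halted (run O th (init M x)) = Some b ->
  forall t, cext (run O t (init M x)) <= size x + 2 * T.
Proof.
move=> le h t; have i := cext_init M x.
case: (leqP t th) => lt.
  by apply: leq_trans (cext_run _ _ _) _; lia.
have -> : run O t (init M x) = run O th (init M x).
  by rewrite -(subnK (ltnW lt)) /run iterD; exact: run_halted h.
by apply: leq_trans (cext_run _ _ _) _; lia.
Qed.

Lemma filter_words_unique m (P : pred word) (y : word) : size y = m ->
  (forall z, size z = m -> P z = (z == y)) -> [seq z <- words m | P z] = [:: y].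
Proof.
move=> sy H; have un : uniq (words m).
  elim: (m) => //= m' IH; rewrite cats0 cat_uniq !map_inj_uniq ?IH //= ?andbT.
  - by apply/hasPn => w /mapP[u _ ->]; apply/negP => /mapP[].
  - by move=> u v [].
  - by move=> u v [].
have -> : [seq z <- words m | P z] = [seq z <- words m | pred1 y z].
  by apply: eq_in_filter => z; rewrite words_size => /eqP sz; rewrite H.
by rewrite filter_pred1_uniq // words_size sy.
Qed.

Theorem theorem7 (n : nat) (hn : 2 <= n) (phi1 : pprob) :
  Deltahat n phi1 -> red_class (UVAL n) phi1.
Proof.
case: n hn => [|[|l']] // _ [M [k H]].
(* [2 * k] pays for the two tapes over [poly_bound k (size x)] steps, and 5 for the few spare cells
   demanded by [ext_ok]. *)
set l := l'.+1; set c := 2 * k + 5; set K := nrel M l'.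
pose X x := pad k c x.
exists (fun x => enc_inst (nseq l'.+2 (K * (size (X x) * size (X x))))
  (expand K (X x) (fun=> size (X x)) (Sentence M l'))).
have wf := owf_sentence M l'.
split; first exact: (fo_poly_computable k c (isT : 2 < 20) wf).
move=> x.
have [th [b [lth hb Pb]]] := all_halt_run (H x).
set N := size (X x).
have NE : N = size x + (c * size x ^ k + c).+1 by rewrite /N size_cat /= size_nseq.
have TE : size x + 2 * poly_bound k (size x) + 2 <= N.
  rewrite NE /poly_bound /c; lia.
have ext_ok t : (cext (run (SAT l) t (init M x))).+1 < N.
  by apply: leq_trans TE; rewrite addn2 !ltnS; exact: cext_bound lth hb t.
have N0 : 0 < N by lia.
have halt_ok : exists2 t, t < N & halted (run (SAT l) t (init M x)) = Some b.
  by exists th => //; lia.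
have init_ok i : i < N -> initcell (X x) false true i = nth None (map Some x) i.
  by move=> _; exact: initcell_pad.
pose Y := mkword K (X x) (@truth M (SAT l) witness b x).
have sY : size Y = wsize K (X x) by exact: size_mkword.
have Bz z r i j : r < K -> i < N -> j < N -> Bcl K (X x) [:: z] 0 r i j = relof N z r i j.
  by move=> lr li lj; rewrite /Bcl lr li lj.
have KE : K = 11 + #|state M| + l'.+3 by [].
have key z : size z = wsize K (X x) ->
    qval false (nseq l (wsize K (X x))) z (expand K (X x) (fun=> N) (Sentence M l')) = (z == Y).
  move=> sz; apply/idP/eqP.
    case/(qval_sentence N0 wf sz) => p a.
    have T := phi0_truth init_ok ext_ok halt_ok p a.
    apply: (word_ext sz sY) => r i j lr li lj.
    by rewrite relof_mkword // -Bz // T.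
  move=> ->; apply/(qval_sentence N0 wf sY).
  apply: (truth_phi0 init_ok ext_ok halt_ok) => r i j lr li lj.
  by rewrite Bz // relof_mkword.
have K0 : 0 < K by rewrite KE.
have w0 : 0 < wsize K (X x) by rewrite /wsize !muln_gt0 K0 N0.
have D : decode (enc_inst (nseq l'.+2 (wsize K (X x))) (expand K (X x) (fun=> N) (Sentence M l'))) =
    Some (nseq l'.+2 (wsize K (X x)), expand K (X x) (fun=> N) (Sentence M l')).
  apply/decodeP; split=> //; first by apply/allP => m /nseqP[->].
  have := @maxvar1_expand K 20 l'.+2 [::] (X x) (fun=> N) _ (envok_init (X x)).
  move=> /(_ (Sentence M l') (fun i => ltac:(by [])) wf) le.
  by apply: leq_trans le _; rewrite sumn_nseq /wsize [X in _ <= X]mulnC !mulnA.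
have U : UVAL l'.+2 (enc_inst (nseq l'.+2 (wsize K (X x))) (expand K (X x) (fun=> N) (Sentence M l'))) = Some b.
  set W := wsize K (X x) in D sY key *; set F := expand _ _ _ _ in D key *.
  have -> : UVAL l'.+2 (enc_inst (nseq l'.+2 W) F) = if size (nseq l W) == l then
      if [seq z <- words W | qval false (nseq l W) z F] is [:: z] then Some (head false z) else None
      else None by rewrite /UVAL D.
  rewrite size_nseq eqxx.
  have -> : [seq z <- words W | qval false (nseq l W) z F] = [:: Y].
    by apply: filter_words_unique sY _ => z sz; exact: key.
  (* The output is entry (0, 0) of relation 0 and hence the first bit of [Y], which is the bit
     returned by [UVAL]. *)
  congr Some; have : relof N Y 0 0 0 = b by rewrite relof_mkword.
  by rewrite /relof /= nth0.
move=> d; rewrite -/(X x) -/N -[K * (N * N)]/(wsize K (X x)) U => /= ->.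
exact: Pb.
Qed.
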